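(* Let $(\mathcal S,\mathcal M)$ be a disc with $n+3$ marked points on the boundary ($n\ge1$), $\mathcal T=\{\tau_1,\dots,\tau_n\}$ a triangulation whose quiver $Q$ is of type $A_n$, and $(B,\Lambda)$ the principal quantization pair of the signed adjacency matrix $\widetilde B$ of $\mathcal T$. For every arc $\gamma$ in $(\mathcal S,\mathcal M)$, the corresponding quantum cluster variable $x_\gamma\in\mathcal{A}_q(B,\Lambda)$ satisfies $$x_\gamma=\sum_{P\models\mathcal G_\gamma} M[\nu(P)],$$ the sum running over all perfect matchings $P$ of the snake graph $\mathcal G_\gamma$ of $\gamma$ (in particular all coefficients equal $1$).
   Context: Signed adjacency matrix: $\widetilde B=\sum_\Delta B^\Delta$ over triangles $\Delta$ of $\mathcal T$, where if the sides of $\Delta$ are $\tau_r,\tau_s,\tau_t$ in positive cyclic order then $B^\Delta$ has $b_{rs}=b_{st}=b_{tr}=1$, $b_{sr}=b_{ts}=b_{rt}=-1$, other entries $0$ (boundary segments are ignored). Principal quantization pair: $B=\begin{pmatrix}\widetilde B\\ I\end{pmatrix}$, $\Lambda=\begin{pmatrix}0&-I\\ I&-\widetilde B\end{pmatrix}$. Based quantum torus: $\mathbb{Z}[q^{\pm1/2}]$-algebra with basis $M[a]$, $a\in\mathbb{Z}^{2n}$, and $M[a]M[b]=q^{\frac12 a^T\Lambda b}M[a+b]$; $\mathcal{A}_q(B,\Lambda)$ is the Berenstein–Zelevinsky quantum cluster algebra with initial quantum cluster $x_i=M[e_i]$, $y_i=M[e_{n+i}]$, $i\in[1,n]$. Quantum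 cluster variables are in bijection with arcs, $\tau_i\mapsto x_i$, flips corresponding to quantum mutations. Snake graph (Musiker–Schiffler–Williams): if $\gamma$ crosses $\tau_{i_1},\dots,\tau_{i_k}$ in order, $\mathcal G_\gamma$ is obtained by gluing square tiles $G_1,\dots,G_k$, where $G_j$ has face weight $\tau_{i_j}$ and edge weights given by the four sides of the quadrilateral of $\mathcal T$ having $\tau_{i_j}$ as diagonal, consecutive tiles glued along the edge labelled by the third side of the triangle bounded by $\tau_{i_j},\tau_{i_{j+1}}$, with the standard MSW orientation convention. The perfect matchings form a distributive lattice whose minimal element $P_{min}$ consists only of boundary edges of $\mathcal G_\gamma$; $\mathrm{Twist}(P)$ is the set of tiles in the interior of the cycles of the symmetric difference $P\triangle P_{min}$. For a perfect matching $P$ let $x(P)=\prod_{e\in P}x_{w(e)}$ (boundary-segment weights contribute $1$) and $\mathrm{cross}(\gamma,\mathcal T)=\prod_j x_{i_j}$; then $\nu(P)=\big(\deg x(P)-\deg\mathrm{cross}(\gamma,\mathcal T),\ (|\mathrm{Twist}(P)_{\tau_i}|)_{i=1}^n\big)\in\mathbb{Z}^{2n}$, where $\deg$ is the exponent vector in $x_1,\dots,x_n$ and $\mathrm{Twist}(P)_{\tau_i}$ is the set of twisted tiles of face weight $\tau_i$.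
   Formalization: The formula is stated for arcs γ not in the triangulation T; for γ = τ_i there are no crossings, so the snake graph has no tiles and the sum as defined would be M[0] = 1 instead of x_i = M[e_i]. *)

(* Defs.v *)
From HB Require Import structures.
From mathcomp Require Import all_boot all_order all_algebra.
Set Implicit Arguments. Unset Strict Implicit. Unset Printing Implicit Defensive.
Import Order.TTheory GRing.Theory Num.Theory.

(* The disc with n+3 marked points = convex (n+3)-gon.  Marked points  *)
(* are 0,1,...,n+2, listed in POSITIVE (counterclockwise) cyclic order. *)
(* An arc is a diagonal, encoded as an ordered pair (x,y) with x < y.   *)

Section Polygon.
Variable n : nat.
Local Notation V := 'I_n.+3.
Definition pairV := (V * V)%type.

Definition ind (b : bool) : int := if b then 1 else 0.

Definition bseg (x y : V) : bool :=
  ((y : nat) == (x.+1 %% n.+3)) || ((x : nat) == (y.+1 %% n.+3)).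

Definition sd (x y : V) : pairV := if x < y then (x, y) else (y, x).

Definition is_arc (e : pairV) : bool := (e.1 < e.2) && ~~ bseg e.1 e.2.

Definition crossing (e f : pairV) : bool :=
  ((e.1 < f.1 < e.2) && (e.2 < f.2)) || ((f.1 < e.1 < f.2) && (f.2 < e.2)).

Definition triangulation (tau : 'I_n -> pairV) : bool :=
  [&& [forall i, is_arc (tau i)], injectiveb tau,
      [forall i, forall j, ~~ crossing (tau i) (tau j)] &
      [forall e : pairV,
         (is_arc e && [forall i, ~~ crossing e (tau i)]) ==> [exists i, tau i == e]]].

Definition in_T (tau : 'I_n -> pairV) (e : pairV) : bool := [exists i, tau i == e].

Definition present (tau : 'I_n -> pairV) (x y : V) : bool :=
  in_T tau (sd x y) || bseg x y.

(* triangles of T: a < b < c with all three sides present;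
   its sides in positive cyclic order are ab, bc, ca *)
Definition triangleT (tau : 'I_n -> pairV) (a b c : V) : bool :=
  [&& a < b, b < c, present tau a b, present tau b c & present tau c a].

(* contribution b^Delta_{rs} of the triangle with sides e1,e2,e3 (positive
   cyclic order); boundary segments never equal some tau_i, hence are ignored *)
Definition bDelta (tau : 'I_n -> pairV) (e1 e2 e3 : pairV) (r s : 'I_n) : int :=
  ind ((tau r == e1) && (tau s == e2)) + ind ((tau r == e2) && (tau s == e3))
  + ind ((tau r == e3) && (tau s == e1))
  - ind ((tau s == e1) && (tau r == e2)) - ind ((tau s == e2) && (tau r == e3))
  - ind ((tau s == e3) && (tau r == e1)).

Definition Btilde (tau : 'I_n -> pairV) : 'M[int]_n :=
  \matrix_(r, s) (\sum_(a : V) \sum_(b : V) \sum_(c : V)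
     (if triangleT tau a b c then bDelta tau (sd a b) (sd b c) (sd c a) r s else 0))%R.

(* the quiver Q of \widetilde B (arrows i -> j : [b_ij]_+) is of type A_n:
   its underlying graph is the path 1 - 2 - ... - n (after relabelling) *)
Definition quiver_typeA (B : 'M[int]_n) : Prop :=
  exists sigma : 'I_n -> 'I_n, bijective sigma /\
    forall i j, (B i j != 0) =
      (((sigma i : nat) == (sigma j).+1) || ((sigma j : nat) == (sigma i).+1)).

Definition Bprin (tau : 'I_n -> pairV) : 'M[int]_(n + n, n) :=
  col_mx (Btilde tau) 1%:M.
Definition Lprin (tau : 'I_n -> pairV) : 'M[int]_(n + n) :=
  block_mx 0 (- 1%:M) 1%:M (- Btilde tau).

Definition qform (L : 'M[int]_(n + n)) (a b : 'rV[int]_(n + n)) : int :=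
  (a *m L *m b^T) ord0 ord0.

(* flip of the arc tau_k: the unique other arc completing the
   remaining arcs to a triangulation *)
Definition flip (tau : 'I_n -> pairV) (k : 'I_n) : 'I_n -> pairV :=
  fun j => if j == k then
     odflt (tau k) [pick e : pairV | (e != tau k) &&
                     triangulation (fun i => if i == k then e else tau i)]
   else tau j.

Definition flips (tau : 'I_n -> pairV) (s : seq 'I_n) : 'I_n -> pairV :=
  foldl flip tau s.

Section Seeds.
Variable D : unitRingType.
Variable t : D.   (* t plays the role of q^{1/2} *)

Record qseed := QSeed {
  sB : 'M[int]_(n + n, n);
  sL : 'M[int]_(n + n);
  sX : 'I_(n + n) -> D }.

Definition frame (L : 'M[int]_(n + n)) (X : 'I_(n + n) -> D)
    (a : 'I_(n + n) -> int) : D :=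
  (t ^ (- \sum_(i < n + n) \sum_(j < n + n | (i < j)%N) a i * a j * L i j)
  * \prod_(i < n + n) X i ^ a i)%R.

Local Open Scope ring_scope.
Definition mutate (S : qseed) (k : 'I_n) : qseed :=
  let B := sB S in let L := sL S in let X := sX S in
  let kk := lshift n k in
  let B' := \matrix_(i, j) (if (i == kk) || (j == k) then - B i j
            else B i j + Num.max (B i k) 0 * Num.max (B kk j) 0
                 - Num.max (- B i k) 0 * Num.max (- B kk j) 0) in
  let E : 'M[int]_(n + n) := \matrix_(i, j) (if j != kk then ind (i == j)
            else if i == kk then -1 else Num.max 0 (- B i k)) in
  let L' := E^T *m L *m E in
  let X' := fun j => if j == kk then
        frame L X (fun i => - ind (i == kk) + Num.max (B i k) 0)
      + frame L X (fun i => - ind (i == kk) + Num.max (- B i k) 0)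
      else X j in
  QSeed B' L' X'.
Local Close Scope ring_scope.

Definition init_seed (tau : 'I_n -> pairV) (Mq : 'rV[int]_(n + n) -> D) : qseed :=
  QSeed (Bprin tau) (Lprin tau) (fun i => Mq (\row_j ind (j == i))%R).

Definition seeds (tau : 'I_n -> pairV) (Mq : 'rV[int]_(n + n) -> D)
   (s : seq 'I_n) : qseed := foldl mutate (init_seed tau Mq) s.

End Seeds.

(* Snake graph of an arc gamma = (a,b), a < b, traversed from a to b.  *)
Section Snake.
Variable tau : 'I_n -> pairV.
Variable gamma : pairV.
Local Notation a := gamma.1.
Local Notation b := gamma.2.

Definition inner_end (e : pairV) : V := if a < e.1 < b then e.1 else e.2.
Definition outer_end (e : pairV) : V := if a < e.1 < b then e.2 else e.1.
Definition along (i j : 'I_n) : bool :=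
  (inner_end (tau i) < inner_end (tau j)) ||
  ((inner_end (tau i) == inner_end (tau j)) &&
   ((a + n.+3 - outer_end (tau i)) %% n.+3 <= (a + n.+3 - outer_end (tau j)) %% n.+3)).

Definition cs : seq 'I_n :=
  sort along [seq i <- enum 'I_n | crossing (tau i) gamma].
Definition nk : nat := size cs.

Definition arcAt (j : nat) : pairV := nth (ord0, ord0) (map tau cs) j.

Definition oth (e f : pairV) : V := if (e.1 == f.1) || (e.1 == f.2) then e.2 else e.1.

Definition ccw3 (x y z : V) : bool := [|| x < y < z, y < z < x | z < x < y].

(* tile G_j (0-based): corners SW = u_j, NE = w_j, and SE, NW the
   endpoints of tau_{i_j}; orientations alternate, G_1 has relative
   orientation +1 (square orientation SW->SE->NE->NW agrees with the
   positive orientation of the quadrilateral) *)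
Definition uT (j : nat) : V := if j == 0 then a else oth (arcAt j.-1) (arcAt j).
Definition wT (j : nat) : V := if j == nk.-1 then b else oth (arcAt j.+1) (arcAt j).
Definition pf (j : nat) : V :=
  if ccw3 (uT j) (arcAt j).1 (wT j) then (arcAt j).1 else (arcAt j).2.
Definition po (j : nat) : V :=
  if ccw3 (uT j) (arcAt j).1 (wT j) then (arcAt j).2 else (arcAt j).1.
Definition seT (j : nat) : V := if ~~ odd j then pf j else po j.
Definition nwT (j : nat) : V := if ~~ odd j then po j else pf j.

(* polygon endpoints of side s of tile j: 0 = S, 1 = E, 2 = N, 3 = W *)
Definition side_ends (j : nat) (s : nat) : V * V :=
  match s with
  | 0 => (uT j, seT j) | 1 => (seT j, wT j) | 2 => (wT j, nwT j) | _ => (nwT j, uT j)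
  end.

(* edge weight: Some i if the side is tau_i, None for boundary segments *)
Definition label (j s : nat) : option 'I_n :=
  [pick i | tau i == sd (side_ends j s).1 (side_ends j s).2].

(* G_{j+1} is glued on the north (true) or east (false) side of G_j *)
Definition dirN (j : nat) : bool := oth (arcAt j) (arcAt j.+1) == nwT j.

(* lower-left corner of tile j in Z^2 *)
Fixpoint pos (j : nat) : int * int :=
  match j with
  | 0 => (0%R, 0%R)
  | j'.+1 => if dirN j' then ((pos j').1, ((pos j').2 + 1)%R)
             else (((pos j').1 + 1)%R, (pos j').2)
  end.

Definition edge := ('I_nk * 'I_4)%type.

Definition canon (e : edge) : bool :=
  let j := val e.1 in let s := val e.2 in
  [|| s == 1, s == 2,
      (s == 0) && ((j == 0) || ~~ dirN j.-1) |
      (s == 3) && ((j == 0) || dirN j.-1)].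

Definition ends (e : edge) : seq (int * int) :=
  let p := pos (val e.1) in let x := p.1 in let y := p.2 in
  (match val e.2 with
  | 0 => [:: (x, y); (x + 1, y)]
  | 1 => [:: (x + 1, y); (x + 1, y + 1)]
  | 2 => [:: (x, y + 1); (x + 1, y + 1)]
  | _ => [:: (x, y); (x, y + 1)]
  end)%R.

Definition corners (j : 'I_nk) : seq (int * int) :=
  let p := pos j in ([:: p; (p.1 + 1, p.2); (p.1, p.2 + 1); (p.1 + 1, p.2 + 1)])%R.

Definition perfect (P : {set edge}) : bool :=
  [forall e in P, canon e] &&
  [forall j : 'I_nk, all (fun v => #|[set e in P | v \in ends e]| == 1) (corners j)].

(* boundary edges of G_gamma (gluing edges are interior) *)
Definition boundary (e : edge) : bool :=
  let j := val e.1 in let s := val e.2 in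
  ~~ [|| (s == 1) && (j.+1 < nk) && ~~ dirN j | (s == 2) && (j.+1 < nk) && dirN j].

(* P_min: the perfect matching consisting of boundary edges only which
   contains the west edge of G_1 (= minimum of the lattice of perfect
   matchings for the above orientation convention) *)
Definition Pmin : {set edge} :=
  odflt set0 [pick P : {set edge} | [&& perfect P, [forall e in P, boundary e] &
        [exists e in P, (val e.1 == 0) && (val e.2 == 3)]]].

(* tiles in the interior of the cycles of P (+) P_min: the horizontal
   leftward ray from the centre of the tile meets an odd number of
   (vertical) edges of the symmetric difference *)
Definition twisted (P : {set edge}) (j : 'I_nk) : bool :=
  let Q := (P :\: Pmin) :|: (Pmin :\: P) in
  odd #|[set e in Q | ((val e.2 == 1) || (val e.2 == 3)) &&
        ((head (0%R, 0%R) (ends e)).2 == (pos j).2) &&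
        ((head (0%R, 0%R) (ends e)).1 <= (pos j).1)%R]|.

Definition nu (P : {set edge}) : 'rV[int]_(n + n) := (
  row_mx
    (\row_i ((#|[set e in P | label (val e.1) (val e.2) == Some i]|)%:Z
             - (count_mem i cs)%:Z))
    (\row_i (#|[set j : 'I_nk | twisted P j && (nth None (map Some cs) j == Some i)]|)%:Z))%R.

Definition snake_sum (D : unitRingType) (Mq : 'rV[int]_(n + n) -> D) : D :=
  (\sum_(P : {set edge} | perfect P) Mq (nu P))%R.

End Snake.
End Polygon.

(* Main.v *)
Require Import Defs.
From mathcomp Require Import all_boot all_order all_algebra.
From mathcomp Require Import zify ring.
Set Implicit Arguments. Unset Strict Implicit. Unset Printing Implicit Defensive.
Import Order.TTheory GRing.Theory Num.Theory.

(* A cluster variable is read off noncommutative lambda lengths [z x y] of the chords of the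
   polygon: pairings of vectors over the division ring that satisfy the Ptolemy relation of
   Berenstein and Retakh and that equal, in every seed, a sign times a power of [t] times a
   frame monomial, the coefficients entering through indicators of intervals. As [z] does not
   depend on the seed, a cluster variable only depends on its arc, so for [gamma = ab] one may
   flip the crossed arcs in order: the exchange relations then express the arcs from [a] to the
   successive triangles as sums of monomials, with two summands at each step. The sets of
   twisted tiles of the perfect matchings of the snake graph are the order ideals of a fence,
   which obey the same recursion. *)

(** The flip sequence [s] is arbitrary, so equal arcs must first be shown to carry equal variables.
    Frames of different seeds cannot be compared directly, since each mutation alters the
    commutation exponents. In a given seed [z x y] is known up to a power [t ^ m x y], where [m]
    depends on the seed and is antisymmetric. The two terms of a Ptolemy relation add up to an
    exchange relation only if they carry the same power of [t]; this is ensured by the triangle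
    relation [trirel], the shadow on exponents of [z x x = 0]. It is carried through the flips
    together with [Binv], which writes each column of [B], frozen rows included, as a ratio of
    products of opposite sides. The intervals come from intersection numbers with elementary
    laminations: twice the indicator of a chord is the sum of two vertex terms minus such a number,
    and vertex terms cancel in a quadrilateral. The expansion itself needs no record of the powers
    of [t], which are recovered from linear independence in the torus. On the side of matchings, the
    parity of a tile, due to alternating orientations, cancels against the direction of gluing, and
    only the end shared by consecutive arcs matters. *)

(** * Cyclic order of the vertices, decided by exhaustion over ranks *)

Definition cyc3 (a b c : nat) : bool :=
  [|| (a < b) && (b < c), (b < c) && (c < a) | (c < a) && (a < b)].
Definition cyc4 (a b c d : nat) : bool :=
  [|| [&& a < b, b < c & c < d], [&& b < c, c < d & d < a],
      [&& c < d, d < a & a < b] | [&& d < a, a < b & b < c]].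
Definition xing (x y u v : nat) : bool := cyc4 x u y v || cyc4 x v y u.

(* A statement about the relative order of finitely many naturals only depends on
   their ranks, so it can be checked by exhaustion over ranks. *)
Definition rank (s : seq nat) (x : nat) := count (fun z => z < x) (undup s).

Lemma rank_lt (s : seq nat) x y : x \in s -> y \in s -> (x < y) = (rank s x < rank s y).
Proof.
have mono x' y' : x' <= y' -> rank s x' <= rank s y'.
  by move=> h; apply: sub_count => z /leq_trans; apply.
move=> xs ys; have [xy|yx] := ltnP x y; last first.
  by apply/esym/negbTE; rewrite -leqNgt mono.
have us := undup_uniq s; rewrite -mem_undup in xs; apply/esym.
rewrite /rank; move: (undup s) us xs => u.
elim: u => [//|z u IH] /= /andP[zu uu]; rewrite inE => /orP[/eqP<-|xu].
  rewrite ltnn xy add0n add1n ltnS; apply: sub_count => z' /= h; exact: ltn_trans xy.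
rewrite -addnS leq_add // ?IH //.
by case h: (z < x) => //; rewrite (ltn_trans h xy).
Qed.

Lemma rank_eq (s : seq nat) x y : x \in s -> y \in s -> (x == y) = (rank s x == rank s y).
Proof.
by move=> xs ys; rewrite !eqn_leq leqNgt (rank_lt ys xs) -leqNgt
  [y <= x]leqNgt (rank_lt xs ys) -leqNgt.
Qed.

Lemma rank_bound (s : seq nat) x : x \in s -> rank s x < size s.
Proof.
move=> xs; apply: (@leq_trans (size (undup s))); last exact: size_undup.
rewrite -(count_predC (fun z => z < x) (undup s)) -[X in X < _]addn0 ltn_add2l -has_count.
by apply/hasP; exists x; rewrite ?mem_undup //= ltnn.
Qed.

Definition below k (P : nat -> bool) := all P (iota 0 k).
Lemma belowP k P : below k P -> forall a, a < k -> P a.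
Proof. by move/allP => h a ak; apply: h; rewrite mem_iota. Qed.

Lemma dec4 (P : nat -> nat -> nat -> nat -> bool) :
  below 4 (fun a => below 4 (fun b => below 4 (fun c => below 4 (P a b c)))) ->
  forall a, a < 4 -> forall b, b < 4 -> forall c, c < 4 -> forall d, d < 4 -> P a b c d.
Proof.
by move=> h a /(belowP h){}h b /(belowP h){}h c /(belowP h){}h d /(belowP h).
Qed.

Lemma dec5 (P : nat -> nat -> nat -> nat -> nat -> bool) :
  below 5 (fun a => below 5 (fun b => below 5 (fun c => below 5 (fun d => below 5 (P a b c d))))) ->
  forall a, a < 5 -> forall b, b < 5 -> forall c, c < 5 -> forall d, d < 5 ->
  forall e, e < 5 -> P a b c d e.
Proof.
by move=> h a /(belowP h){}h b /(belowP h){}h c /(belowP h){}h d /(belowP h){}h e /(belowP h).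
Qed.

Lemma dec6 (P : nat -> nat -> nat -> nat -> nat -> nat -> bool) :
  below 6 (fun a => below 6 (fun b => below 6 (fun c => below 6 (fun d =>
    below 6 (fun e => below 6 (P a b c d e)))))) ->
  forall a, a < 6 -> forall b, b < 6 -> forall c, c < 6 -> forall d, d < 6 ->
  forall e, e < 6 -> forall f, f < 6 -> P a b c d e f.
Proof.
by move=> h a /(belowP h){}h b /(belowP h){}h c /(belowP h){}h d /(belowP h){}h
  e /(belowP h){}h f /(belowP h).
Qed.

Lemma dec7 (P : nat -> nat -> nat -> nat -> nat -> nat -> nat -> bool) :
  below 7 (fun a => below 7 (fun b => below 7 (fun c => below 7 (fun d =>
    below 7 (fun e => below 7 (fun f => below 7 (P a b c d e f))))))) ->
  forall a, a < 7 -> forall b, b < 7 -> forall c, c < 7 -> forall d, d < 7 ->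
  forall e, e < 7 -> forall f, f < 7 -> forall g, g < 7 -> P a b c d e f g.
Proof.
by move=> h a /(belowP h){}h b /(belowP h){}h c /(belowP h){}h d /(belowP h){}h
  e /(belowP h){}h f /(belowP h){}h g /(belowP h).
Qed.

Ltac in_list := by rewrite ?inE ?eqxx ?orbT.
Ltac rank_pairs s x l :=
  lazymatch l with
  | nil => idtac
  | cons ?y ?l' =>
    rewrite ?(@rank_lt s x y) ?(@rank_eq s x y); try in_list; rank_pairs s x l'
  end.
Ltac rank_all s l :=
  lazymatch l with
  | nil => idtac
  | cons ?x ?l' => rank_pairs s x s; rank_all s l'
  end.
Ltac rank_move s l :=
  lazymatch l with
  | nil => idtac
  | cons ?x ?l' => rank_move s l';
     (have : (rank s x < size s)%N by apply: rank_bound; in_list); move: (rank s x)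
  end.
Ltac order_dec s :=
  rewrite /xing /cyc4 /cyc3; rank_all s s; rank_move s s; rewrite [size _]/=;
  first [refine (@dec4 _ _) | refine (@dec5 _ _) | refine (@dec6 _ _) | refine (@dec7 _ _)];
  vm_cast_no_check (erefl true).

(** A chord that enters the triangle through [bc] and cannot leave through the other two sides must
    end at [a]; its other end is then farther from [a] than [b], against the choice of [b] in
    [third_vertex]. *)
Lemma cyc_third (a b c u w : nat) :
  [&& cyc3 a b c, cyc4 b u c w, ~~ xing a c u w & ~~ xing a b u w] ==> (w == a) && cyc3 a u c && cyc3 a b u.
Proof. order_dec [:: a; b; c; u; w]. Qed.

Lemma cyc_diag (a b c d u v : nat) :
  [&& cyc4 a b c d, xing b d u v, ~~ xing a b u v, ~~ xing b c u v, ~~ xing c d u v & ~~ xing d a u v]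
  ==> (u == a) && (v == c) || (u == c) && (v == a).
Proof. order_dec [:: a; b; c; d; u; v]. Qed.

(* [thru]: the chord [p, q] crosses [a, b] and [p] lies in the interval;
   [ahead]: travelling from [a] to [b], one meets [p, q] not after [p', q']. *)
Definition thru (a b p q : nat) := [&& a < p, p < b & (q < a) || (b < q)].
Definition ahead (a p q p' q' : nat) := (p < p') || (p == p') && ((q == q') || cyc3 q' q a).

(** The chord [ab] leaves the triangle [p r q] through [rq] or [pr], according to the side on which
    [r] lies, and whatever it crosses later lies behind this exit side. *)
Lemma next_chord (a b p q r p' q' : nat) :
  [&& thru a b p q, thru a b p' q', cyc3 p r q, ~~ xing p r p' q', ~~ xing r q p' q',
    ~~ xing p q p' q', ahead a p q p' q' & ~~ ((p == p') && (q == q'))] ==>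
  (r != b) && (if (a < r) && (r < b) then ahead a r q p' q' else ahead a p r p' q').
Proof. rewrite /ahead /thru; order_dec [:: a; b; p; q; r; p'; q']. Qed.

(** * Triangulations and flips *)

Ltac ordlia := unfold xing, cyc4, cyc3 in *;
  repeat match goal with [x : ordinal _ |- _] =>
    lazymatch goal with
    | [H : is_true (leq (S (nat_of_ord x)) _) |- _] => fail
    | _ => pose proof (ltn_ord x) end end; lia.

Section Geometry.
Variable n : nat.
Local Notation V := 'I_n.+3.
Implicit Types (T : 'I_n -> pairV n) (x y u v a b c d : V).

Lemma cyc4_rot (a b c d : nat) : cyc4 a b c d = cyc4 b c d a.
Proof. by rewrite /cyc4; lia. Qed.

Lemma modS (x : V) : x.+1 %% n.+3 = if x.+1 == n.+3 then 0 else x.+1.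
Proof.
by case: eqP => [->|h]; rewrite ?modnn // modn_small //; have := ltn_ord x; lia.
Qed.

Lemma bsegE x y : bseg x y =
  [|| y == x.+1 :> nat, x == y.+1 :> nat, (x == n.+2 :> nat) && (y == 0 :> nat) |
      (y == n.+2 :> nat) && (x == 0 :> nat)].
Proof. by rewrite /bseg !modS; case: ifP => h1; case: ifP => h2; ordlia. Qed.

Lemma sdC x y : sd x y = sd y x.
Proof. by rewrite /sd; case: (ltngtP x y) => // /val_inj ->. Qed.

Lemma crossingE x y u v : crossing (sd x y) (sd u v) = xing x y u v.
Proof. by rewrite /crossing /sd; case: (ltnP x y) => h1; case: (ltnP u v) => h2 /=; ordlia. Qed.

Lemma sd_inj x y u v : sd x y = sd u v -> (x = u /\ y = v) \/ (x = v /\ y = u).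
Proof. by rewrite /sd; case: (ltnP x y) => _; case: (ltnP u v) => _ [-> ->]; auto. Qed.

Lemma sd_lt x y : x < y -> sd x y = (x, y).
Proof. by rewrite /sd => ->. Qed.

Lemma sd_surj (e : pairV n) : is_arc e -> e = sd e.1 e.2.
Proof. by case: e => x y /andP[/= h _]; rewrite sd_lt. Qed.

Lemma is_arc_sd x y : is_arc (sd x y) = (x != y) && ~~ bseg x y.
Proof.
by rewrite /is_arc /sd; case: (ltnP x y) => h /=; rewrite !bsegE -val_eqE /=; ordlia.
Qed.

Lemma bsegC x y : bseg x y = bseg y x.
Proof. by rewrite !bsegE; ordlia. Qed.

Lemma presentC T x y : present T x y = present T y x.
Proof. by rewrite /present sdC bsegC. Qed.

Lemma bseg_xing x y u v : bseg x y -> ~~ xing x y u v.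
Proof. by rewrite bsegE; ordlia. Qed.

Lemma xingC (x y u v : nat) : xing x y u v = xing u v x y.
Proof. by apply/idP/idP; apply/implyP; order_dec [:: x; y; u; v]. Qed.

Lemma eq_triangulation T1 T2 : T1 =1 T2 -> triangulation T1 = triangulation T2.
Proof.
move=> h; rewrite /triangulation.
congr [&& _, _, _ & _].
- by apply: eq_forallb => i; rewrite h.
- by apply/injectiveP/injectiveP => hi i j; [rewrite -!h|rewrite !h] => /hi.
- by apply: eq_forallb => i; apply: eq_forallb => j; rewrite !h.
- apply: eq_forallb => e; congr (_ && _ ==> _).
    by apply: eq_forallb => i; rewrite h.
  by apply: eq_existsb => i; rewrite h.
Qed.

Section Tri.
Variable T : 'I_n -> pairV n.
Hypothesis hT : triangulation T.

Lemma tri_arc i : is_arc (T i).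
Proof. by case/and4P: hT => /forallP. Qed.
Lemma tri_inj : injective T.
Proof. by case/and4P: hT => _ /injectiveP. Qed.
Lemma tri_nc i j : ~~ crossing (T i) (T j).
Proof. by case/and4P: hT => _ _ /forallP /(_ i) /forallP. Qed.
Lemma tri_max e : is_arc e -> (forall i, ~~ crossing e (T i)) -> exists i, T i = e.
Proof.
case/and4P: hT => _ _ _ /forallP /(_ e) /implyP h he hc.
by have /existsP[i /eqP] := h (introT andP (conj he (introT forallP hc))); exists i.
Qed.

Lemma tri_sd i : T i = sd (T i).1 (T i).2.
Proof. exact/sd_surj/tri_arc. Qed.

Lemma present_T i x y : T i = sd x y -> present T x y.
Proof. by move=> h; apply/orP; left; apply/existsP; exists i; rewrite h. Qed.

Lemma present_neq x y : present T x y -> x != y.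
Proof.
case/orP => [/existsP[i /eqP h]|]; last by rewrite bsegE -val_eqE /=; ordlia.
by have := tri_arc i; rewrite h is_arc_sd => /andP[].
Qed.

Lemma present_nc x y u v : present T x y -> present T u v -> ~~ xing x y u v.
Proof.
case/orP => [/existsP[i /eqP hi]|/bseg_xing h _]; last exact: h.
case/orP => [/existsP[j /eqP hj]|/bseg_xing h]; last by rewrite xingC.
by have := tri_nc i j; rewrite hi hj crossingE.
Qed.

Lemma present_max x y : x != y -> (forall i u v, T i = sd u v -> ~~ xing x y u v) ->
  present T x y.
Proof.
move=> xy h; rewrite /present; have [//|nb] := boolP (bseg x y); first by rewrite orbT.
have [] := @tri_max (sd x y); first by rewrite is_arc_sd xy.
  by move=> i; rewrite (tri_sd i) crossingE; apply: (h i); apply: tri_sd.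
by move=> i hi; rewrite orbF; apply/existsP; exists i; apply/eqP.
Qed.

Lemma succ_vertex a : exists s : V, bseg a s /\ forall v c, cyc3 a v c -> cyc3 a s c.
Proof.
have [h|h] := ltnP a.+1 n.+3.
  by exists (Ordinal h); split; [rewrite bsegE /= eqxx | move=> v c; rewrite /cyc3 /=; ordlia].
exists ord0; split; first by rewrite bsegE /=; ordlia.
by move=> v c; rewrite /cyc3 /=; ordlia.
Qed.

(** Among the vertices between [a] and [c] that are joined to [a], the farthest from [a] works: an
    arc crossing [bc] would come from [a] and end farther away, so [bc] is present by maximality of
    the triangulation. *)
Lemma third_vertex a c : present T a c -> (exists v, cyc3 a v c) ->
  exists b, [/\ cyc3 a b c, present T a b & present T b c].
Proof.
move=> hac [v hv]; have [s [sb /(_ v c hv) hs]] := succ_vertex a.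
(* Counterclockwise distance from [a]. The successor [s] of [a] makes the set of candidates
   nonempty. *)
pose dist (x : V) := if a <= x then x - a else x + n.+3 - a.
have sP : present T a s && cyc3 a s c by rewrite /present sb orbT.
case: (@arg_maxnP _ s (fun b => present T a b && cyc3 a b c) dist sP) => b /andP[ab abc] bmax.
exists b; split=> //; apply: present_max; first by rewrite -val_eqE /=; ordlia.
suff key i (u w : V) : T i = sd u w -> ~~ cyc4 b u c w.
  by move=> i u w hi; rewrite /xing negb_or !(key i) // sdC.
move=> hi; apply/negP => cr; have uw := present_T hi.
have := implyP (cyc_third a b c u w).
rewrite abc cr !present_nc // => /(_ isT) /andP[/andP[/eqP/val_inj wa auc] abu].
have au : present T a u && cyc3 a u c by rewrite -wa presentC uw wa auc.
by have := bmax u au; rewrite /dist; case: ifP => h5; case: ifP => h6; clear - abu h5 h6;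
  rewrite /geq /=; move: abu h5 h6 (ltn_ord a) (ltn_ord u) (ltn_ord (b : V)); rewrite /cyc3; lia.
Qed.

End Tri.
End Geometry.

Lemma cyc3_glue (a b c d : nat) : cyc3 a b c && cyc3 c d a ==> cyc4 a b c d.
Proof. order_dec [:: a; b; c; d]. Qed.

Lemma cyc4_neq (a b c d : nat) : cyc4 a b c d ==>
  [&& a != b, a != c, a != d, b != c, b != d & c != d].
Proof. order_dec [:: a; b; c; d]. Qed.

Lemma cyc4_xing (a b c d : nat) : cyc4 a b c d ==> xing b d a c && xing a c b d.
Proof. order_dec [:: a; b; c; d]. Qed.

Lemma cyc_flip_third (a b c d x : nat) :
  [&& cyc4 a b c d, x != a, x != b, x != c, x != d,
    ~~ xing b x c d, ~~ xing b x d a, ~~ xing d x a b & ~~ xing d x b c] ==> false.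
Proof. order_dec [:: a; b; c; d; x]. Qed.

(** * The flip of an arc in its quadrilateral *)

Section Flips.
Variable n : nat.
Local Notation V := 'I_n.+3.
Implicit Types (T : 'I_n -> pairV n) (k : 'I_n) (x y u v a b c d : V).

Lemma cyc4_sd a b c d : cyc4 a b c d ->
  [/\ sd a b != sd a c, sd b c != sd a c, sd c d != sd a c & sd d a != sd a c]
  /\ [/\ sd a b != sd b d, sd b c != sd b d, sd c d != sd b d & sd d a != sd b d].
Proof.
move/(implyP (cyc4_neq _ _ _ _)); rewrite !(inj_eq val_inj) => /and5P[ab ac ad bc /andP[bd cd]].
by split; split; apply/eqP => /sd_inj [] [] e1 e2; move: ab ac ad bc bd cd; subst; rewrite ?eqxx.
Qed.

Definition quad T k a b c d :=
  [&& cyc4 a b c d, T k == sd a c, present T a b, present T b c, present T c d & present T d a].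

Lemma quad_rot2 T k a b c d : quad T k a b c d -> quad T k c d a b.
Proof.
case/and5P=> h1 h2 h3 h4 /andP[h5 h6]; apply/and5P; split; rewrite ?h3 ?h4 ?h5 ?h6 //.
  by rewrite cyc4_rot cyc4_rot.
by rewrite [sd c a]sdC.
Qed.

Lemma arc_between a c : is_arc (sd a c) -> exists v, cyc3 a v c.
Proof.
rewrite is_arc_sd bsegE -val_eqE /= => h.
have [ac|ca] := ltnP a c.
  have lt : a.+1 < n.+3 by ordlia.
  by exists (Ordinal lt); rewrite /cyc3 /=; ordlia.
have [an|na] := ltnP a n.+2.
  have lt : a.+1 < n.+3 by ordlia.
  by exists (Ordinal lt); rewrite /cyc3 /=; ordlia.
by exists ord0; rewrite /cyc3 /=; ordlia.
Qed.

Section OneFlip.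
Variables (T : 'I_n -> pairV n) (k : 'I_n).
Hypothesis hT : triangulation T.

Lemma quad_exists : exists a b c d, quad T k a b c d.
Proof.
have e := tri_sd hT k; set a := (T k).1 in e; set c := (T k).2 in e.
have ar : is_arc (sd a c) by rewrite -e; apply: tri_arc.
have ac : present T a c by apply: present_T e.
have [b [abc ab bc]] := third_vertex hT ac (arc_between ar).
rewrite sdC in ar; rewrite presentC in ac.
have [d [cda cd da]] := third_vertex hT ac (arc_between ar).
exists a, b, c, d; apply/and5P; split; rewrite ?cd ?da ?e //.
by apply: (implyP (cyc3_glue _ _ _ _)); rewrite abc.
Qed.

Definition setarc (e : pairV n) : 'I_n -> pairV n := fun i => if i == k then e else T i.

Variables a b c d : V.
Hypothesis q : quad T k a b c d.

Lemma qcyc : cyc4 a b c d. Proof. by case/and5P: q. Qed.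
Lemma qk : T k = sd a c. Proof. by case/and5P: q => _ /eqP. Qed.
Lemma qab : present T a b. Proof. by case/and5P: q. Qed.
Lemma qbc : present T b c. Proof. by case/and5P: q. Qed.
Lemma qcd : present T c d. Proof. by case/and5P: q => _ _ _ _ /andP[]. Qed.
Lemma qda : present T d a. Proof. by case/and5P: q => _ _ _ _ /andP[]. Qed.
Lemma qac : present T a c. Proof. exact: present_T qk. Qed.

Lemma diag_nin i : T i <> sd b d.
Proof.
move=> e; have := present_nc hT (present_T e) qac.
by case/andP: (implyP (cyc4_xing _ _ _ _) qcyc) => ->.
Qed.

Lemma side_xing u v x y : present T x y -> sd x y != sd a c ->
  (forall j, j != k -> ~~ crossing (sd u v) (T j)) -> ~~ xing x y u v.
Proof.
move=> /orP[/existsP[j /eqP e]|/bseg_xing h] ne hj; last exact: h.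
rewrite xingC -crossingE -e; apply: hj; apply: contraNneq ne => jk.
by rewrite -e jk qk.
Qed.

Lemma xing_diag u v : (forall j, j != k -> ~~ crossing (sd u v) (T j)) ->
  xing a c u v -> sd u v = sd b d.
Proof.
move=> hj xac; have cy := qcyc; have [[h1 h2 h3 h4] _] := cyc4_sd cy.
have cy' : cyc4 d a b c by rewrite cyc4_rot.
have := implyP (cyc_diag d a b c u v).
rewrite cy' xac (side_xing qda h4 hj) (side_xing qab h1 hj) (side_xing qbc h2 hj) (side_xing qcd h3 hj).
by move/(_ isT)/orP => [] /andP[/eqP/val_inj-> /eqP/val_inj->]; rewrite // sdC.
Qed.

(** For maximality, a compatible arc either crosses [ac], and is then [bd] by [xing_diag], or
    belongs to [T] by maximality of [T]; in the second case it is not [ac], which crosses [bd]. *)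
Lemma setarc_triangulation : triangulation (setarc (sd b d)).
Proof.
have cy := qcyc.
have [/and5P[_ _ _ _ /andP[bd _]]] := implyP (cyc4_neq _ _ _ _) cy.
have [x1 x2] := andP (implyP (cyc4_xing _ _ _ _) cy).
have abd : is_arc (sd b d).
  rewrite is_arc_sd -(inj_eq val_inj) bd /=; apply: contraL x1; exact: bseg_xing.
have nc j : j != k -> ~~ crossing (sd b d) (T j).
  rewrite (tri_sd hT j) crossingE => jk; apply/negP => xg.
  have pj := present_T (tri_sd hT j).
  have := implyP (cyc_diag a b c d (T j).1 (T j).2).
  rewrite cy xg !(present_nc hT) ?qab ?qbc ?qcd ?qda // => /(_ isT) h.
  suff /(tri_inj hT)/eqP : T j = T k by rewrite (negbTE jk).
  rewrite qk (tri_sd hT j).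
  by case/orP: h => /andP[/eqP/val_inj-> /eqP/val_inj->]; rewrite // sdC.
apply/and4P; split.
- by apply/forallP => i; rewrite /setarc; case: eqP => // _; apply: tri_arc.
- apply/injectiveP => i j; rewrite /setarc; case: eqP => [->|_]; case: eqP => [->|_] //.
  + by move/esym/diag_nin.
  + by move/diag_nin.
  + by move/(tri_inj hT).
- apply/forallP => i; apply/forallP => j; rewrite /setarc.
  case: eqP => [_|/eqP ik]; case: eqP => [_|/eqP jk].
  + by rewrite crossingE; clear; apply/negP; ordlia.
  + exact: nc.
  + by rewrite (tri_sd hT i) crossingE xingC -crossingE -(tri_sd hT i); apply: nc.
  + exact: tri_nc.
apply/forallP => e; apply/implyP => /andP[ae /forallP he].
have hj j : j != k -> ~~ crossing (sd e.1 e.2) (T j).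
  by move=> jk; have := he j; rewrite /setarc (negbTE jk) -(sd_surj ae).
apply/existsP; case x : (xing a c e.1 e.2).
  by exists k; rewrite /setarc eqxx -(xing_diag hj x) -(sd_surj ae).
have [|i ei] := tri_max hT ae.
  move=> i; have [->|ik] := eqVneq i k; last by have := he i; rewrite /setarc (negbTE ik).
  by rewrite qk (sd_surj ae) crossingE xingC x.
exists i; rewrite /setarc; case: (i =P k) => [ik|_]; last by apply/eqP.
have := he k; rewrite /setarc eqxx -ei ik qk crossingE => h.
by rewrite xingC x1 in h.
Qed.

(** An arc completing the remaining ones must cross [ac]: otherwise the maximality of [T] would make
    it the arc [k] itself or a repetition of another one. *)
Lemma setarc_uniq e : e != T k -> triangulation (setarc e) -> e = sd b d.
Proof.
move=> ek te.
have ae : is_arc e by have := tri_arc te k; rewrite /setarc eqxx.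
have hj j : j != k -> ~~ crossing (sd e.1 e.2) (T j).
  by move=> jk; have := tri_nc te k j; rewrite /setarc eqxx (negbTE jk) -(sd_surj ae).
rewrite (sd_surj ae); apply: xing_diag => //; apply/negPn/negP => x.
have [|i ei] := tri_max hT ae.
  move=> i; have [->|ik] := eqVneq i k; last by rewrite (sd_surj ae) hj.
  by rewrite qk (sd_surj ae) crossingE xingC.
have [ik|ik] := eqVneq i k; first by rewrite -ei ik eqxx in ek.
have /(tri_inj te)/eqP : setarc e i = setarc e k by rewrite /setarc eqxx (negbTE ik).
by rewrite (negbTE ik).
Qed.

Lemma flipE : flip T k =1 setarc (sd b d).
Proof.
move=> j; rewrite /flip /setarc; case: eqP => // _.
case: pickP => [e /andP[ek te] | /(_ (sd b d))] /=; first exact: setarc_uniq.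
rewrite setarc_triangulation andbT => /negbFE/eqP/esym /diag_nin //.
Qed.

Lemma flip_triangulation : triangulation (flip T k).
Proof. by rewrite (eq_triangulation flipE) setarc_triangulation. Qed.

Lemma present_flip x y :
  present (flip T k) x y = (present T x y && (sd x y != sd a c)) || (sd x y == sd b d).
Proof.
have ac := tri_arc hT k; rewrite qk is_arc_sd in ac; case/andP: ac => _ ac.
rewrite /present /in_T; apply/idP/idP.
  case/orP => [/existsP[i]|bs].
    rewrite flipE /setarc; case: (i =P k) => [_ /eqP->|/eqP ik /eqP e]; first by rewrite eqxx orbT.
    apply/orP; left; apply/andP; split; first by apply/orP; left; apply/existsP; exists i; apply/eqP.
    by apply: contraNneq ik; rewrite -e -qk => /(tri_inj hT) ->.
  apply/orP; left; rewrite bs orbT /=; apply: contraNneq ac => /sd_inj.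
  by case=> [] [<- <-] //; rewrite bsegC.
case/orP => [/andP[/orP[/existsP[i /eqP e] ne|-> _]] | /eqP e]; last first.
- by apply/orP; left; apply/existsP; exists k; rewrite flipE /setarc eqxx e.
- by rewrite orbT.
apply/orP; left; apply/existsP; exists i; rewrite flipE /setarc.
by case: (i =P k) => [ik|_]; [rewrite -e ik qk eqxx in ne | apply/eqP].
Qed.

(** For an apex [x] outside the quadrilateral, one of [bx] and [dx] would cross a side of it. This
    controls all triangles on the new diagonal. *)
Lemma flip_third x : x != b -> x != d ->
  present (flip T k) b x -> present (flip T k) d x -> x = a \/ x = c.
Proof.
move=> xb xd; have [[h1 h2 h3 h4] [h5 h6 h7 h8]] := cyc4_sd qcyc => pb pd.
have ht := flip_triangulation.
have := implyP (cyc_flip_third a b c d x); rewrite qcyc !(inj_eq val_inj) xb xd.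
rewrite !(present_nc ht) // ?present_flip ?qab ?qbc ?qcd ?qda ?h1 ?h2 ?h3 ?h4 //.
by have [->|_] := eqVneq x a; [left | have [->|_ /(_ isT)] := eqVneq x c; [right|]].
Qed.

Lemma flip_neq j : j != k -> flip T k j = T j.
Proof. by rewrite flipE /setarc => /negbTE->. Qed.

Lemma flip_k : flip T k k = sd b d.
Proof. by rewrite flipE /setarc eqxx. Qed.

End OneFlip.

Lemma flip_tri T k : triangulation T -> triangulation (flip T k).
Proof. by move=> hT; have [a [b [c [d q]]]] := quad_exists k hT; apply: flip_triangulation q. Qed.

Lemma flips_rcons T s k : flips T (rcons s k) = flip (flips T s) k.
Proof. by rewrite /flips -cats1 foldl_cat. Qed.

Lemma flips_tri T s : triangulation T -> triangulation (flips T s).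
Proof.
move=> hT; elim/last_ind: s => [//|s k IH]; rewrite flips_rcons; exact: flip_tri.
Qed.

End Flips.

(** * Indicators of intervals and elementary laminations *)

Definition between (p q x : nat) : bool := (p < x) && ~~ (q < x).
Definition both (p q x y : nat) : bool := between p q x && between p q y.

(** The lamination of [pq] has both ends pushed off [p] and [q] in the same direction, so the
    vertices on one side of it form the half-open interval [between]. Twice [both] is the sum of the
    indicators of the two ends minus the number of crossings with the lamination; the vertex terms
    cancel, and the tropical Ptolemy relation of crossing numbers remains. *)
Lemma both_tropical (a b c d p q : nat) : cyc4 a b c d ==>
  (both p q a c + both p q b d == minn (both p q a b + both p q c d) (both p q b c + both p q d a)).
Proof. rewrite /both /between; order_dec [:: a; b; c; d; p; q]. Qed.

(** The shear coordinate of a lamination is 1 at its own arc, and 0 at the others by [both_other];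
    this is the identity block of the principal extension. *)
Lemma both_self (a b c d : nat) : cyc4 a b c d ==>
  let p := minn a c in let q := maxn a c in
  (both p q b c + both p q d a == (both p q a b + both p q c d).+1).
Proof.
rewrite /both /between /minn /maxn.
by case: (ltnP a c) => h; apply/implyP => h1 /=; move: h h1; rewrite leqNgt => h h1;
  apply/eqP; move: h h1; rewrite /cyc4; lia.
Qed.

Lemma both_other (a b c d p q : nat) :
  [&& cyc4 a b c d, p < q, ~~ xing a b p q, ~~ xing b c p q, ~~ xing c d p q, ~~ xing d a p q,
    ~~ xing a c p q, ~~ ((p == a) && (q == c)) & ~~ ((p == c) && (q == a))] ==>
  (both p q b c + both p q d a == both p q a b + both p q c d).
Proof. rewrite /both /between; order_dec [:: a; b; c; d; p; q]. Qed.

Lemma cyc_third_vertex (a b c d x : nat) :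
  [&& cyc4 a b c d, x != a, x != c, ~~ xing a x b c, ~~ xing a x c d,
    ~~ xing c x a b & ~~ xing c x d a] ==> (x == b) || (x == d).
Proof. order_dec [:: a; b; c; d; x]. Qed.

Lemma cyc3_sorted (a b c : nat) : cyc3 a b c ->
  ((a < b < c) + (b < c < a) + (c < a < b))%N = 1%N :> nat.
Proof. rewrite /cyc3; lia. Qed.

(** If the arc of the lamination does not cross [pq], the minimum in [both_tropical] is attained at
    the pair [aq], [pw]. By [both_fan] and [both_same] the pair [ap], [wq] attains it too when the
    triangle before [pq] has its apex between [a] and [p], except that it exceeds it by 1 for the
    lamination of [pq] itself. *)
Lemma both_far (a p w q x y : nat) : [&& cyc4 a p w q, x < y & ~~ xing p q x y] ==>
  (both x y a q + both x y p w == both x y p q + both x y a w).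
Proof. rewrite /both /between; order_dec [:: a; p; w; q; x; y]. Qed.

Lemma both_fan (a p w q u x y : nat) :
  [&& cyc4 a p w q, cyc4 a u p q, x < y, ~~ xing p q x y, ~~ xing w q x y, ~~ xing p w x y,
    ~~ xing u q x y, ~~ ((x == p) && (y == q)) & ~~ ((x == q) && (y == p))] ==>
  (both x y a p + both x y w q == both x y p q + both x y a w).
Proof. rewrite /both /between; order_dec [:: a; p; w; q; u; x; y]. Qed.

Lemma both_same (a p w q : nat) : cyc4 a p w q ==>
  let x := minn p q in let y := maxn p q in
  (both x y a p + both x y w q == (both x y p q + both x y a w).+1).
Proof.
rewrite /both /between /minn /maxn.
by case: (ltnP p q) => h; apply/implyP => h1 /=; move: h h1; rewrite leqNgt => h h1;
  apply/eqP; move: h h1; rewrite /cyc4; lia.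
Qed.

Lemma cyc4_insert (b d a c s : nat) : cyc4 b d a s && cyc4 a b c d ==> cyc4 b c a s.
Proof. order_dec [:: a; b; c; d; s]. Qed.
Lemma cyc4_insert' (b d a c s : nat) : cyc4 a b d s && cyc4 a b c d ==> cyc4 a c d s.
Proof. order_dec [:: a; b; c; d; s]. Qed.
Lemma cyc4_orient (a b c d s : nat) : cyc4 a b c d ==>
  [&& ~~ cyc4 b a d c, ~~ cyc4 b d c s, ~~ cyc4 d b a s, ~~ cyc4 a d b s, ~~ cyc4 c b d s,
      ~~ cyc4 b a d s & ~~ cyc4 d c b s].
Proof. order_dec [:: a; b; c; d; s]. Qed.

(** Since [z x y] has the sign given by [y < x], both terms of the Ptolemy relation for [bd] carry
    the sign of [z b d]. *)
Lemma cyc4_signs (a b c d : nat) : cyc4 a b c d ==>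
  ((a < b) (+) (a < c) (+) (d < c) == (d < b)) && ((c < b) (+) (c < a) (+) (d < a) == (d < b)).
Proof. order_dec [:: a; b; c; d]. Qed.

Lemma interval_split (a b c x y : nat) :
  [&& a < c, c < b, ~~ (x < a), ~~ (b < y), x < c, c < y, ~~ xing a c x y & ~~ xing c b x y]
  ==> (x == a) && (y == b).
Proof. order_dec [:: a; b; c; x; y]. Qed.

Lemma cyc_inside (a p w q x : nat) :
  [&& cyc4 a p w q & ~~ xing a x p q] ==> ~~ xing p w a x && ~~ xing w q a x.
Proof. order_dec [:: a; p; w; q; x]. Qed.

Lemma cyc4_next (a p w q w' : nat) : cyc4 a p w q ==>
  (cyc4 a w w' q ==> cyc4 p w w' q) && (cyc4 a p w' w ==> cyc4 q p w' w).
Proof. order_dec [:: a; p; w; q; w']. Qed.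

Lemma cyc4_ccw (u p w q : nat) : cyc4 u p w q ==> cyc3 u p w && ~~ cyc3 u q w.
Proof. order_dec [:: u; p; w; q]. Qed.

(** * The arcs crossed by a chord *)

Lemma next_crosses (a b p q r : nat) : [&& thru a b p q, cyc3 p r q & r != b] ==>
  (if (a < r) && (r < b) then [&& thru a b r q, ahead a p q r q, ~~ ahead a r q p q & xing r q a b]
   else [&& thru a b p r, ahead a p q p r, ~~ ahead a p r p q & xing p r a b]).
Proof. rewrite /ahead /thru; order_dec [:: a; b; p; q; r]. Qed.

Lemma prev_crosses (a b p q u : nat) : [&& thru a b p q, cyc3 q u p & u != a] ==>
  (if (a < u) && (u < b) then [&& thru a b u q, ~~ ahead a p q u q & xing u q a b]
   else [&& thru a b p u, ~~ ahead a p q p u & xing p u a b]).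
Proof. rewrite /ahead /thru; order_dec [:: a; b; p; q; u]. Qed.

Lemma thru_cyc (a b p q r : nat) : [&& thru a b p q & cyc3 p r q] ==> cyc4 a p r q && cyc4 a p b q.
Proof. rewrite /thru; order_dec [:: a; b; p; q; r]. Qed.

Lemma ahead_anti (a b p q p' q' : nat) :
  [&& thru a b p q, thru a b p' q', ahead a p q p' q' & ahead a p' q' p q] ==> (p == p') && (q == q').
Proof. rewrite /ahead /thru; order_dec [:: a; b; p; q; p'; q']. Qed.

Section Crossings.
Variables (n : nat) (tau : 'I_n -> pairV n).
Local Notation V := 'I_n.+3.
Hypothesis htau : triangulation tau.
Variables (gamma : pairV n).
Hypothesis hg : is_arc gamma.
Hypothesis hgT : ~~ in_T tau gamma.
Local Notation a := gamma.1.
Local Notation b := gamma.2.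
Local Notation cs := (cs tau gamma).
Local Notation K := (nk tau gamma).
Implicit Types (x y u v r : V).

Definition ip i := inner_end gamma (tau i).
Definition iq i := outer_end gamma (tau i).

Lemma gamma_lt : a < b. Proof. by case/andP: hg. Qed.

Lemma ends_of_thru i x y : tau i = sd x y -> thru a b x y -> ip i = x /\ iq i = y.
Proof.
rewrite /ip /iq /inner_end /outer_end => ->; have := gamma_lt.
by rewrite /sd /thru; case: (ltnP x y) => /= h1 h2 h3; case: ifP => h4; split => //; exfalso; lia.
Qed.

Lemma crossing_thru i : crossing (tau i) gamma -> thru a b (ip i) (iq i) /\ tau i = sd (ip i) (iq i).
Proof.
have e := tri_sd htau i; set x := (tau i).1 in e; set y := (tau i).2 in e => cr.
have : thru a b x y || thru a b y x.
  by move: cr (gamma_lt); rewrite /crossing -/x -/y /thru; lia.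
case/orP => h; first by have [-> ->] := ends_of_thru e h.
by rewrite sdC in e; have [-> ->] := ends_of_thru e h.
Qed.

Lemma mem_cs i : (i \in cs) = crossing (tau i) gamma.
Proof. by rewrite mem_sort mem_filter mem_enum andbT. Qed.

Lemma cs_uniq : uniq cs.
Proof. by rewrite sort_uniq filter_uniq // enum_uniq. Qed.

Lemma backdist (z : V) : z != a -> (a + n.+3 - z) %% n.+3 = if z < a then a - z else a + n.+3 - z.
Proof.
rewrite -(inj_eq val_inj) /=; have := ltn_ord z; have := ltn_ord a.
case: ifP => h1 h2 h3 h4; last by rewrite modn_small //; lia.
by rewrite -(modn_small (m := a - z) (d := n.+3)) -?(modnDr (a - z)); [congr (_ %% _); lia | lia].
Qed.

(** Trades distances modulo [n.+3] for plain comparisons, to which exhaustion over ranks applies. *)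
Lemma alongE i j : crossing (tau i) gamma -> crossing (tau j) gamma ->
  along tau gamma i j = ahead a (ip i) (iq i) (ip j) (iq j).
Proof.
move=> /crossing_thru[ti _] /crossing_thru[tj _]; rewrite /along -/(ip i) -/(ip j) -/(iq i) -/(iq j).
rewrite !backdist -?(inj_eq val_inj) /=; try (move: ti tj; rewrite /thru; have := gamma_lt; lia).
rewrite /ahead; congr (_ || _ && _).
move: ti tj; rewrite /thru /cyc3; have := ltn_ord (iq i); have := ltn_ord (iq j); have := gamma_lt.
by case: ifP => h1; case: ifP => h2; lia.
Qed.

Lemma along_trans : transitive (along tau gamma).
Proof.
move=> j i k; rewrite /along; set d := fun z : V => (a + n.+3 - z) %% n.+3.
rewrite -!/(d _) -!(inj_eq val_inj) /=; clear; lia.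
Qed.

Lemma along_total : total (along tau gamma).
Proof.
move=> i j; rewrite /along; set d := fun z : V => (a + n.+3 - z) %% n.+3.
rewrite -!/(d _) -!(inj_eq val_inj) /=; clear; lia.
Qed.

Lemma cs_sorted i0 j k : j < k < K -> along tau gamma (nth i0 cs j) (nth i0 cs k).
Proof.
case/andP=> jk kK; apply: (sorted_ltn_nth along_trans) => //; last by rewrite inE (ltn_trans jk).
exact: sort_sorted along_total _.
Qed.

Lemma cs_ahead_index i0 j k : j < K -> k < K ->
  ~~ ahead a (ip (nth i0 cs k)) (iq (nth i0 cs k)) (ip (nth i0 cs j)) (iq (nth i0 cs j)) -> j < k.
Proof.
move=> jK kK; rewrite -alongE -?mem_cs ?mem_nth // => h.
case: (ltngtP j k) => // [kj|e]; first by rewrite cs_sorted ?kj in h.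
by move: h; rewrite e; case/orP: (along_total (nth i0 cs k) (nth i0 cs k)) => ->.
Qed.

Lemma present_crossing x y : present tau x y -> xing x y a b ->
  exists i, tau i = sd x y /\ i \in cs.
Proof.
case/orP => [/existsP[i /eqP e] xg|/bseg_xing h xg]; last by rewrite (negbTE (h _ _)) in xg.
by exists i; split=> //; rewrite mem_cs e (sd_surj hg) crossingE.
Qed.

Lemma cs_nonempty : 0 < K.
Proof.
rewrite lt0n size_eq0; apply/negP => /eqP e.
have [i ei] : exists i, tau i = gamma.
  apply: (tri_max htau hg) => i; apply/negP => cr.
  have : i \in cs.
    by rewrite mem_cs; move: cr; rewrite (sd_surj hg) (tri_sd htau i) !crossingE xingC.
  by rewrite e.
by case/negP: hgT; apply/existsP; exists i; apply/eqP.
Qed.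

Section At.
Variables (i0 : 'I_n).
Let ind j := nth i0 cs j.
Let p j := ip (ind j).
Let q j := iq (ind j).

Lemma ind_cr j : j < K -> crossing (tau (ind j)) gamma.
Proof. by move=> jK; rewrite -mem_cs mem_nth. Qed.

Lemma cs_arc j : j < K -> tau (ind j) = sd (p j) (q j).
Proof. by move/ind_cr/crossing_thru => []. Qed.

Lemma cs_thru j : j < K -> thru a b (p j) (q j).
Proof. by move/ind_cr/crossing_thru => []. Qed.

Lemma arc_index i x y : tau i = sd x y -> i \in cs -> thru a b x y ->
  exists k, [/\ k < K, p k = x & q k = y].
Proof.
move=> e ic th; exists (index i cs); rewrite index_mem ic; have [e1 e2] := ends_of_thru e th.
by rewrite /p /q /ind nth_index.
Qed.

(** If the triangle before the first crossed arc had an apex other than [a], the chord would enter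
    it through another side, crossed earlier. *)
Lemma first_triangle : present tau a (p 0) /\ present tau (q 0) a.
Proof.
have K0 := cs_nonempty; have th := cs_thru K0; have e := cs_arc K0.
have pq : present tau (q 0) (p 0) by rewrite presentC; apply: present_T e.
have [u [cy p1 p2]] : exists u : V, [/\ cyc3 (q 0) u (p 0), present tau (q 0) u & present tau u (p 0)].
  apply: (third_vertex htau pq); exists a; move: th (gamma_lt); rewrite /thru /cyc3; lia.
have [ua|ua] := eqVneq u a; first by rewrite ua in p1 p2.
have := implyP (prev_crosses a b (p 0) (q 0) u); rewrite th cy (inj_eq val_inj) ua => /(_ isT).
have no x y : thru a b x y -> ~~ ahead a (p 0) (q 0) x y -> xing x y a b -> present tau x y -> False.
  move=> h1 h2 h3 /present_crossing /(_ h3) [i [ei ic]].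
  have [k [kK pk qk]] := arc_index ei ic h1.
  by have := @cs_ahead_index i0 k 0 kK K0; rewrite -/(p 0) -/(q 0) -/(p k) -/(q k) pk qk => /(_ h2).
case: ifP => _ /and3P[h1 h2 h3]; exfalso.
  by apply: no h1 h2 h3 _; rewrite presentC.
by apply: no h1 h2 h3 _; rewrite presentC.
Qed.

Lemma oth_shared x y z : x != y -> x != z -> oth (sd x y) (sd z y) = x.
Proof.
move=> xy xz; rewrite /oth /sd; case: (ltnP x y) => h1; case: (ltnP z y) => h2 /=;
by rewrite ?(negbTE xy) ?(negbTE xz) ?eqxx ?orbT.
Qed.

(** The chord either ends at the apex of the triangle beyond the arc [j] or leaves it through one of
    the other two sides. This exit side belongs to the triangulation, and by [next_chord] nothing is
    crossed before it, so it is the arc [j.+1]. *)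
Lemma next_triangle j : j < K -> exists r : V, [/\ cyc3 (p j) r (q j),
  present tau (p j) r, present tau r (q j) &
  j = K.-1 /\ r = b \/ [/\ j.+1 < K, (p j.+1 = r /\ q j.+1 = q j) \/ (p j.+1 = p j /\ q j.+1 = r)
    & r != b]].
Proof.
move=> jK; have th := cs_thru jK; have e := cs_arc jK.
have pq : present tau (p j) (q j) by apply: present_T e.
have [r [cy p1 p2]] : exists r : V, [/\ cyc3 (p j) r (q j), present tau (p j) r & present tau r (q j)].
  apply: (third_vertex htau pq); exists b; move: th (gamma_lt); rewrite /thru /cyc3; lia.
exists r; split=> //.
have later k : j < k < K -> [/\ r != b &
    if (a < r) && (r < b) then ahead a r (q j) (p k) (q k) else ahead a (p j) r (p k) (q k)].
  case/andP=> jk kK; have := implyP (next_chord a b (p j) (q j) r (p k) (q k)).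
  have pk := present_T (cs_arc kK).
  rewrite th (cs_thru kK) cy !(present_nc htau) // -alongE ?ind_cr // cs_sorted ?jk //=.
  suff -> : ~~ ((p j == p k :> nat) && (q j == q k :> nat)).
    by move=> /(_ isT) /andP[]; rewrite (inj_eq val_inj).
  apply/negP => /andP[/eqP/val_inj e1 /eqP/val_inj e2].
  have /(tri_inj htau)/eqP : tau (ind j) = tau (ind k) by rewrite !cs_arc // e1 e2.
  by rewrite nth_uniq ?cs_uniq // => /eqP jk'; rewrite jk' ltnn in jk.
have [rb|rb] := eqVneq r b.
  left; split=> //; apply/eqP; rewrite eqn_leq -ltnS prednK ?cs_nonempty // jK /=.
  rewrite leqNgt; apply/negP => h.
  have jK1 : j.+1 < K by move: h; clear; lia.
  by have [|h2 _] := later j.+1; [rewrite ltnSn | rewrite rb eqxx in h2].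
right.
(* The exit side is first found at some index [k] beyond [j]; by [later] and the antisymmetry of
   [ahead], this index is [j.+1]. *)
suff [k [jk kK pk]] : exists k, [/\ j < k, k < K &
    if (a < r) && (r < b) then p k = r /\ q k = q j else p k = p j /\ q k = r].
  have jK1 : j.+1 < K by apply: leq_ltn_trans kK.
  have ek : k = j.+1.
    apply/eqP; rewrite eqn_leq jk andbT leqNgt; apply/negP => h.
    have [|_ h1] := later j.+1; first by rewrite ltnSn.
    have := @cs_ahead_index i0 k j.+1 kK jK1.
    rewrite -/(p k) -/(q k) -/(p j.+1) -/(q j.+1).
    have h2 : ahead a (p j.+1) (q j.+1) (p k) (q k) by rewrite -alongE ?ind_cr // cs_sorted ?h.
    have := implyP (ahead_anti a b (p j.+1) (q j.+1) (p k) (q k)).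
    have -> : ahead a (p k) (q k) (p j.+1) (q j.+1) by move: pk h1; case: ifP => _ [-> ->].
    rewrite h2 !cs_thru // => /(_ isT) /andP[/eqP/val_inj e1 /eqP/val_inj e2] _.
    have /(tri_inj htau)/eqP : tau (ind k) = tau (ind j.+1) by rewrite !cs_arc // e1 e2.
    by rewrite nth_uniq ?cs_uniq // => /eqP e3; rewrite e3 ltnn in h.
  by split=> //; rewrite -ek; move: pk; case: ifP => _; [left | right].
have := implyP (next_crosses a b (p j) (q j) r); rewrite th cy (inj_eq val_inj) rb => /(_ isT).
case: ifP => _ /and4P[h1 h2 h3 h4].
  have [i [ei ic]] := present_crossing p2 h4; have [k [kK pk qk]] := arc_index ei ic h1.
  exists k; split=> //; apply: (@cs_ahead_index i0) => //.
  by rewrite -/(p k) -/(q k) -/(p j) -/(q j) pk qk.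
have [i [ei ic]] := present_crossing p1 h4; have [k [kK pk qk]] := arc_index ei ic h1.
exists k; split=> //; apply: (@cs_ahead_index i0) => //.
by rewrite -/(p k) -/(q k) -/(p j) -/(q j) pk qk.
Qed.

End At.
End Crossings.

(** * Perfect matchings of a snake graph *)

Lemma sum_near (K j0 : nat) (F : nat -> nat) : j0 < K ->
  (forall j, j != j0 -> j != j0.+1 -> j.+1 != j0 -> F j = 0) -> (forall j, K <= j -> F j = 0) ->
  \sum_(j < K) F j = (if j0 is j'.+1 then F j' else 0) + F j0 + F j0.+1.
Proof.
move=> jK h0 hK.
have -> : \sum_(j < K) F j = \sum_(0 <= j < j0.+2) F j.
  rewrite -(big_mkord xpredT F).
  have [le|lt] := leqP K j0.+2.
    rewrite [RHS](big_cat_nat (n := K)) //= [X in _ + X]big_nat_cond [X in _ + X]big1 ?addn0 //.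
    by move=> j /andP[/andP[/hK]].
  rewrite (big_cat_nat (n := j0.+2)) //=; last exact: ltnW.
  rewrite [X in _ + X]big_nat_cond [X in _ + X]big1 ?addn0 //.
  by move=> j /andP[/andP[h1 h2] _]; apply: h0; apply/eqP; lia.
rewrite !big_nat_recr //=; congr (_ + _ + _).
case: j0 h0 {jK} => [|j1] h0; first by rewrite big_geq.
rewrite big_nat_recr //= big_nat_cond big1 // => j /andP[/andP[_ h] _].
by apply: h0; apply/eqP; lia.
Qed.

Section Matchings.
Variables (n : nat) (tau : 'I_n -> pairV n) (gamma : pairV n).
Local Notation K := (nk tau gamma).
Local Notation dN := (dirN tau gamma).
Local Notation ps := (pos tau gamma).
Local Notation edg := (edge tau gamma).
Hypothesis K0 : 0 < K.
Implicit Types (P : {set edg}) (I : nat -> bool).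

(** With natural indices the neighbouring tiles [j.-1] and [j.+1] can be named without bounds; out
    of range the answer is false. *)
Definition emem P (j s : nat) := [exists e in P, (val e.1 == j) && (val e.2 == s)].

Lemma ememE P (e : edg) : emem P (val e.1) (val e.2) = (e \in P).
Proof.
apply/existsP/idP => [[e' /and3P[h /eqP/val_inj h1 /eqP/val_inj h2]]|h].
  by rewrite [e]surjective_pairing -h1 -h2 -surjective_pairing.
by exists e; rewrite h !eqxx.
Qed.

Lemma emem_out P j s : K <= j -> emem P j s = false.
Proof.
by move=> h; apply/existsP => -[e /and3P[_ /eqP e1 _]]; have := ltn_ord e.1; rewrite e1 ltnNge h.
Qed.

Lemma card_edges P (Q : nat -> nat -> bool) :
  #|[set e in P | Q (val e.1) (val e.2)]| = \sum_(j < K) \sum_(s < 4) (emem P j s && Q j s).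
Proof.
rewrite -sum1dep_card big_mkcond pair_big /=; apply: eq_bigr => e _.
by rewrite ememE; case: (_ && _).
Qed.

Definition endsN (c : int * int) (s : nat) : seq (int * int) :=
  let x := c.1 in let y := c.2 in
  (match s with
  | 0 => [:: (x, y); (x + 1, y)]
  | 1 => [:: (x + 1, y); (x + 1, y + 1)]
  | 2 => [:: (x, y + 1); (x + 1, y + 1)]
  | _ => [:: (x, y); (x, y + 1)]
  end)%R.

Definition deg P v := #|[set e in P | v \in ends e]|.

Lemma degE P v : deg P v =
  \sum_(j < K) \sum_(s < 4) (emem P j s && (v \in endsN (ps j) s)).
Proof. exact: (card_edges P (fun j s => v \in endsN (ps j) s)). Qed.

(** The snake only goes right or up, so the tile [j] occupies the antidiagonals [j] to [j.+2], and a
    vertex on the antidiagonal [j.+1] can only touch the tiles [j.-1], [j] and [j.+1]. *)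
Lemma pos_sum j : ((ps j).1 + (ps j).2 = j%:Z)%R.
Proof. by elim: j => [|j IH] //=; case: ifP => _ /=; lia. Qed.

Lemma posS j : ps j.+1 = if dN j then ((ps j).1, (ps j).2 + 1)%R else ((ps j).1 + 1, (ps j).2)%R.
Proof. by []. Qed.

Definition tdeg P v j := \sum_(s < 4) (emem P j s && (v \in endsN (ps j) s)) : nat.

Lemma tdegE P v j : tdeg P v j =
  (emem P j 0 && (v \in endsN (ps j) 0)) + (emem P j 1 && (v \in endsN (ps j) 1)) +
  (emem P j 2 && (v \in endsN (ps j) 2)) + (emem P j 3 && (v \in endsN (ps j) 3)).
Proof. by rewrite /tdeg !big_ord_recl big_ord0 /= addn0 !addnA. Qed.

Definition SE j := ((ps j).1 + 1, (ps j).2)%R.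
Definition NW j := ((ps j).1, (ps j).2 + 1)%R.
Definition NE j := ((ps j).1 + 1, (ps j).2 + 1)%R.

Lemma deg_near P v j0 : j0 < K -> (v.1 + v.2 = j0.+1%:Z)%R ->
  deg P v = (if j0 is j'.+1 then tdeg P v j' else 0) + tdeg P v j0 + tdeg P v j0.+1.
Proof.
move=> jK hv; rewrite degE; apply: (sum_near (F := tdeg P v)) => // j.
  move=> h1 h2 h3; rewrite tdegE; have := pos_sum j; case: (ps j) => x y /= hxy.
  by case: v hv => v1 v2 /= hv; rewrite /endsN /= !inE !xpair_eqE; lia.
by move=> h; rewrite /tdeg big1 // => s _; rewrite emem_out.
Qed.

Lemma deg_SE P j : j < K -> deg P (SE j) =
  (if j is j'.+1 then dN j' * (emem P j' 1 + emem P j' 2) else 0) + (emem P j 0 + emem P j 1)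
  + ~~ dN j * (emem P j.+1 0 + emem P j.+1 3).
Proof.
move=> jK; rewrite (deg_near _ jK) /SE /=; last by have := pos_sum j; lia.
rewrite !tdegE posS; congr (_ + _ + _).
- case: j jK => [//|j] jK; rewrite tdegE posS; case: (ps j) => x y.
  by case: (dN j) => /=; rewrite /endsN /= !inE !xpair_eqE; lia.
- by case: (ps j) => x y /=; rewrite /endsN /= !inE !xpair_eqE; lia.
by case: (ps j) => x y; case: (dN j) => /=; rewrite /endsN /= !inE !xpair_eqE; lia.
Qed.

Lemma deg_NW P j : j < K -> deg P (NW j) =
  (if j is j'.+1 then ~~ dN j' * (emem P j' 1 + emem P j' 2) else 0) + (emem P j 3 + emem P j 2)
  + dN j * (emem P j.+1 0 + emem P j.+1 3).
Proof.
move=> jK; rewrite (deg_near _ jK) /NW /=; last by have := pos_sum j; lia.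
rewrite !tdegE posS; congr (_ + _ + _).
- case: j jK => [//|j] jK; rewrite tdegE posS; case: (ps j) => x y.
  by case: (dN j) => /=; rewrite /endsN /= !inE !xpair_eqE; lia.
- by case: (ps j) => x y /=; rewrite /endsN /= !inE !xpair_eqE; lia.
by case: (ps j) => x y; case: (dN j) => /=; rewrite /endsN /= !inE !xpair_eqE; lia.
Qed.

Lemma sum_only (F : nat -> nat) j0 : j0 < K -> (forall j, j != j0 -> F j = 0) ->
  \sum_(j < K) F j = F j0.
Proof.
move=> jK h; rewrite (bigD1 (Ordinal jK)) //= big1 ?addn0 // => j hj; apply: h.
by rewrite -[j0]/(val (Ordinal jK)) (inj_eq val_inj).
Qed.

Lemma deg_first P : deg P (ps 0) = emem P 0 0 + emem P 0 3.
Proof.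
rewrite degE (sum_only (F := tdeg P (ps 0)) K0) => [|j hj]; rewrite tdegE.
  by rewrite /endsN /= !inE !xpair_eqE; lia.
have := pos_sum j; case: (ps j) => x y /= hxy.
by rewrite /endsN /= !inE !xpair_eqE; lia.
Qed.

Lemma deg_last P : deg P (NE K.-1) = emem P K.-1 1 + emem P K.-1 2.
Proof.
have jK : K.-1 < K by rewrite ltn_predL.
rewrite degE.
have -> : \sum_(j < K) \sum_(s < 4) (emem P j s && (NE K.-1 \in endsN (ps j) s)) = tdeg P (NE K.-1) K.-1.
  rewrite (bigD1 (Ordinal jK)) //= [X in _ + X]big1 ?addn0 // => j hj; rewrite -/(tdeg P _ j) tdegE.
  have jl : j < K.-1.
    by move: (ltn_ord j) hj; rewrite -(inj_eq val_inj) /=; lia.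
  rewrite /NE; have := pos_sum j; have := pos_sum K.-1; case: (ps j) => x y /=.
  by case: (ps K.-1) => x' y' /=; rewrite /endsN /= !inE !xpair_eqE; lia.
by rewrite tdegE /NE; case: (ps K.-1) => x y; rewrite /endsN /= !inE !xpair_eqE; lia.
Qed.

End Matchings.

(** * Perfect matchings encoded by one bit per tile *)

Section Bits.
Variables (n : nat) (tau : 'I_n -> pairV n) (gamma : pairV n).
Local Notation K := (nk tau gamma).
Local Notation dN := (dirN tau gamma).
Local Notation ps := (pos tau gamma).
Local Notation edg := (edge tau gamma).
Hypothesis K0 : 0 < K.
Implicit Types (P : {set edg}) (I : nat -> bool).

Local Notation SE := (SE tau gamma).
Local Notation NW := (NW tau gamma).
Local Notation NE := (NE tau gamma).

(** Apart from its first and last corners, the snake has just the two vertices [SE j] and [NW j] on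
    each antidiagonal, so every vertex is listed once although it may lie on several tiles. *)
Lemma perfectP P : reflect
  [/\ forall e, e \in P -> canon e, deg P (ps 0) = 1, deg P (NE K.-1) = 1,
    forall j, j < K -> deg P (SE j) = 1 & forall j, j < K -> deg P (NW j) = 1]
  (perfect P).
Proof.
apply: (iffP andP) => [[/forallP h1 /forallP h2]|[h1 hs he hse hnw]].
  have cor j (jK : j < K) : [/\ deg P (ps j) = 1, deg P (SE j) = 1, deg P (NW j) = 1 & deg P (NE j) = 1].
    by have := h2 (Ordinal jK); rewrite /corners /= -!/(deg _ _) => /and5P[/eqP-> /eqP-> /eqP-> /eqP->].
  split=> [e eP||| |].
  - exact: (implyP (h1 e)).
  - by have [] := cor 0 K0.
  - by have [] := cor K.-1; rewrite // ltn_predL.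
  - by move=> j /cor[].
  - by move=> j /cor[].
split; first by apply/forallP => e; apply/implyP; apply: h1.
apply/forallP => j; rewrite /corners /= -!/(deg _ _) andbT.
have jK := ltn_ord j; rewrite -/(SE j) -/(NW j) -/(NE j) hse // hnw // !eqxx /=; apply/andP; split.
  case: (nat_of_ord j) jK => [|i] iK; first by rewrite hs.
  by rewrite posS; case: ifP => _; [rewrite -/(NW i) hnw | rewrite -/(SE i) hse]; rewrite ?(ltnW iK).
have [lt|ge] := ltnP j.+1 K.
  have -> : NE j = if dN j then SE j.+1 else NW j.+1.
    by rewrite /NE /SE /NW posS; case: (dN j).
  by case: ifP => _; rewrite ?hse ?hnw.
have -> : nat_of_ord j = K.-1 by move: jK ge; clear; lia.
by rewrite he.
Qed.

(** In [Pmin] the corner [SE j] is matched forwards on even tiles and backwards on odd ones; adding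
    the parity turns the twist of a tile into this direction. *)
Definition xbit I j := I j (+) odd j.
Definition cS j := (j == 0) || ~~ dN j.-1.
Definition cW j := (j == 0) || dN j.-1.

(* The matching whose set of twisted tiles is [I]: on the tile [j] the corner [SE j] is
   matched to an earlier vertex if [xbit I j], and to a later one otherwise. *)
Definition hm I (j s : nat) : bool :=
  match s with
  | 0 => cS j && xbit I j
  | 1 => ~~ xbit I j && ~~ [&& ~~ dN j, j.+1 < K & xbit I j.+1]
  | 2 => xbit I j && ~~ [&& dN j, j.+1 < K & ~~ xbit I j.+1]
  | _ => cW j && ~~ xbit I j
  end.
Definition hP I : {set edg} := [set e | hm I (val e.1) (val e.2)].

Lemma cSS j : cS j.+1 = ~~ dN j. Proof. by []. Qed.
Lemma cWS j : cW j.+1 = dN j. Proof. by []. Qed.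

(** Across a north gluing the only later neighbour of [SE j] is [SE j.+1], across an east gluing
    that of [NW j] is [NW j.+1]. If this corner is matched forwards, the next bit is forced. *)
Definition closedI I := forall j, j.+1 < K ->
  if dN j then xbit I j || xbit I j.+1 else ~~ (xbit I j && xbit I j.+1).

Lemma emem_hP I j s : s < 4 -> emem (hP I) j s = (j < K) && hm I j s.
Proof.
move=> s4; case: (ltnP j K) => jK; last by rewrite emem_out.
by rewrite -[j]/(val (Ordinal jK)) -[s in LHS]/(val (Ordinal s4)) (ememE (hP I) (Ordinal jK, Ordinal s4)) inE.
Qed.

Lemma emem_canon P j s : (forall e, e \in P -> canon e) -> emem P j s ->
  [|| s == 1, s == 2, (s == 0) && cS j | (s == 3) && cW j].
Proof. by move=> h /existsP[e /and3P[/h ce /eqP <- /eqP <-]]. Qed.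

Lemma hP_canon I e : e \in hP I -> canon e.
Proof.
rewrite inE; case: e => j s; rewrite /canon /= /hm /cS /cW.
by case: s => -[|[|[|[|//]]]] ? /= => [/andP[->]|_|_|/andP[-> _]]; rewrite ?orbT.
Qed.

Lemma hP_perfect I : closedI I -> perfect (hP I).
Proof.
move=> cl; apply/perfectP; split.
- exact: hP_canon.
- by rewrite (deg_first K0) !emem_hP // K0 /hm /cS /cW /=; case: (xbit I 0).
- rewrite (deg_last K0) !emem_hP // ltn_predL K0 /hm /= prednK // ltnn /= !andbF /= !andbT.
  by case: (xbit _ _).
- move=> j jK; rewrite deg_SE // !emem_hP // jK /=.
  have -> : (if j is j'.+1 then dN j' * (emem (hP I) j' 1 + emem (hP I) j' 2) else 0)
      = (~~ cS j && xbit I j).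
    case: j jK => [//|j] jK; rewrite !emem_hP // (ltnW jK) /hm /cS /= jK.
    by have := cl j jK; case: (dN j); case: (xbit I j); case: (xbit I j.+1).
  rewrite /hm !cSS !cWS; have [lt|ge] := ltnP j.+1 K.
    by have := cl j lt; case: (cS j); case: (dN j); case: (xbit I j); case: (xbit I j.+1).
  by case: (cS j); case: (dN j); case: (xbit I j).
move=> j jK; rewrite deg_NW // !emem_hP // jK /=.
have -> : (if j is j'.+1 then ~~ dN j' * (emem (hP I) j' 1 + emem (hP I) j' 2) else 0)
    = (~~ cW j && ~~ xbit I j).
  case: j jK => [//|j] jK; rewrite !emem_hP // (ltnW jK) /hm /cW /= jK.
  by have := cl j jK; case: (dN j); case: (xbit I j); case: (xbit I j.+1).
rewrite /hm !cSS !cWS; have [lt|ge] := ltnP j.+1 K.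
  by have := cl j lt; case: (cW j); case: (dN j); case: (xbit I j); case: (xbit I j.+1).
by case: (cW j); case: (dN j); case: (xbit I j).
Qed.

(** After the first tile, exactly one of the south and west sides is not glued to the preceding
    tile, and by the formula of [hm] this side tells the bit. *)
Definition xP P j := if cS j then emem P j 0 else ~~ emem P j 3.
Definition bitsP P j := xP P j (+) odd j.

Lemma xbit_bitsP P j : xbit (bitsP P) j = xP P j.
Proof. by rewrite /xbit /bitsP -addbA addbb addbF. Qed.

(** Along the snake exactly one of [SE j] and [NW j] is matched backwards; the other one must be
    matched forwards, which determines the edges tile by tile. *)
Lemma perfect_hP P : perfect P -> closedI (bitsP P) /\ P = hP (bitsP P).
Proof.
move=> /perfectP[ca d0 dl dse dnw].
have nS j : ~~ cS j -> emem P j 0 = false.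
  by move=> h; case mm: (emem _ _ _) => //; have := emem_canon ca mm; rewrite /= (negbTE h).
have nW j : ~~ cW j -> emem P j 3 = false.
  by move=> h; case mm: (emem _ _ _) => //; have := emem_canon ca mm; rewrite /= (negbTE h).
(* The numbers [a j] and [c j] count the edges from [SE j], respectively [NW j], to earlier
   vertices. *)
pose a j := (if j is j'.+1 then dN j' * (emem P j' 1 + emem P j' 2) else 0) + emem P j 0.
pose c j := (if j is j'.+1 then ~~ dN j' * (emem P j' 1 + emem P j' 2) else 0) + emem P j 3.
have step j : j < K -> a j = xP P j -> c j = ~~ xP P j -> j.+1 < K ->
   [/\ a j.+1 = xP P j.+1, c j.+1 = ~~ xP P j.+1,
     emem P j 1 = hm (bitsP P) j 1, emem P j 2 = hm (bitsP P) j 2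
     & if dN j then xP P j || xP P j.+1 else ~~ (xP P j && xP P j.+1)].
  move=> jK ha hc jK1; have := dse j jK; have := dnw j jK.
  rewrite deg_SE // deg_NW // /a /c in ha hc *.
  have -> u1 u2 u3 u4 : u1 + (u2 + u3) + u4 = (u1 + u2) + u3 + u4 :> nat by rewrite addnA.
  have -> u1 u2 u3 u4 : u1 + (u2 + u3) + u4 = (u1 + u2) + u3 + u4 :> nat by rewrite addnA.
  rewrite ha hc /hm !xbit_bitsP jK1.
  have xS : xP P j.+1 = if dN j then ~~ emem P j.+1 3 else emem P j.+1 0.
    by rewrite /xP cSS; case: (dN j).
  have h1 : dN j -> emem P j.+1 0 = false by move=> d; apply: nS; rewrite cSS d.
  have h2 : ~~ dN j -> emem P j.+1 3 = false by move=> d; apply: nW; rewrite cWS.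
  rewrite xS; case: (dN j) h1 h2 => /= [/(_ isT) -> _|_ /(_ isT) ->];
  case: (xP P j); case: (emem P j 1); case: (emem P j 2) => //;
  by [case: (emem P j.+1 0) => // _ _; split | case: (emem P j.+1 3) => // _ _; split].
have inv j : j < K -> a j = xP P j /\ c j = ~~ xP P j.
  elim: j => [|j IH] jK; last by have [h1 h2] := IH (ltnW jK); have [] := step j (ltnW jK) h1 h2 jK.
  rewrite (deg_first K0) in d0; rewrite /a /c /xP /cS /= !add0n.
  by move: d0; case: (emem P 0 0); case: (emem P 0 3) => // _; split.
have lastE : emem P K.-1 1 = hm (bitsP P) K.-1 1 /\ emem P K.-1 2 = hm (bitsP P) K.-1 2.
  have jK : K.-1 < K by rewrite ltn_predL.
  have [ha hc] := inv _ jK; have := dse _ jK; have := dnw _ jK.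
  have out s : emem P K.-1.+1 s = false by apply: emem_out; rewrite prednK.
  rewrite deg_SE // deg_NW // !out !muln0 !addn0 !addnA.
  rewrite -/(a K.-1) -/(c K.-1) ha hc /hm !xbit_bitsP prednK // ltnn !andbF !andbT.
  by case: (xP _ _); case: (emem _ _ 1); case: (emem _ _ 2).
split.
  move=> j jK1; have [h1 h2] := inv j (ltnW jK1).
  by rewrite !xbit_bitsP; have [] := step j (ltnW jK1) h1 h2 jK1.
apply/setP => e; rewrite inE -ememE; case: e => j s /=; have jK := ltn_ord j.
have [h1 h2] := inv j jK.
have EN : emem P j 1 = hm (bitsP P) j 1 /\ emem P j 2 = hm (bitsP P) j 2.
  have [lt|ge] := ltnP j.+1 K; first by have [] := step j jK h1 h2 lt.
  by have -> : nat_of_ord j = K.-1 by move: jK ge; clear; lia.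
case: s => -[|[|[|[|//]]]] hs /=; try (by case: EN).
  rewrite xbit_bitsP /xP; case: ifP => // h; apply: nS; by rewrite h.
rewrite xbit_bitsP /xP.
have [cw|cw] := boolP (cW j); last by rewrite nW.
case: ifP => /= [cs|_]; last by rewrite negbK.
have j0 : nat_of_ord j = 0.
  by move: cs cw; rewrite /cS /cW; case: (nat_of_ord j) => //= i /negbTE->.
by rewrite (deg_first K0) in d0; rewrite j0; move: d0; case: (emem P 0 0); case: (emem P 0 3).
Qed.

Lemma bitsP_hP I j : j < K -> bitsP (hP I) j = I j.
Proof.
move=> jK; rewrite /bitsP /xP !emem_hP // jK /hm /cS /cW /= /xbit.
by case: (j == 0); case: (dN j.-1); rewrite /= ?andbT ?negbK -?addbA ?addbb ?addbF.
Qed.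

End Bits.

(** * Twisted tiles and weights of a matching *)

Lemma big_shift (R : Type) (x0 : R) (op : Monoid.com_law x0) K (g : nat -> R) :
  \big[op/x0]_(j < K) (if j.+1 < K then g j.+1 else x0) =
  \big[op/x0]_(j < K) (if 0 < j then g j else x0).
Proof.
case: K => [|K]; first by rewrite !big_ord0.
rewrite big_ord_recr big_ord_recl /= ltnn Monoid.mulm1 Monoid.mul1m.
by apply: eq_bigr => j _; rewrite /bump /= add1n ltnS ltn_ord.
Qed.

Section Twists.
Variables (n : nat) (tau : 'I_n -> pairV n) (gamma : pairV n).
Local Notation K := (nk tau gamma).
Local Notation dN := (dirN tau gamma).
Local Notation ps := (pos tau gamma).
Local Notation edg := (edge tau gamma).
Local Notation hm := (hm tau gamma).
Local Notation hP := (hP tau gamma).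
Local Notation cS := (cS tau gamma).
Local Notation cW := (cW tau gamma).
Local Notation closedI := (closedI tau gamma).
Hypothesis K0 : 0 < K.
Implicit Types (P : {set edg}) (I : nat -> bool).

Lemma eq_hP I I' : (forall j, j < K -> I j = I' j) -> hP I = hP I'.
Proof.
move=> h; apply/setP => e; rewrite !inE; case: e => j s /=; have jK := ltn_ord j.
rewrite /hm /xbit (h j jK); have [lt|ge] := ltnP j.+1 K; first by rewrite h.
by case: s => -[|[|[|[|//]]]].
Qed.

Definition I0 : nat -> bool := fun=> false.

Lemma closed0 : closedI I0.
Proof. by move=> j _; rewrite /xbit /=; case: (odd j); case: ifP. Qed.

Lemma hm_boundary I j s : hm I j s -> xbit I j.+1 = ~~ xbit I j ->
  ~~ [|| (s == 1) && (j.+1 < K) && ~~ dN j | (s == 2) && (j.+1 < K) && dN j].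
Proof.
rewrite /hm; case: s => [|[|[|s]]] //= h e; move: h; rewrite e.
  by case: (xbit I j); case: (_ < _); case: (dN j).
by case: (xbit I j); case: (_ < _); case: (dN j).
Qed.

(** Without gluing edges the values of [xbit] must alternate, and the west edge of the first tile
    fixes the first one. *)
Lemma Pmin_hP : Pmin tau gamma = hP I0.
Proof.
rewrite /Pmin; case: pickP => [P|/(_ (hP I0))] /=; last first.
  move/negbT/negP; case; apply/and3P; split; first exact: hP_perfect closed0.
    apply/forallP => e; apply/implyP; rewrite inE => h; apply: hm_boundary h _.
    by rewrite /xbit /=.
  apply/existsP; exists (Ordinal K0, inord 3); rewrite inE /= inordK //.
case/and3P=> /(perfect_hP K0) [cl ->]; set I := bitsP P in cl *.
move=> /forallP bd /existsP[e /and3P[eP /eqP e1 /eqP e2]].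
apply: eq_hP; have x0 : xbit I 0 = false.
  have e1' : val e.1 = 0 := e1; have e2' : val e.2 = 3 := e2.
  have : hm I (val e.1) (val e.2) by move: eP; rewrite inE.
  by rewrite e1' e2' /hm /=; case: (xbit I 0); rewrite ?andbF.
have alt j : j.+1 < K -> xbit I j.+1 = ~~ xbit I j.
  move=> jK; have := cl j jK; case d: (dN j).
    have := bd (Ordinal (ltnW jK), inord 2); rewrite inE /boundary /= inordK // /hm jK d /=.
    by case: (xbit I j); case: (xbit I j.+1).
  have := bd (Ordinal (ltnW jK), inord 1); rewrite inE /boundary /= inordK // /hm jK d /=.
  by case: (xbit I j); case: (xbit I j.+1).
have xj j : j < K -> xbit I j = odd j.
  by elim: j => [//|j IH] jK; rewrite alt // IH // ltnW.
by move=> j /xj; rewrite /xbit /I0; case: (I j); case: (odd j).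
Qed.

Lemma hm_diff1 I j : closedI I -> j < K ->
  hm I j 1 (+) hm I0 j 1 = I j (+) [&& ~~ dN j, j.+1 < K & I j.+1].
Proof.
move=> cl jK; rewrite /hm /xbit /=; have [lt|ge] := ltnP j.+1 K; last first.
  by rewrite !andbF; case: (I j); case: (odd j).
have := cl j lt; rewrite /xbit /=.
by case: (dN j); case: (I j); case: (I j.+1); case: (odd j).
Qed.

Lemma hm_diff3 I j : hm I j 3 (+) hm I0 j 3 = cW j && I j.
Proof. by rewrite /hm /xbit; case: (cW j); case: (I j); case: (odd j). Qed.

Lemma emem_symdiff P P' j s : emem ((P :\: P') :|: (P' :\: P)) j s = emem P j s (+) emem P' j s.
Proof.
have [jK|jK] := ltnP j K; last by rewrite !emem_out.
have [s4|s4] := ltnP s 4; last first.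
  have out P'' : emem P'' j s = false.
    by apply/existsP => -[e /and3P[_ _ /eqP e2]]; have := ltn_ord e.2; rewrite e2 ltnNge s4.
  by rewrite !out.
have E P'' : emem P'' j s = ((Ordinal jK, Ordinal s4) \in P'') by rewrite -ememE.
by rewrite !E !inE; case: (_ \in P); case: (_ \in P').
Qed.

(** The symmetric difference with [Pmin] is the sum modulo 2 of the boundaries of the tiles in [I].
    A tile contributes both of its vertical sides to the ray or none, except for [j] itself, which
    contributes only its west side. *)
Lemma twisted_hP I (j : 'I_K) : closedI I -> twisted (hP I) j = I j.
Proof.
move=> cl; rewrite /twisted Pmin_hP.
pose Qp (j' s : nat) := ((s == 1) || (s == 3)) &&
  ((head (0%R, 0%R) (endsN (ps j') s)).2 == (ps j).2) &&
  ((head (0%R, 0%R) (endsN (ps j') s)).1 <= (ps j).1)%R.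
rewrite (card_edges _ Qp) (big_morph odd oddD (erefl _)).
pose row (i : nat) := (ps i).2 == (ps j).2.
pose lt (i : nat) := ((ps i).1 + 1 <= (ps j).1)%R.
pose le (i : nat) := ((ps i).1 <= (ps j).1)%R.
pose g i := [&& ~~ dN i.-1, row i, le i & I i].
(* A glued east side of the tile [i] is also the west side of the tile [i.+1]; the share of the
   latter is isolated as [g i.+1], so that [big_shift] can move it there. *)
transitivity (\big[addb/false]_(i < K)
  ((row i && (lt i && I i (+) le i && (cW i && I i))) (+) (if i.+1 < K then g i.+1 else false))).
  apply: eq_bigr => i _; rewrite !big_ord_recl big_ord0 /= /Qp /=.
  rewrite !andbF !add0n addn0 -/(row i) -/(lt i) -/(le i) !emem_symdiff !emem_hP // ltn_ord /=.
  rewrite oddD !oddb (hm_diff1 cl (ltn_ord i)) hm_diff3 /g /=.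
  have [iK|iK] := ltnP i.+1 K; last first.
    by rewrite !andbF !addbF; case: (row i); case: (lt i); case: (le i); case: (I i); case: (cW i).
  have [d|d] := boolP (dN i).
    by rewrite /= !addbF; case: (row i); case: (lt i); case: (le i); case: (I i); case: (cW i).
  have -> : row i.+1 = row i by rewrite /row posS (negbTE d).
  have -> : le i.+1 = lt i by rewrite /le /lt posS (negbTE d).
  by case: (row i); case: (lt i); case: (le i); case: (I i); case: (cW i); case: (I i.+1).
rewrite big_split /= big_shift -big_split /=.
rewrite (bigD1 j) //= big1 ?addbF => [|i ij].
  rewrite /g /row /lt /le /cW !eqxx !lexx /=.
  have -> : ((ps j).1 + 1 <= (ps j).1)%R = false by lia.
  case: (nat_of_ord j) => [|m] /=; first by rewrite addbF.
  by case: (dN m); case: (I m.+1).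
have : ~~ (row i && (lt i (+) le i)).
  apply/negP => /andP[/eqP h1 h2]; case/negP: ij; apply/eqP/val_inj => /=.
  have := pos_sum K0 i; have := pos_sum K0 j; move: h1 h2; rewrite /lt /le.
  by case: (ps i) => x y; case: (ps j) => x' y' /=; lia.
rewrite /g /cW; case: (nat_of_ord i) => [|m] /=.
  by rewrite addbF; case: (row 0); case: (lt 0); case: (le 0); case: (I 0).
by case: (row m.+1); case: (lt m.+1); case: (le m.+1); case: (I m.+1); case: (dN m).
Qed.

Local Open Scope ring_scope.

(** Assign to each tile its two horizontal or its two vertical sides according to its bit. By
    closedness a gluing edge is then counted twice if it belongs to the matching and once if it does
    not, so subtracting it once is always right. *)
Lemma label_sum I (lb : nat -> nat -> int) : closedI I ->
  (forall j, (j.+1 < K)%N -> ~~ dN j -> lb j 1%N = lb j.+1 3%N) ->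
  (forall j, (j.+1 < K)%N -> dN j -> lb j 2%N = lb j.+1 0%N) ->
  \sum_(j < K) \sum_(s < 4) (emem (hP I) j s)%:Z * lb j s =
  \sum_(j < K) ((if xbit I j then lb j 0%N + lb j 2%N else lb j 1%N + lb j 3%N)
    - (if (0 < j)%N then if dN j.-1 then lb j 0%N else lb j 3%N else 0)).
Proof.
move=> cl gE gN.
pose A (j : nat) : int := if (0 < j)%N then
  if dN j.-1 then (xbit I j)%:Z * lb j 0%N else (~~ xbit I j)%:Z * lb j 3%N else 0.
pose Bg (j : nat) : int :=
  if dN j.-1 then (~~ xbit I j)%:Z * lb j 0%N else (xbit I j)%:Z * lb j 3%N.
transitivity (\sum_(j < K) ((if xbit I j then lb j 0%N + lb j 2%N else lb j 1%N + lb j 3%N) - A j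
   - (if (j.+1 < K)%N then Bg j.+1 else 0))).
  apply: eq_bigr => j _; rewrite !big_ord_recl big_ord0 /= !emem_hP // ltn_ord /=.
  have -> : A j = (~~ cS j && xbit I j)%:Z * lb j 0%N + (~~ cW j && ~~ xbit I j)%:Z * lb j 3%N.
    rewrite /A /cS /cW; case: (nat_of_ord j) => [|m] /=; first by rewrite !mul0r.
    by case: (dN m); rewrite /= !mul0r ?addr0 ?add0r.
  rewrite /hm /bump /= /Bg; case: (ltnP j.+1 K) => [jK|_]; last first.
    by rewrite !andbF !andbT; case: (xbit I j); case: (cS j); case: (cW j) => /=; rewrite ?mul1r ?mul0r; ring.
  have := cl j jK; case d: (dN j); rewrite ?(gN j jK d) ?(gE j jK (negbT d)) /=.
    by case: (xbit I j); case: (xbit I j.+1); case: (cS j); case: (cW j) => //= _; rewrite ?mul1r ?mul0r; ring.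
  by case: (xbit I j); case: (xbit I j.+1); case: (cS j); case: (cW j) => //= _; rewrite ?mul1r ?mul0r; ring.
rewrite sumrB [X in _ - X](big_shift _ _ Bg) -sumrB; apply: eq_bigr => j _.
rewrite /A /Bg; case: (nat_of_ord j) => [|m] /=; first by rewrite !subr0.
by case: (dN m); case: (xbit I m.+1) => /=; rewrite ?mul1r ?mul0r; ring.
Qed.

End Twists.

Local Open Scope ring_scope.

(** * Quantum seeds and their mutations *)

Section QCommute.
Variables (D : unitRingType) (t : D).
Hypothesis tU : t \is a GRing.unit.

Definition qc (c : int) (x y : D) := x * y = t ^ c * (y * x).

Lemma tzD (a b : int) : t ^ (a + b) = t ^ a * t ^ b.
Proof. by rewrite exprzDr. Qed.

Lemma commtz (x : D) (c : int) : GRing.comm t x -> t ^ c * x = x * t ^ c.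
Proof. by move=> h; apply/esym; apply: commrXz; apply: commr_sym. Qed.

Lemma qcM c d x y z : GRing.comm t y -> qc c x y -> qc d x z -> qc (c + d) x (y * z).
Proof.
move=> ty h1 h2; rewrite /qc mulrA h1 -!mulrA h2 tzD -!mulrA.
by congr (_ * _); rewrite [RHS]mulrA (commtz _ ty) -!mulrA.
Qed.

Lemma qc_sym c x y : qc c x y -> qc (- c) y x.
Proof. by move=> h; rewrite /qc h mulrA -tzD addNr expr0z mul1r. Qed.

Lemma qc1 x : qc 0 x 1.
Proof. by rewrite /qc expr0z !mulr1 !mul1r. Qed.

Lemma qcV c x y : y \is a GRing.unit -> GRing.comm t y -> qc c x y -> qc (- c) x y^-1.
Proof.
move=> yU ty h; apply: (mulrI yU); rewrite [RHS]mulrA -(commtz _ ty) -[RHS]mulrA mulVKr //.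
apply: (mulIr yU); rewrite -!mulrA mulVr // mulr1 h.
by rewrite mulrA -tzD addNr expr0z mul1r.
Qed.

Lemma commtX x (a : nat) : GRing.comm t x -> GRing.comm t (x ^+ a).
Proof. by move=> h; apply: commrX. Qed.

Lemma qcXn c x y (a : nat) : GRing.comm t y -> qc c x y -> qc (c * a%:Z) x (y ^+ a).
Proof.
move=> ty h; elim: a => [|a IH]; first by rewrite mulr0 expr0; apply: qc1.
rewrite exprS; have -> : c * a.+1%:Z = c + c * a%:Z by lia.
exact: qcM.
Qed.

Lemma qcXz c x y (a : int) : y \is a GRing.unit -> GRing.comm t y ->
  qc c x y -> qc (c * a) x (y ^ a).
Proof.
move=> yU ty h; case: a => a; first exact: qcXn.
rewrite NegzE -exprnN mulrN; apply: qcV; last exact: qcXn.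
  exact: unitrX.
exact: commtX.
Qed.

Lemma commtXz x (a : int) : GRing.comm t x -> GRing.comm t (x ^ a).
Proof. by move=> h; apply: commrXz. Qed.

Lemma qcXzz c x y (a b : int) : x \is a GRing.unit -> y \is a GRing.unit ->
  GRing.comm t x -> GRing.comm t y -> qc c x y -> qc (c * a * b) (x ^ a) (y ^ b).
Proof.
move=> xU yU tx ty h; apply: qcXz => //.
by have := qc_sym (qcXz a xU tx (qc_sym h)); rewrite mulNr opprK.
Qed.

Lemma comm_prod (I : Type) (r : seq I) (P : pred I) (F : I -> D) x :
  (forall i, P i -> GRing.comm x (F i)) -> GRing.comm x (\prod_(i <- r | P i) F i).
Proof.
move=> h; elim/big_rec: _ => [|i y Pi IH]; first exact: commr1.
by apply: commrM => //; apply: h.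
Qed.

Lemma qc_prod (I : Type) (r : seq I) (F : I -> D) (c : I -> int) x :
  (forall i, GRing.comm t (F i)) -> (forall i, qc (c i) x (F i)) ->
  qc (\sum_(i <- r) c i) x (\prod_(i <- r) F i).
Proof.
move=> tF h; elim: r => [|i r IH]; first by rewrite !big_nil; apply: qc1.
by rewrite !big_cons; apply: qcM.
Qed.

Lemma prod_qmul N (X : 'I_N -> D) (L : 'I_N -> 'I_N -> int) (a b : 'I_N -> int) :
  (forall i, X i \is a GRing.unit) -> (forall i, GRing.comm t (X i)) ->
  (forall i j, qc (L i j *+ 2) (X i) (X j)) ->
  (\prod_i X i ^ a i) * (\prod_i X i ^ b i) =
  t ^ (\sum_(i < N) \sum_(j < N | (i < j)%N) L j i *+ 2 * a j * b i) *
  \prod_i X i ^ (a i + b i).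
Proof.
elim: N X L a b => [|N IH] X L a b XU tX qX.
  by rewrite !big_ord0 expr0z !mul1r.
rewrite big_ord_recr [X in _ * X]big_ord_recr /=.
set w := widen_ord _.
set xa := X ord_max ^ a ord_max; set xb := X ord_max ^ b ord_max.
set Pa := \prod_(i < N) _; set Pb := \prod_(i < N) _.
have hx : qc (\sum_(i < N) L ord_max (w i) *+ 2 * a ord_max * b (w i)) xa Pb.
  apply: qc_prod => i; first exact/commtXz/tX.
  exact: qcXzz.
have := IH (fun i => X (w i)) (fun i j => L (w i) (w j)) (fun i => a (w i)) (fun i => b (w i))
  (fun i => XU _) (fun i => tX _) (fun i j => qX _ _).
rewrite -/Pa -/Pb => hP.
have tP : GRing.comm t Pa by apply: comm_prod => i _; apply/commtXz/tX.
rewrite -mulrA [xa * _]mulrA hx -!mulrA [Pa * _]mulrA -(commtz _ tP) -!mulrA.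
rewrite [Pa * (Pb * _)]mulrA hP -!mulrA mulrA -tzD.
rewrite big_ord_recr [in RHS]big_ord_recr /= -exprzDr //.
congr (t ^ _ * _).
have -> : \sum_(j < N.+1 | ((ord_max : 'I_N.+1) < j)%N) L j ord_max *+ 2 * a j * b ord_max = 0.
  by apply: big1 => j /=; rewrite ltnNge -ltnS ltn_ord.
rewrite addr0 -big_split /=; apply: eq_bigr => i _.
rewrite [in RHS]big_mkcond big_ord_recr /= ltn_ord addrC; congr (_ + _).
by rewrite big_mkcond.
Qed.

End QCommute.

Lemma sum_pairs N (F : 'I_N -> 'I_N -> int) : (forall i, F i i = 0) ->
  \sum_i \sum_j F i j = \sum_(i < N) \sum_(j < N | (i < j)%N) (F i j + F j i).
Proof.
move=> F0.
transitivity (\sum_(i < N) (\sum_(j < N | (i < j)%N) F i j + \sum_(j < N | (j < i)%N) F i j)).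
  apply: eq_bigr => i _; rewrite (bigID (fun j : 'I_N => (i < j)%N)) /=; congr (_ + _).
  rewrite (bigD1 i) ?ltnn //= F0 add0r; apply: eq_bigl => j.
  by rewrite -leqNgt ltn_neqAle andbC.
rewrite big_split /= [X in _ + X](exchange_big_dep xpredT) //= -big_split /=.
by apply: eq_bigr => i _; rewrite big_split.
Qed.

Section Qform.
Variable n : nat.
Implicit Types (L : 'M[int]_(n + n)) (a b c : 'rV[int]_(n + n)).

Definition unitv (i : 'I_(n + n)) : 'rV[int]_(n + n) := delta_mx ord0 i.

Lemma unitvE i j : unitv i ord0 j = (j == i)%:R.
Proof. by rewrite mxE eqxx. Qed.

Lemma qformE L a b : qform L a b = \sum_i \sum_j a ord0 i * L i j * b ord0 j.
Proof.
rewrite /qform mxE exchange_big /=; apply: eq_bigr => j _.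
by rewrite mxE [in RHS](eq_bigr _ (fun i _ => erefl)) -big_distrl /= mxE.
Qed.

Lemma qformDl L a b c : qform L (a + b) c = qform L a c + qform L b c.
Proof. by rewrite /qform !mulmxDl mxE. Qed.
Lemma qformDr L a b c : qform L a (b + c) = qform L a b + qform L a c.
Proof. by rewrite /qform linearD mulmxDr mxE. Qed.
Lemma qformNl L a b : qform L (- a) b = - qform L a b.
Proof. by rewrite /qform !mulNmx mxE. Qed.
Lemma qformNr L a b : qform L a (- b) = - qform L a b.
Proof. by rewrite /qform linearN mulmxN mxE. Qed.
Lemma qformZl L (x : int) a b : qform L (x *: a) b = x * qform L a b.
Proof. by rewrite /qform -!scalemxAl mxE. Qed.
Lemma qform_unit L i j : qform L (unitv i) (unitv j) = L i j.
Proof.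
rewrite qformE (bigD1 i) //= [X in _ + X]big1 ?addr0 => [|i' /negbTE h]; last first.
  by apply: big1 => j' _; rewrite unitvE h !mul0r.
rewrite (bigD1 j) //= big1 ?addr0 => [|j' /negbTE h]; last by rewrite [unitv j _ _]unitvE h mulr0.
by rewrite !unitvE !eqxx mul1r mulr1.
Qed.

Definition anti L := forall i j, L i j = - L j i.

Lemma qform_anti L a b : anti L -> qform L a b = - qform L b a.
Proof.
move=> h; rewrite !qformE exchange_big -sumrN; apply: eq_bigr => i _.
by rewrite -sumrN; apply: eq_bigr => j _; rewrite (h j i); ring.
Qed.

Lemma qform_self L a : anti L -> qform L a a = 0.
Proof. by move/(qform_anti a a); lia. Qed.

Definition qformD := (qformDl, qformDr, qformNl, qformNr).

End Qform.

Section Frames.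
Variables (n : nat) (D : unitRingType) (t : D).
Hypothesis tU : t \is a GRing.unit.
Variables (L : 'M[int]_(n + n)) (X : 'I_(n + n) -> D).
Hypothesis antiL : anti L.
Hypothesis XU : forall i, X i \is a GRing.unit.
Hypothesis tX : forall i, GRing.comm t (X i).
Hypothesis qX : forall i j, qc t (L i j *+ 2) (X i) (X j).

Definition fr (a : 'rV[int]_(n + n)) := frame t L X (fun i => a ord0 i).

Lemma fr_comm a : GRing.comm t (fr a).
Proof.
apply: commrM; first by apply: commrXz; apply: commr_refl.
by apply: comm_prod => i _; apply/commtXz/tX.
Qed.

(** The normalising power in [frame] turns the one-sided reordering exponent of [prod_qmul] into the
    antisymmetric form of [L]. *)
Lemma fr_mul a b : fr a * fr b = t ^ (qform L a b) * fr (a + b).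
Proof.
rewrite /fr /frame.
set qa := \sum_(i < n + n) _; set qb := \sum_(i < n + n) _; set qab := \sum_(i < n + n) _.
set Pa := \prod_(i < n + n) _; set Pb := \prod_(i < n + n) _.
have tP : GRing.comm t Pa by apply: comm_prod => i _; apply/commtXz/tX.
rewrite -!mulrA [Pa * _]mulrA -(commtz _ tP) -!mulrA.
rewrite (prod_qmul tU _ _ XU tX qX) !mulrA -!tzD //; congr (t ^ _ * _); last first.
  by apply: eq_bigr => i _; rewrite mxE.
rewrite qformE sum_pairs; last by move=> i; have := antiL i i; nia.
rewrite -!sumrN -!big_split /=; apply: eq_bigr => i _.
rewrite -!sumrN -!big_split /=; apply: eq_bigr => j _.
by rewrite !mxE (antiL j i); ring.
Qed.

Lemma fr0 : fr 0 = 1.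
Proof.
rewrite /fr /frame [X in _ * X]big1 ?mulr1; last by move=> i _; rewrite mxE expr0z.
rewrite big1 ?oppr0 ?expr0z // => i _.
by apply: big1 => j _; rewrite !mxE !mul0r.
Qed.

Lemma fr_unit i : fr (unitv i) = X i.
Proof.
rewrite /fr /frame [X in _ * X](eq_bigr (fun j => if j == i then X j else 1)); last first.
  by move=> j _; rewrite unitvE; case: eqP => _; rewrite ?expr1z ?expr0z.
rewrite -big_mkcond big_pred1_eq big1 ?oppr0 ?expr0z ?mul1r // => j _.
apply: big1 => k hk; rewrite !unitvE.
case: (j =P i) => [ji|_]; last by rewrite !mul0r.
by case: (k =P i) => [ki|_]; [rewrite ji ki ltnn in hk | rewrite mulr0 mul0r].
Qed.

Lemma frU a : fr a \is a GRing.unit.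
Proof.
have UXz (x : D) (m : int) : x \is a GRing.unit -> x ^ m \is a GRing.unit.
  by move=> xU; case: m => m; rewrite ?NegzE -?exprnN ?unitrV; apply: unitrX.
by apply: rpredM; [apply: UXz | apply: rpred_prod => i _; apply: UXz].
Qed.

Lemma frN a : (fr a)^-1 = fr (- a).
Proof.
apply: (mulrI (frU a)); rewrite divrr ?frU // fr_mul subrr fr0 qformNr.
by rewrite (qform_self a antiL) oppr0 expr0z mulr1.
Qed.

Lemma fr_qc a b : qc t (qform L a b *+ 2) (fr a) (fr b).
Proof.
rewrite /qc !fr_mul mulrA -tzD // [b + a]addrC (qform_anti b a antiL).
by congr (t ^ _ * _); lia.
Qed.

End Frames.

(* [lia] and [ring] only compare matrix entries syntactically, hence the abstraction
   of each entry up to conversion. *)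
Ltac mxatoms := rewrite ?mxE; repeat (match goal with
  |- context [@fun_of_matrix _ _ _ ?u ?i ?j] =>
    let x := fresh "e" in set x := (@fun_of_matrix _ _ _ u i j); move: x => x end).
Ltac mxlia := mxatoms; lia.
Ltac mxring := mxatoms; ring.

Lemma row_ext (R : Type) m (u v : 'rV[R]_m) : (forall i, u ord0 i = v ord0 i) -> u = v.
Proof. by move=> h; apply/rowP => i; apply: h. Qed.

(** * Compatible seeds and the exchange relation *)

Section Mutation.
Variables (n : nat) (D : unitRingType) (t : D).
Hypothesis hD : forall x : D, x != 0 -> x \is a GRing.unit.
Hypothesis tU : t \is a GRing.unit.
Hypothesis troot : forall m : int, t ^ m = 1 -> m = 0.
Implicit Types (S : qseed n D) (k : 'I_n) (u v : 'rV[int]_(n + n)).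

Definition bcol S k : 'rV[int]_(n + n) := \row_i sB S i k.
Definition posv u : 'rV[int]_(n + n) := \row_i Num.max (u ord0 i) 0.
Definition pvec S k := posv (bcol S k) - unitv (lshift n k).
Definition mvec S k := posv (- bcol S k) - unitv (lshift n k).
Definition sfr S u := fr t (sL S) (sX S) u.

(** The field [g_compat] is the compatibility condition of Berenstein and Zelevinsky. It also yields
    the skew-symmetry of the principal part, because pairing two columns of [B] gives an entry of
    [B]. *)
Record good S : Prop := Good {
  g_anti : anti (sL S);
  g_compat : forall k v, qform (sL S) (bcol S k) v = v ord0 (lshift n k);
  g_unit : forall i, sX S i \is a GRing.unit;
  g_comm : forall i, GRing.comm t (sX S i);
  g_qc : forall i j, qc t (sL S i j *+ 2) (sX S i) (sX S j) }.

Lemma eq_frame (L : 'M[int]_(n + n)) (X : 'I_(n + n) -> D) (a b : 'I_(n + n) -> int) :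
  a =1 b -> frame t L X a = frame t L X b.
Proof.
move=> h; rewrite /frame; congr (t ^ (- _) * _).
  by apply: eq_bigr => i _; apply: eq_bigr => j _; rewrite !h.
by apply: eq_bigr => i _; rewrite h.
Qed.

Section OneSeed.
Variables (S : qseed n D) (k : 'I_n).
Hypothesis gS : good S.
Let kk := lshift n k.
Let S' := mutate t S k.

Let aL := g_anti gS.
Let XU := g_unit gS.
Let tX := g_comm gS.
Let qX := g_qc gS.

Lemma sfr_mul u v : sfr S u * sfr S v = t ^ (qform (sL S) u v) * sfr S (u + v).
Proof. exact: fr_mul. Qed.
Lemma sfr_unitv i : sfr S (unitv i) = sX S i.
Proof. exact: fr_unit. Qed.
Lemma sfrU u : sfr S u \is a GRing.unit.
Proof. exact: frU. Qed.
Lemma sfr_comm u : GRing.comm t (sfr S u).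
Proof. exact: fr_comm. Qed.
Lemma sfr0 : sfr S 0 = 1. Proof. exact: fr0. Qed.
Lemma sfrN u : (sfr S u)^-1 = sfr S (- u).
Proof. exact: frN. Qed.
Lemma sfr_qc u v : qc t (qform (sL S) u v *+ 2) (sfr S u) (sfr S v).
Proof. exact: fr_qc. Qed.

Lemma B_skew i j : sB S (lshift n i) j = - sB S (lshift n j) i.
Proof.
have h a b : qform (sL S) (bcol S a) (bcol S b) = sB S (lshift n a) b.
  by rewrite g_compat // mxE.
by rewrite -!h; apply: qform_anti.
Qed.

Lemma B_diag : sB S kk k = 0.
Proof. by have := B_skew k k; rewrite -/kk; lia. Qed.

Lemma pm_vec : pvec S k = mvec S k + bcol S k.
Proof. by rewrite /pvec /mvec; apply: row_ext => i; mxlia. Qed.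

Lemma qform_pm v : v ord0 kk = 0 -> qform (sL S) (pvec S k) v = qform (sL S) (mvec S k) v.
Proof. by move=> h; rewrite pm_vec qformDl g_compat // h addr0. Qed.

Lemma mutX_k : sX S' kk = sfr S (pvec S k) + sfr S (mvec S k).
Proof.
rewrite /S' /mutate /= eqxx; congr (_ + _); apply: eq_frame => i;
  by rewrite !mxE eqxx /= -/kk /ind; case: (i == kk); rewrite addrC.
Qed.

Lemma mutX_neq i : i != kk -> sX S' i = sX S i.
Proof. by rewrite /S' /mutate /= => /negbTE ->. Qed.

(** The matrix [E] of the mutation as a map rewriting new exponents in the old frame: the new
    variable is replaced by one of its two exchange monomials. *)
Definition emap u := u + u ord0 kk *: (mvec S k - unitv kk).

Lemma mutL u v : qform (sL S') u v = qform (sL S) (emap u) (emap v).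
Proof.
rewrite /S' /mutate /= /qform; set E := (X in X^T *m _ *m X).
have eE w : w *m E^T = emap w.
  apply: row_ext => i; rewrite mxE (bigD1 kk) //= !mxE !eqxx /=.
  have -> : \sum_(j < n + n | j != kk) w ord0 j * E^T j i = if i == kk then 0 else w ord0 i.
    case: eqP => [->|/eqP ik].
      by apply: big1 => j /negbTE jk; rewrite !mxE jk /= /ind eq_sym jk mulr0.
    rewrite (bigD1 i) //= !mxE ik /= /ind eqxx mulr1 big1 ?addr0 // => j /andP[jk /negbTE ji].
    by rewrite !mxE jk /= /ind eq_sym ji mulr0.
  rewrite -/kk; case: (i =P kk) => [->|_] /=.
    by rewrite B_diag oppr0 maxxx; mxring.
  by rewrite (_ : Num.max 0 (- sB S i k) = Num.max (- sB S i k) 0) ?mulr0n; [mxring | mxlia].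
by rewrite !mulmxA eE -!mulmxA; congr ((_ *m (_ *m _)) _ _); rewrite -eE trmx_mul trmxK.
Qed.

Lemma emap_id u : u ord0 kk = 0 -> emap u = u.
Proof. by rewrite /emap => ->; rewrite scale0r addr0. Qed.

Lemma emap_k : emap (unitv kk) = mvec S k.
Proof. by rewrite /emap unitvE eqxx scale1r addrC subrK. Qed.

Lemma emapD u v : emap (u + v) = emap u + emap v.
Proof. by apply: row_ext => i; mxring. Qed.

Lemma mutL_unit i j : sL S' i j = qform (sL S) (emap (unitv i)) (emap (unitv j)).
Proof. by rewrite -mutL qform_unit. Qed.

Lemma unitv_k i : i != kk -> unitv i ord0 kk = 0.
Proof. by rewrite unitvE eq_sym => /negbTE ->. Qed.

Lemma mutL_neq i j : i != kk -> j != kk -> sL S' i j = sL S i j.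
Proof. by move=> hi hj; rewrite mutL_unit !emap_id ?unitv_k // qform_unit. Qed.

Lemma bcol_mut j : j != k ->
  emap (bcol S' j) = bcol S j + Num.max (sB S kk j) 0 *: bcol S k.
Proof.
move=> jk; apply: row_ext => i; rewrite !mxE /S' /mutate /= -/kk !eqxx (negbTE jk) /= orbF.
by case: (i =P kk) => [->|ik] /=; rewrite ?B_diag; [lia | nia].
Qed.

Lemma bcol_mut_k : emap (bcol S' k) = - bcol S k.
Proof.
have h : bcol S' k = - bcol S k by apply: row_ext => i; rewrite !mxE /= eqxx orbT.
by rewrite h emap_id // !mxE B_diag.
Qed.

(** Read through [emap], a mutated column is an old column plus a multiple of the column [k], or the
    opposite of the latter, so compatibility of the old seed applies. *)
Lemma mut_compat j v : qform (sL S') (bcol S' j) v = v ord0 (lshift n j).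
Proof.
rewrite mutL; have [->|jk] := eqVneq j k.
  rewrite bcol_mut_k qformNl g_compat // !mxE !eqxx /= -/kk B_diag oppr0 maxxx; mxring.
rewrite bcol_mut // qformDl qformZl !g_compat // !mxE !eqxx /= -/kk B_diag.
rewrite (_ : (lshift n j == kk) = false); last by rewrite eq_lshift; apply/negbTE.
by have := B_skew j k; rewrite -/kk => ->; rewrite opprK mulr0n; mxring.
Qed.

Lemma mutX_comm i : GRing.comm t (sX S' i).
Proof.
have [->|ik] := eqVneq i kk; last by rewrite mutX_neq.
by rewrite mutX_k; apply: commrD; apply: sfr_comm.
Qed.

Lemma qcDl (c : int) (x y z : D) : qc t c x z -> qc t c y z -> qc t c (x + y) z.
Proof. by rewrite /qc mulrDl => -> ->; rewrite -mulrDr -mulrDr. Qed.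

Lemma mutX_qc_k j : j != kk -> qc t (sL S' kk j *+ 2) (sX S' kk) (sX S' j).
Proof.
move=> jk; rewrite mutX_k (mutX_neq jk) mutL_unit emap_k (emap_id (unitv_k jk)) -sfr_unitv.
by apply: qcDl; [rewrite -qform_pm ?unitv_k // | ]; apply: sfr_qc.
Qed.

Lemma mut_anti : anti (sL S').
Proof. by move=> i j; rewrite !mutL_unit; apply: qform_anti. Qed.

Lemma mutX_qc i j : qc t (sL S' i j *+ 2) (sX S' i) (sX S' j).
Proof.
have [->|ik] := eqVneq i kk.
  have [->|jk] := eqVneq j kk; last exact: mutX_qc_k.
  have -> : sL S' kk kk = 0 by have := mut_anti kk kk; lia.
  by rewrite mul0rn /qc expr0z mul1r.
have [->|jk] := eqVneq j kk; last by rewrite mutL_neq // !mutX_neq.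
rewrite mut_anti mulNrn; apply: qc_sym => //; exact: mutX_qc_k.
Qed.

(* Were the two exchange monomials opposite up to a power of t, their quotient
   would commute with the mutated variable, although compatibility makes it
   [t ^ 2]-commute. *)
Lemma mutX_unit i : sX S' i \is a GRing.unit.
Proof.
have [->|ik] := eqVneq i kk; last by rewrite mutX_neq.
apply: hD; rewrite mutX_k; apply/eqP => h0.
pose m := sfr S (mvec S k).
have pm : sfr S (pvec S k) = - m by apply/eqP; rewrite -subr_eq0 opprK h0.
have bE : exists c : int, sfr S (bcol S k) = - t ^ c.
  exists (qform (sL S) (mvec S k) (bcol S k)).
  apply: (mulrI (sfrU (mvec S k))); rewrite sfr_mul -pm_vec pm mulrN mulrN; congr (- _).
  by apply: commtz; apply: sfr_comm.
case: bE => c bE.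
have := sfr_qc (bcol S k) (unitv kk); rewrite g_compat // unitvE eqxx bE sfr_unitv /qc.
rewrite mulrN mulNr mulrN (commtz c (tX kk)) => /oppr_inj.
rewrite -[X in X = _]mul1r => /mulIr => h.
have /h : sX S kk * t ^ c \is a GRing.unit.
  by rewrite -(commtz c (tX kk)); apply: rpredM => //;
     case: (c) => m'; rewrite ?NegzE -?exprnN ?unitrV; apply: unitrX.
by move/esym/troot.
Qed.

Lemma good_mutate : good S'.
Proof.
split; [exact: mut_anti | exact: mut_compat | exact: mutX_unit | exact: mutX_comm | exact: mutX_qc].
Qed.

Lemma sfr_mut_neq v : v ord0 kk = 0 -> sfr S' v = sfr S v.
Proof.
move=> h; rewrite /sfr /fr /frame; congr (t ^ (- _) * _).
  apply: eq_bigr => i _; apply: eq_bigr => j _.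
  have [->|ik] := eqVneq i kk; first by rewrite h !mul0r.
  have [->|jk] := eqVneq j kk; first by rewrite h !(mul0r, mulr0).
  by rewrite mutL_neq.
apply: eq_bigr => i _; have [->|ik] := eqVneq i kk; first by rewrite h !expr0z.
by rewrite mutX_neq.
Qed.

End OneSeed.

(** By [qform_pm] both exchange monomials produce the same power of [t] when multiplied by [v]; it
    is also the power on the left and cancels. *)
Lemma sfr_mut_k S k v : good S -> v ord0 (lshift n k) = 0 ->
  sfr (mutate t S k) (unitv (lshift n k) + v) = sfr S (pvec S k + v) + sfr S (mvec S k + v).
Proof.
move=> gS h; have gS' := good_mutate k gS.
have := sfr_mul gS' (unitv (lshift n k)) v.
rewrite sfr_unitv (sfr_mut_neq gS h) mutX_k mulrDl !(sfr_mul gS).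
rewrite (mutL k gS) emap_k (emap_id _ h) (qform_pm gS h) -mulrDr.
move/mulrI => e; symmetry; apply: e.
by case: (qform _ _ _) => m; rewrite ?NegzE -?exprnN ?unitrV; apply: unitrX.
Qed.

End Mutation.

(** * Coefficients as lambda lengths *)

Section Coefficients.
Variable n : nat.
Local Notation V := 'I_n.+3.
Variable tau : 'I_n -> pairV n.
Hypothesis htau : triangulation tau.
Implicit Types (T : 'I_n -> pairV n) (i j k : 'I_n) (x y a b c d : V).

(* The tropical lambda length of [xy] with respect to the i-th elementary lamination
   is half an integer; up to a rescaling at the vertices it becomes this indicator. *)
Definition fI i x y : int := (both (tau i).1 (tau i).2 x y : nat)%:Z.
Definition bot x y : 'rV[int]_(n + n) := row_mx 0 (\row_i fI i x y).
(** The exponent of a lambda length. For a boundary segment the upper half vanishes but the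
    coefficients stay, so sides of a quadrilateral need no case distinction. *)
Definition ev T x y : 'rV[int]_(n + n) := row_mx (\row_i ind (T i == sd x y)) (\row_i fI i x y).

Lemma evl T x y i : ev T x y ord0 (lshift n i) = ind (T i == sd x y).
Proof. by rewrite row_mxEl mxE. Qed.
Lemma evr T x y i : ev T x y ord0 (rshift n i) = fI i x y.
Proof. by rewrite row_mxEr mxE. Qed.
Lemma botl x y i : bot x y ord0 (lshift n i) = 0.
Proof. by rewrite row_mxEl mxE. Qed.
Lemma botr x y i : bot x y ord0 (rshift n i) = fI i x y.
Proof. by rewrite row_mxEr mxE. Qed.
Lemma fIC i x y : fI i x y = fI i y x.
Proof. by rewrite /fI /both andbC. Qed.
Lemma row_eq2 (u v : 'rV[int]_(n + n)) :
  (forall i, u ord0 (lshift n i) = v ord0 (lshift n i)) ->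
  (forall i, u ord0 (rshift n i) = v ord0 (rshift n i)) -> u = v.
Proof.
by move=> hl hr; apply: row_ext => s; rewrite -[s]splitK; case: (split s) => i /=; [apply: hl|apply: hr].
Qed.

Lemma evC T x y : ev T x y = ev T y x.
Proof. by apply: row_eq2 => i; rewrite ?evl ?evr ?[sd x y]sdC // fIC. Qed.

Lemma fI_tropical i a b c d : cyc4 a b c d ->
  fI i a c + fI i b d = Num.min (fI i a b + fI i c d) (fI i b c + fI i d a).
Proof.
move/(implyP (both_tropical _ _ _ _ (tau i).1 (tau i).2)) => /eqP; rewrite /fI; lia.
Qed.

Lemma fI_self k a b c d : cyc4 a b c d -> tau k = sd a c ->
  fI k b c + fI k d a = fI k a b + fI k c d + 1.
Proof.
move=> cy hk; have /eqP := implyP (both_self a b c d) cy.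
have -> : minn a c = (tau k).1.
  by rewrite hk /sd /minn; case: ifP.
have -> : maxn a c = (tau k).2.
  by rewrite hk /sd /maxn; case: ifP.
rewrite /fI; lia.
Qed.

Lemma fI_other k i a b c d : quad tau k a b c d -> i != k ->
  fI i b c + fI i d a = fI i a b + fI i c d.
Proof.
move=> q ik.
have := implyP (both_other a b c d (tau i).1 (tau i).2).
have pi := present_T (tri_sd htau i).
rewrite (qcyc q) !(present_nc htau) ?(qab q) ?(qbc q) ?(qcd q) ?(qda q) ?(qac q) //.
have -> : ((tau i).1 < (tau i).2)%N by case/andP: (tri_arc htau i).
have ne : tau i != sd a c by rewrite -(qk q); apply: contraNneq ik => /(tri_inj htau)->.
have -> : ~~ (((tau i).1 == a :> nat) && ((tau i).2 == c :> nat)).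
  by apply: contra ne => /andP[/eqP/val_inj <- /eqP/val_inj <-]; rewrite -(tri_sd htau).
have -> : ~~ (((tau i).1 == c :> nat) && ((tau i).2 == a :> nat)).
  by apply: contra ne => /andP[/eqP/val_inj <- /eqP/val_inj <-]; rewrite sdC -(tri_sd htau).
by move=> /(_ isT) /eqP; rewrite /fI; lia.
Qed.

Section Base.
Variable T : 'I_n -> pairV n.
Hypothesis hT : triangulation T.

Lemma third_vertices k a b c d x : quad T k a b c d -> x != a -> x != c ->
  present T a x -> present T c x -> x = b \/ x = d.
Proof.
move=> q xa xc pa pc.
have := implyP (cyc_third_vertex a b c d x); rewrite (qcyc q) !(inj_eq val_inj) xa xc.
rewrite !(present_nc hT) ?(qab q) ?(qbc q) ?(qcd q) ?(qda q) // => /(_ isT).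
by case/orP => /eqP; [left | right].
Qed.

End Base.

Lemma sum_support (I : finType) (l : seq I) (G : I -> int) : uniq l ->
  (forall p, p \notin l -> G p = 0) -> \sum_p G p = \sum_(p <- l) G p.
Proof.
move=> ul h; rewrite [RHS]big_uniq //= (bigID [in l]) /= [X in _ + X]big1 ?addr0 //.
Qed.

Lemma bDelta_rot e1 e2 e3 r s : bDelta tau e1 e2 e3 r s = bDelta tau e2 e3 e1 r s.
Proof. by rewrite /bDelta; ring. Qed.

Definition tri_term r s (p : V * V * V) : int :=
  if triangleT tau p.1.1 p.1.2 p.2
  then bDelta tau (sd p.1.1 p.1.2) (sd p.1.2 p.2) (sd p.2 p.1.1) r s else 0.

(** [Btilde] sums over increasing triples, and exactly one rotation of a cyclically ordered triangle
    is increasing. *)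
Lemma tri_terms_rot r s a b c : cyc3 a b c ->
  present tau a b -> present tau b c -> present tau c a ->
  tri_term r s (a, b, c) + tri_term r s (b, c, a) + tri_term r s (c, a, b) =
  bDelta tau (sd a b) (sd b c) (sd c a) r s.
Proof.
move=> cy h1 h2 h3; rewrite /tri_term /triangleT /= h1 h2 h3 !andbT.
rewrite (bDelta_rot (sd b c)) (bDelta_rot (sd c a)).
have := cyc3_sorted cy.
by case: (_ < _ < _)%N; case: (_ < _ < _)%N; case: (_ < _ < _)%N => // _; rewrite ?add0r ?addr0.
Qed.

End Coefficients.

Lemma cyc4_cyc3 (a b c d : nat) : cyc4 a b c d ==>
  [&& cyc3 a b c, cyc3 a c d, ~~ (a < c < b)%N, ~~ (c < b < a)%N, ~~ (b < a < c)%N,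
      ~~ (a < d < c)%N, ~~ (d < c < a)%N & ~~ (c < a < d)%N].
Proof. order_dec [:: a; b; c; d]. Qed.

Lemma entryD m (u v : 'rV[int]_m) i : (u + v) ord0 i = u ord0 i + v ord0 i.
Proof. by rewrite mxE. Qed.
Lemma entryN m (u : 'rV[int]_m) i : (- u) ord0 i = - u ord0 i.
Proof. by rewrite mxE. Qed.

(** * Columns of the exchange matrix from quadrilaterals *)

Section Exchange.
Variable n : nat.
Local Notation V := 'I_n.+3.
Variable tau : 'I_n -> pairV n.
Hypothesis htau : triangulation tau.
Implicit Types (T : 'I_n -> pairV n) (i j k : 'I_n) (x y a b c d : V).
Local Notation ev := (ev tau).
Local Notation bot := (bot tau).

Lemma triangle_of_arc k a b c d (p : V * V * V) : quad tau k a b c d ->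
  triangleT tau p.1.1 p.1.2 p.2 ->
  [|| tau k == sd p.1.1 p.1.2, tau k == sd p.1.2 p.2 | tau k == sd p.2 p.1.1] ->
  p \in [:: (a, b, c); (b, c, a); (c, a, b); (a, c, d); (c, d, a); (d, a, c)].
Proof.
case: p => [[x y] z] /= q /and5P[xy yz pxy pyz pzx].
have [xy' yz' xz'] : [/\ x != y, y != z & x != z].
  by rewrite -!(inj_eq val_inj) /=; split; lia.
have [zx zy yx] : [/\ z != x, z != y & y != x] by rewrite eq_sym xz' eq_sym yz' eq_sym xy'.
have [pxz pyx pzy] : [/\ present tau x z, present tau y x & present tau z y].
  by rewrite presentC pzx presentC pxy presentC pyz.
have := implyP (cyc4_cyc3 _ _ _ _) (qcyc q) => /and5P[_ _ o1 o2 /and4P[o3 o4 o5 o6]].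
have key u v (w : V) : sd a c = sd u v -> w != u -> w != v -> present tau u w -> present tau v w ->
    [|| (u == a) && (v == c) | (u == c) && (v == a)] && [|| w == b | w == d].
  move=> /sd_inj e wu wv pu pv.
  have [wa wc pa pc] : [/\ w != a, w != c, present tau a w & present tau c w].
    by case: e => -[-> ->].
  case: (third_vertices htau q wa wc pa pc) => ->; rewrite eqxx ?orbT andbT;
  by case: e => -[-> ->]; rewrite !eqxx ?orbT.
rewrite (qk q) => /or3P[] /eqP e; rewrite !inE -!pair_eqE /= /pair_eq /=.
- have := key _ _ z e zx zy pxz pyz.
  by case/andP=> /orP[] /andP[/eqP h1 /eqP h2] /orP[] /eqP h3; subst;
     rewrite ?eqxx ?orbT //=; move: o1 o2 o3 o4 o5 o6; rewrite xy yz.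
- have := key _ _ x e xy' xz' pyx pzx.
  by case/andP=> /orP[] /andP[/eqP h1 /eqP h2] /orP[] /eqP h3; subst;
     rewrite ?eqxx ?orbT //=; move: o1 o2 o3 o4 o5 o6; rewrite xy yz.
- have := key _ _ y e yz' yx pzy pxy.
  by case/andP=> /orP[] /andP[/eqP h1 /eqP h2] /orP[] /eqP h3; subst;
     rewrite ?eqxx ?orbT //=; move: o1 o2 o3 o4 o5 o6; rewrite xy yz.
Qed.

Lemma Btilde_col r k a b c d : quad tau k a b c d ->
  Btilde tau r k = ind (tau r == sd b c) + ind (tau r == sd d a)
                 - ind (tau r == sd a b) - ind (tau r == sd c d).
Proof.
move=> q; have cy := qcyc q.
have /and5P[cy1 cy2 _ _ _] := implyP (cyc4_cyc3 _ _ _ _) cy.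
have [ab ac ad bc /andP[bd cd]] := and5P (implyP (cyc4_neq _ _ _ _) cy).
rewrite !(inj_eq val_inj) in ab ac ad bc bd cd.
have [[n1 n2 n3 n4] _] := cyc4_sd cy.
rewrite mxE.
transitivity (\sum_(p : V * V * V) tri_term tau r k p).
  rewrite pair_bigA /= pair_bigA /=; apply: eq_bigr => -[[x y] z] _ //.
rewrite (@sum_support _ [:: (a, b, c); (b, c, a); (c, a, b); (a, c, d); (c, d, a); (d, a, c)]); first last.
- move=> p pl; rewrite /tri_term; case: ifP => // tp.
  have := contra (triangle_of_arc q tp) pl; rewrite !negb_or => /and3P[e1 e2 e3].
  by rewrite /bDelta (negbTE e1) (negbTE e2) (negbTE e3) !andbF.
- have sy (u v : V) : u != v -> (u == v) = false by move/negbTE.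
  have sy' (u v : V) : u != v -> (v == u) = false by rewrite eq_sym => /negbTE.
  by rewrite /= !inE !xpair_eqE !(sy _ _ ab, sy _ _ ac, sy _ _ ad, sy _ _ bc, sy _ _ bd, sy _ _ cd,
    sy' _ _ ab, sy' _ _ ac, sy' _ _ ad, sy' _ _ bc, sy' _ _ bd, sy' _ _ cd) ?andbF ?andFb.
rewrite !big_cons big_nil.
have ca : present tau c a by rewrite presentC (qac q).
have h1 := tri_terms_rot r k cy1 (qab q) (qbc q) ca.
have h2 := tri_terms_rot r k cy2 (qac q) (qcd q) (qda q).
transitivity (bDelta tau (sd a b) (sd b c) (sd c a) r k + bDelta tau (sd a c) (sd c d) (sd d a) r k).
  by rewrite -h1 -h2; ring.
rewrite /bDelta (qk q) [sd c a]sdC eqxx.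
have sy (u v : pairV n) : u != v -> (v == u) = false by rewrite eq_sym => /negbTE.
have i0 : ind false = 0 by [].
rewrite (sy _ _ n1) (sy _ _ n2) (sy _ _ n3) (sy _ _ n4) !(andbF, andbT) /= i0.
by ring.
Qed.

Variable D : unitRingType.
Variable t : D.
Implicit Types S : qseed n D.

Definition Binv T S := forall k a b c d, quad T k a b c d ->
  bcol S k = ev T b c + ev T d a - ev T a b - ev T c d.

Lemma Binv_init Mq : Binv tau (init_seed tau Mq).
Proof.
move=> k a b c d q; apply: row_eq2 => i; rewrite [LHS]mxE /= !(entryD, entryN).
  by rewrite /Bprin col_mxEu !evl (Btilde_col _ q); ring.
rewrite /Bprin col_mxEd !evr mxE; have [->|ik] := eqVneq i k.
  by have := fI_self htau (qcyc q) (qk q); lia.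
by have := fI_other htau q ik; lia.
Qed.

Section Vectors.
Variables (T : 'I_n -> pairV n) (S : qseed n D) (k : 'I_n) (a b c d : V).
Hypothesis hT : triangulation T.
Hypothesis hB : Binv T S.
Hypothesis q : quad T k a b c d.

Lemma side_excl i : [/\ ~~ ((T i == sd b c) && (T i == sd a b)), ~~ ((T i == sd b c) && (T i == sd c d)),
  ~~ ((T i == sd d a) && (T i == sd a b)) & ~~ ((T i == sd d a) && (T i == sd c d))].
Proof.
have := implyP (cyc4_neq _ _ _ _) (qcyc q); rewrite !(inj_eq val_inj) => /and5P[ab ac ad bc /andP[bd cd]].
by split; apply/negP => /andP[/eqP-> /eqP/sd_inj] [] [] e1 e2;
  move: ab ac ad bc bd cd; rewrite ?e1 ?e2 ?eqxx // -?e1 -?e2 ?eqxx.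
Qed.

Lemma pm_vecE : pvec S k = ev T b c + ev T d a - ev T a c - bot b d /\
  mvec S k = ev T a b + ev T c d - ev T a c - bot b d.
Proof.
have [[n1 n2 n3 n4] _] := cyc4_sd (qcyc q).
have e := hB q; split; rewrite /pvec /mvec e; apply: row_eq2 => i;
  rewrite !(entryD, entryN) [posv _ _ _]mxE !(entryD, entryN) ?(evl, botl, evr, botr) unitvE; try (have := fI_tropical htau i (qcyc q);
    rewrite (_ : (rshift n i == lshift n k) = false) ?eq_rlshift //; lia);
  rewrite eq_lshift; (have [->|ik] := eqVneq i k;
    [ by rewrite (qk q) ![sd a c == _]eq_sym (negbTE n1) (negbTE n2) (negbTE n3) (negbTE n4) !eqxx /ind /=; lia|]);
  (have -> : T i == sd a c = false
    by apply/negbTE; rewrite -(qk q); apply: contraNneq ik => /(tri_inj hT)->);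
  have [] := side_excl i; rewrite /ind;
  by case: (T i == sd b c); case: (T i == sd d a); case: (T i == sd a b); case: (T i == sd c d) => //=.
Qed.

End Vectors.
End Exchange.

(** * The column formula under a flip *)

Section MutateB.
Variable n : nat.
Local Notation V := 'I_n.+3.
Variable tau : 'I_n -> pairV n.
Hypothesis htau : triangulation tau.
Implicit Types (T : 'I_n -> pairV n) (i j k : 'I_n) (x y a b c d : V).
Local Notation ev := (ev tau).
Local Notation bot := (bot tau).
Variables (D : unitRingType) (t : D).
Hypothesis tU : t \is a GRing.unit.
Implicit Types S : qseed n D.

Lemma ev_arc T k x y : triangulation T -> T k = sd x y ->
  ev T x y = unitv (lshift n k) + bot x y.
Proof.
move=> hT e; apply: row_eq2 => i; rewrite entryD unitvE ?evl ?evr ?botl ?botr.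
  by rewrite -e (inj_eq (tri_inj hT)) eq_lshift addr0 /ind; case: eqP.
by rewrite eq_rlshift add0r.
Qed.

Lemma ev_flip T k a b c d x y : triangulation T -> quad T k a b c d ->
  sd x y != sd a c -> sd x y != sd b d -> ev (flip T k) x y = ev T x y.
Proof.
move=> hT q h1 h2; apply: row_eq2 => i; rewrite ?evl ?evr //.
have [->|ik] := eqVneq i k; last by rewrite (flip_neq hT q).
by rewrite (flip_k hT q) (qk q) ![_ == sd x y]eq_sym (negbTE h1) (negbTE h2).
Qed.

Section BcolMutate.
Variables (S : qseed n D) (k j : 'I_n).
Hypothesis gS : good t S.
Hypothesis jk : j != k.
Let kk := lshift n k.

Lemma bcol_mutate0 : sB S kk j = 0 -> bcol (mutate t S k) j = bcol S j.
Proof.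
move=> h; apply: row_ext => i; rewrite /bcol !mxE /= -/kk (negbTE jk) orbF h.
by case: eqP => [->|_]; rewrite ?h ?oppr0 // maxxx !mulr0 subr0 addr0.
Qed.

Lemma bcol_mutate1 : sB S kk j = 1 ->
  bcol (mutate t S k) j = bcol S j + pvec S k - unitv kk.
Proof.
move=> h; apply: row_ext => i; rewrite /bcol /pvec /posv !mxE /= -/kk (negbTE jk) orbF h ?eqxx /=.
case: (i =P kk) => [->|_]; rewrite ?h ?(B_diag tU) //.
by rewrite !subr0 mulr1 (_ : Num.max (-1) 0 = 0) // mulr0 subr0.
Qed.

Lemma bcol_mutateN1 : sB S kk j = -1 ->
  bcol (mutate t S k) j = bcol S j - mvec S k + unitv kk.
Proof.
move=> h; apply: row_ext => i; rewrite /bcol /mvec /posv !mxE /= -/kk (negbTE jk) orbF h ?eqxx /=.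
case: (i =P kk) => [->|_]; rewrite ?h ?(B_diag tU) //.
by rewrite opprK (_ : Num.max (-1) 0 = 0) // (_ : Num.max 1 0 = 1) // mulr0 mulr1 !mulr0n; ring.
Qed.

Lemma bcol_mutate_k : bcol (mutate t S k) k = - bcol S k.
Proof. by apply: row_ext => i; rewrite /bcol !mxE /= eqxx orbT. Qed.

End BcolMutate.

Section Step.
Variables (T : 'I_n -> pairV n) (S : qseed n D).
Hypothesis hT : triangulation T.
Hypothesis gS : good t S.
Hypothesis hB : Binv tau T S.
Variable k : 'I_n.
Let T' := flip T k.
Let S' := mutate t S k.

Lemma ev_at_k a b c d x y : quad T k a b c d -> sd x y != sd a c -> ev T x y ord0 (lshift n k) = 0.
Proof. by move=> q ne; rewrite evl (qk q) eq_sym (negbTE ne). Qed.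

Lemma present_back a b c d x y : quad T k a b c d -> present T' x y -> sd x y != sd b d ->
  present T x y && (sd x y != sd a c).
Proof. by move=> q; rewrite /T' (present_flip hT q) => /orP[|/eqP->]; rewrite ?eqxx. Qed.

Definition colform T0 p q r s := ev T0 q r + ev T0 s p - ev T0 p q - ev T0 r s.

Lemma colform_rot2 T0 p q r s : colform T0 r s p q = colform T0 p q r s.
Proof. by apply: row_ext => i; rewrite !(entryD, entryN); ring. Qed.

Lemma Binv_step_k a b c d p q r s : quad T k a b c d -> quad T' k p q r s ->
  bcol S' k = colform T' p q r s.
Proof.
move=> q0 q1; have cy := qcyc q0; have cy1 := qcyc q1; have hT' := flip_tri k hT.
have := qk q1; rewrite /T' (flip_k hT q0) -/T' => e.
wlog [ep er] : p q r s q1 cy1 e / b = p /\ d = r.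
  move=> W; case: (sd_inj e) => -[e1 e2]; first exact: (W p q r s).
  rewrite -colform_rot2; apply: (W r s p q) => //; first exact: quad_rot2.
    by rewrite cyc4_rot cyc4_rot.
  by rewrite [sd r p]sdC.
subst p r.
have := implyP (cyc4_neq _ _ _ _) cy1; rewrite !(inj_eq val_inj) => /and5P[bq bd bs qd /andP[qs ds]].
have third x : x != b -> x != d -> present T' b x -> present T' d x -> x = a \/ x = c.
  exact: (flip_third hT q0).
have := third q; rewrite eq_sym bq qd (qab q1) presentC (qbc q1) => /(_ isT isT isT isT) hq.
have := third s; rewrite ![s == _]eq_sym bs ds presentC (qda q1) (qcd q1) => /(_ isT isT isT isT) hs.
have [eq es] : q = c /\ s = a.
  have /and5P[o _ _ _ _] := implyP (cyc4_orient a b c d a) cy.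
  move: qs cy1 o; case: hq => ->; case: hs => ->; rewrite ?eqxx // => _ -> //.
subst q s; have [[n1 n2 n3 n4] [m1 m2 m3 m4]] := cyc4_sd cy.
rewrite bcol_mutate_k (hB q0) /colform !(ev_flip hT q0) //.
by apply: row_ext => i; rewrite !(entryD, entryN); ring.
Qed.

Lemma Binv_step_adj a b c d p q r s j : quad T k a b c d -> quad T' j p q r s ->
  j != k -> (sd p q == sd b d) || (sd q r == sd b d) -> bcol S' j = colform T' p q r s.
Proof.
move=> q0 q1 jk; have cy := qcyc q0; have cy1 := qcyc q1; have hT' := flip_tri k hT.
have := implyP (cyc4_neq _ _ _ _) cy1; rewrite !(inj_eq val_inj) => /and5P[pq pr ps qr /andP[qs rs]].
have [sp sq] : s != p /\ s != q by rewrite eq_sym ps eq_sym qs.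
(* A triangle on [bd] has its apex at [a] or [c], orientation excludes one way of matching its
   vertices, and a half-turn of [a b c d] exchanges the two apexes. *)
wlog adj : a b c d q0 cy / [\/ [/\ p = b, q = d & r = a] | [/\ p = a, q = b & r = d]].
  move=> W.
  have third x : x != b -> x != d -> present T' b x -> present T' d x -> x = a \/ x = c.
    exact: (flip_third hT q0).
  have q0' := quad_rot2 q0; have cy' := qcyc q0'.
  have /and5P[_ o1 o2 o3 /and3P[o4 _ _]] := implyP (cyc4_orient a b c d s) cy.
  case/orP => /eqP e.
    have hr : r = a \/ r = c.
      case: (sd_inj e) => -[e1 e2]; subst p q; apply: third; rewrite 1?eq_sym //;
      by [apply: (qbc q1) | apply: (qac q1)].
    case: (sd_inj e) => -[e1 e2]; case: hr => er.
    - by apply: (W a b c d) => //; [left | rewrite e eqxx].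
    - by rewrite e1 e2 er (negbTE o1) in cy1.
    - by rewrite e1 e2 er (negbTE o2) in cy1.
    - by apply: (W c d a b) => //; [left | rewrite e [sd d b]sdC eqxx].
  have hp : p = a \/ p = c.
    have pC := presentC T' _ p.
    case: (sd_inj e) => -[e1 e2]; subst q r; apply: third; rewrite // pC;
    by [apply: (qab q1) | apply: (qac q1)].
  case: (sd_inj e) => -[e1 e2]; case: hp => ep.
  - by apply: (W a b c d) => //; [right | rewrite e eqxx orbT].
  - by rewrite e1 e2 ep (negbTE o4) in cy1.
  - by rewrite e1 e2 ep (negbTE o3) in cy1.
  - by apply: (W c d a b) => //; [right | rewrite e [sd d b]sdC eqxx orbT].
have [[n1 n2 n3 n4] [m1 m2 m3 m4]] := cyc4_sd cy => _.
have [pvE mvE] := pm_vecE htau hT hB q0.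
have ebd : ev T' b d = unitv (lshift n k) + bot b d.
  by apply: ev_arc; rewrite // /T' (flip_k hT q0).
have nbd x y : x != b -> x != d -> sd x y != sd b d.
  by move=> xb xd; apply/eqP => /sd_inj[] [e1 _]; rewrite e1 eqxx in xb xd.
have Tj : T' j = T j by rewrite /T' (flip_neq hT q0).
have eac := ev_arc hT (qk q0).
have old x y : present T' x y -> sd x y != sd b d ->
    [/\ ev T' x y = ev T x y, present T x y & ev T x y ord0 (lshift n k) = 0].
  move=> pxy nxy; have /andP[h1 h2] := present_back q0 pxy nxy.
  by rewrite (ev_flip hT q0) // (ev_at_k q0 h2).
have ek : ev T a c ord0 (lshift n k) = 1.
  by rewrite evl (qk q0) eqxx.
case: adj => -[ep eq er]; subst p q r.
  (* Before the flip the quadrilateral of [j] had [c] in the place of [d], hence [ac] as a side; its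
     position gives the entry 1. *)
  have cyo : cyc4 b c a s by apply: (implyP (cyc4_insert b d a c s)); rewrite cy1.
  have [sbE sbP sbk] := old _ _ (qda q1) (nbd _ _ sp sq).
  have [asE asP ask] : [/\ ev T' a s = ev T a s, present T a s & ev T a s ord0 (lshift n k) = 0].
    by apply: old; [apply: (qcd q1) | rewrite sdC; apply: nbd].
  have qo : quad T j b c a s.
    apply/and5P; split; rewrite ?(qbc q0) ?sbP ?asP //; first by rewrite -Tj (qk q1).
    by rewrite presentC (qac q0).
  have bE := hB qo.
  have bkj : sB S (lshift n k) j = 1.
    have := congr1 (fun u : 'rV_(n + n) => u ord0 (lshift n k)) bE.
    rewrite /bcol mxE !(entryD, entryN) sbk ask (ev_at_k q0 n2) [ev T c a]evC ek.
    by move=> ->; rewrite subr0 addr0 subr0.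
  rewrite (bcol_mutate1 gS jk bkj) bE pvE /colform sbE asE ebd (ev_flip hT q0) // [ev T c a]evC.
  by apply: row_ext => i; rewrite !(entryD, entryN); ring.
(* Here [c] stood in the place of [b], and [ac] is a side of the other kind, which gives the entry
   -1. *)
have cyo : cyc4 a c d s by apply: (implyP (cyc4_insert' b d a c s)); rewrite cy1.
have [saE saP sak] : [/\ ev T' s a = ev T s a, present T s a & ev T s a ord0 (lshift n k) = 0].
  by apply: old; [apply: (qda q1) | apply: nbd; rewrite // eq_sym].
have [dsE dsP dsk] : [/\ ev T' d s = ev T d s, present T d s & ev T d s ord0 (lshift n k) = 0].
  by apply: old; [apply: (qcd q1) | rewrite sdC; apply: nbd; rewrite // eq_sym].
have qo : quad T j a c d s.
  by apply/and5P; split; rewrite ?(qcd q0) ?saP ?dsP ?(qac q0) // -Tj (qk q1).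
have bE := hB qo.
have bkj : sB S (lshift n k) j = -1.
  have := congr1 (fun u : 'rV_(n + n) => u ord0 (lshift n k)) bE.
  rewrite /bcol mxE !(entryD, entryN) sak dsk (ev_at_k q0 n3) ek.
  by move=> ->; rewrite addr0 subr0 add0r.
rewrite (bcol_mutateN1 gS jk bkj) bE mvE /colform saE dsE ebd (ev_flip hT q0) //.
by apply: row_ext => i; rewrite !(entryD, entryN); ring.
Qed.

Lemma Binv_step : Binv tau T' S'.
Proof.
move=> j p q r s q1; rewrite -/(colform T' p q r s).
have [a [b [c [d q0]]]] := quad_exists k hT.
have [ej|jk] := eqVneq j k; first by rewrite ej in q1 *; apply: Binv_step_k q0 q1.
have [h|h1] := boolP ((sd p q == sd b d) || (sd q r == sd b d)); first exact: Binv_step_adj q0 q1 jk h.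
have [h|h2] := boolP ((sd r s == sd b d) || (sd s p == sd b d)).
  by rewrite -colform_rot2; apply: Binv_step_adj q0 _ jk h; apply: quad_rot2.
case/norP: h1 => m1 m2; case/norP: h2 => m3 m4.
have old x y : present T' x y -> sd x y != sd b d ->
    [/\ ev T' x y = ev T x y, present T x y & ev T x y ord0 (lshift n k) = 0].
  move=> pxy nxy; have /andP[h1 h2] := present_back q0 pxy nxy.
  by rewrite (ev_flip hT q0) // (ev_at_k q0 h2).
have [e1 p1 k1] := old _ _ (qab q1) m1; have [e2 p2 k2] := old _ _ (qbc q1) m2.
have [e3 p3 k3] := old _ _ (qcd q1) m3; have [e4 p4 k4] := old _ _ (qda q1) m4.
have qo : quad T j p q r s.
  have Tj : T' j = T j by rewrite /T' (flip_neq hT q0).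
  by apply/and5P; split; rewrite ?p1 ?p2 ?p3 ?p4 ?(qcyc q1) // -Tj (qk q1).
rewrite bcol_mutate0 //; first by rewrite (hB qo) /colform e1 e2 e3 e4.
have := congr1 (fun u : 'rV_(n + n) => u ord0 (lshift n k)) (hB qo).
by rewrite /bcol mxE !(entryD, entryN) k1 k2 k3 k4 => ->.
Qed.

End Step.
End MutateB.

(** * The noncommutative Ptolemy relation *)

Section Ptolemy.
Variables (I : Type) (D : unitRingType) (z : I -> I -> D).

(* The noncommutative Ptolemy relation of Berenstein and Retakh, in all quadrilaterals
   with diagonal [ac]. *)
Definition Ptol a c := forall i j,
  z i j = z i a * (z c a)^-1 * z c j + z i c * (z a c)^-1 * z a j.

Lemma Ptol_sym a c : Ptol a c -> Ptol c a.
Proof. by move=> h i j; rewrite (h i j) addrC. Qed.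

(** [Ptol a c] says that [a] and [c] span a pairing of rank 2. Applied to [z b b = 0] it gives the
    relation [tri] among the sides of the triangle, and this cancels the cross terms when [c] is
    replaced by [b]. *)
Lemma Ptol_third a b c : Ptol a c -> z b b = 0 ->
  z a b \is a GRing.unit -> z b a \is a GRing.unit -> z c a \is a GRing.unit ->
  z a c \is a GRing.unit -> Ptol a b.
Proof.
move=> h hb ab ba ca ac i j.
have tri : (z b a)^-1 * z b c * (z a c)^-1 + (z c a)^-1 * z c b * (z a b)^-1 = 0.
  have := h b b; rewrite hb => /esym e.
  apply: (mulrI ba); apply: (mulIr ab); rewrite mulr0 mul0r -[RHS]e mulrDr mulrDl addrC.
  by congr (_ + _); rewrite !mulrA ?(mulrV ba, mul1r) // mulrVK.
have PQ : z i a * (z b a)^-1 * z b c * (z a c)^-1 * z a j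
        + z i a * (z c a)^-1 * z c b * (z a b)^-1 * z a j = 0.
  by rewrite -[RHS](mulr0 (z i a)) -[in RHS](mul0r (z a j)) -tri mulrDl mulrDr !mulrA.
rewrite (h i j) (h b j) (h i b) !mulrDr !mulrDl !mulrA (mulrVK ba) (mulrK ab).
by rewrite -[RHS]addrA [X in _ = _ + X]addrA PQ add0r.
Qed.

End Ptolemy.

Section Monomials.
Variables (n : nat) (D : unitRingType) (t : D).
Hypothesis tU : t \is a GRing.unit.
Variable S : qseed n D.
Hypothesis gS : good t S.

Definition mono (s : bool) (m : int) (u : 'rV[int]_(n + n)) : D :=
  (-1) ^+ s * (t ^ m * sfr t S u).

Lemma tzU (m : int) : t ^ m \is a GRing.unit.
Proof. by case: m => m; rewrite ?NegzE -?exprnN ?unitrV; apply: unitrX. Qed.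

Lemma monoU s m u : mono s m u \is a GRing.unit.
Proof.
apply: rpredM; first by apply: unitrX; rewrite unitrN1.
by apply: rpredM; [exact: tzU | exact: sfrU].
Qed.

Lemma scaled_mul (x y w : D) (s1 s2 : bool) (m1 m2 q : int) : GRing.comm t x ->
  x * y = t ^ q * w ->
  (-1) ^+ s1 * (t ^ m1 * x) * ((-1) ^+ s2 * (t ^ m2 * y)) =
  (-1) ^+ (s1 (+) s2) * (t ^ (m1 + m2 + q) * w).
Proof.
move=> tx xy; rewrite signr_addb !tzD // -!mulrA; congr (_ * _).
rewrite [x * _]mulrA (commr_sign x s2) -!mulrA [LHS]mulrA (commr_sign (t ^ m1) s2) -!mulrA.
by congr (_ * (_ * _)); rewrite [x * _]mulrA -(commtz m2 tx) -!mulrA xy.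
Qed.

Lemma mono_mul s1 m1 u1 s2 m2 u2 : mono s1 m1 u1 * mono s2 m2 u2 =
  mono (s1 (+) s2) (m1 + m2 + qform (sL S) u1 u2) (u1 + u2).
Proof. by apply: scaled_mul; [apply: sfr_comm | apply: sfr_mul]. Qed.

Lemma monoV s m u : (mono s m u)^-1 = mono s (- m) (- u).
Proof.
apply: (mulrI (monoU s m u)); rewrite divrr ?monoU // mono_mul addbb qformNr.
by rewrite (qform_self u (g_anti gS)) !subrr /mono sfr0 expr0z !mul1r.
Qed.

Lemma mono3 s1 m1 u1 s2 m2 u2 s3 m3 u3 :
  mono s1 m1 u1 * (mono s2 m2 u2)^-1 * mono s3 m3 u3 =
  mono (s1 (+) s2 (+) s3)
    (m1 - m2 + m3 - qform (sL S) u1 u2 + qform (sL S) u1 u3 - qform (sL S) u2 u3)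
    (u1 - u2 + u3).
Proof. by rewrite monoV !mono_mul !qformD; congr (mono _ _ _); ring. Qed.

End Monomials.

(** * Lambda lengths under a flip *)

Section Family.
Variable n : nat.
Local Notation V := 'I_n.+3.
Variable tau : 'I_n -> pairV n.
Hypothesis htau : triangulation tau.
Implicit Types (T : 'I_n -> pairV n) (i j k : 'I_n) (x y a b c d : V).
Local Notation ev := (ev tau).
Local Notation bot := (bot tau).
Variables (D : unitRingType) (t : D).
Hypothesis hD : forall x : D, x != 0 -> x \is a GRing.unit.
Hypothesis tU : t \is a GRing.unit.
Hypothesis troot : forall m : int, t ^ m = 1 -> m = 0.
Implicit Types S : qseed n D.
Variable z : V -> V -> D.

(** The exponents of [t] in the triangle relation of noncommutative lambda lengths: its two
    monomials cancel exactly when these exponents agree. *)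
Definition trirel T (L : 'M[int]_(n + n)) (m : V -> V -> int) x y w :=
  m x y + m y w + m w x = qform L (ev T x y) (ev T y w)
    + qform L (ev T y w) (ev T w x) + qform L (ev T w x) (ev T x y).

Record zinv T S (m : V -> V -> int) : Prop := Zinv {
  z_diag : forall x, z x x = 0;
  z_ptol : forall a c, present T a c -> Ptol z a c;
  z_anti : forall x y, m y x = - m x y;
  z_mono : forall x y, present T x y -> z x y = mono t S (y < x)%N (m x y) (ev T x y);
  z_tri : forall x y w, present T x y -> present T y w -> present T w x ->
    trirel T (sL S) m x y w }.

Lemma trirel_rot T L m x y w : trirel T L m x y w -> trirel T L m y w x.
Proof. by rewrite /trirel => h; rewrite addrC addrA h -addrA addrC. Qed.

Lemma trirel_swap T L m x y w : anti L -> (forall x y, m y x = - m x y) ->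
  trirel T L m x y w -> trirel T L m y x w.
Proof.
move=> aL am; rewrite /trirel (am x y) (am w x) (am y w).
rewrite [ev T y x]evC [ev T x w]evC [ev T w y]evC.
rewrite (qform_anti (ev T x y) (ev T w x) aL) (qform_anti (ev T w x) (ev T y w) aL).
rewrite (qform_anti (ev T y w) (ev T x y) aL); clear htau hD tU troot; lia.
Qed.

Section Step.
Variables (T : 'I_n -> pairV n) (S : qseed n D) (m : V -> V -> int) (k : 'I_n).
Hypothesis hT : triangulation T.
Hypothesis gS : good t S.
Hypothesis hB : Binv tau T S.
Hypothesis hz : zinv T S m.
Let T' := flip T k.
Let S' := mutate t S k.

(** The exponent that [mono3] gives to the Ptolemy term [z b c * (z a c)^-1 * z a d]. *)
Definition newm a b c d := m b c - m a c + m a d - qform (sL S) (ev T b c) (ev T a c)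
  + qform (sL S) (ev T b c) (ev T a d) - qform (sL S) (ev T a c) (ev T a d).

Lemma compat_side a b c d u : quad T k a b c d ->
  qform (sL S) (ev T b c) u + qform (sL S) (ev T a d) u
  - qform (sL S) (ev T a b) u - qform (sL S) (ev T c d) u = u ord0 (lshift n k).
Proof.
move=> q; rewrite -(g_compat gS) (hB q) !qformD [ev T d a]evC; ring.
Qed.

Lemma sfr_new a b c d : quad T k a b c d ->
  sfr t S' (ev T' b d) = sfr t S (ev T b c - ev T a c + ev T a d)
                       + sfr t S (ev T a b - ev T a c + ev T c d).
Proof.
move=> q; have [pE mE] := pm_vecE htau hT hB q.
rewrite (@ev_arc _ tau T' k b d (flip_tri k hT) (flip_k hT q)).
rewrite (sfr_mut_k hD tU troot gS) ?botl // pE mE [ev T d a]evC.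
by congr (_ + _); congr (sfr t S _); apply: row_ext => i; rewrite !(entryD, entryN); ring.
Qed.

(** The triangle relations on both sides of [ac] and compatibility show that the two Ptolemy terms
    have the same power of [t]; by [cyc4_signs] they have the same sign. What remains is the
    exchange relation [sfr_new]. *)
Lemma z_new a b c d : quad T k a b c d ->
  z b d = mono t S' (d < b)%N (newm a b c d) (ev T' b d).
Proof.
move=> q; have [/eqP s1 /eqP s2] := andP (implyP (cyc4_signs _ _ _ _) (qcyc q)).
have [[n1 n2 n3 n4] _] := cyc4_sd (qcyc q).
have pca : present T c a by rewrite presentC (qac q).
have pba : present T b a by rewrite presentC (qab q).
have pad : present T a d by rewrite presentC (qda q).
have M := z_mono hz.
rewrite (z_ptol hz (qac q) b d) (M _ _ pba) (M _ _ pca) (M _ _ (qcd q)) (M _ _ (qbc q)).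
rewrite (M _ _ (qac q)) (M _ _ pad) !(mono3 tU gS) s1 s2 [ev T b a]evC [ev T c a]evC.
have aL := g_anti gS.
set X := (X in mono t S _ X _ + _).
have -> : X = newm a b c d.
  have t1 := z_tri hz (qab q) (qbc q) pca.
  have t2 := z_tri hz (qac q) (qcd q) (qda q).
  rewrite /trirel [ev T c a]evC in t1; rewrite /trirel [ev T d a]evC in t2.
  have h1 := compat_side (ev T c d) q; have h2 := compat_side (ev T b c) q.
  rewrite (ev_at_k _ q n3) in h1; rewrite (ev_at_k _ q n2) in h2.
  rewrite (qform_self _ aL) in h1; rewrite (qform_self _ aL) in h2.
  have m1 := z_anti hz a b; have m2 := z_anti hz a c; have m3 := z_anti hz a d.
  rewrite (qform_anti (ev T a c) (ev T a b) aL) in t1.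
  rewrite (qform_anti (ev T a d) (ev T a c) aL) in t2.
  rewrite (qform_anti (ev T a d) (ev T b c) aL) (qform_anti (ev T c d) (ev T b c) aL) in h2.
  rewrite (qform_anti (ev T a d) (ev T c d) aL) in h1.
  rewrite /X /newm (qform_anti (ev T b c) (ev T a c) aL).
  rewrite (qform_anti (ev T b c) (ev T a c) aL) in t1.
  rewrite (qform_anti (ev T a c) (ev T b c) aL) in t1 *.
  clear - t1 t2 m1 m2 m3 h1 h2; lia.
rewrite /mono -mulrDr -mulrDr [X in _ * (_ * X)]addrC -(sfr_new q) //.
Qed.

Lemma newm_rot2 a b c d : quad T k a b c d -> newm c d a b = - newm a b c d.
Proof.
move=> q; have aL := g_anti gS; have pca : present T c a by rewrite presentC (qac q).
have t1 := z_tri hz (qab q) (qbc q) pca; have t2 := z_tri hz (qac q) (qcd q) (qda q).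
rewrite /trirel [ev T c a]evC in t1; rewrite /trirel [ev T d a]evC in t2.
have m1 := z_anti hz a b; have m2 := z_anti hz a c; have m3 := z_anti hz a d.
have m4 := z_anti hz b c; have [[n1 n2 n3 n4] _] := cyc4_sd (qcyc q).
have h1 := compat_side (ev T a d) q; have h2 := compat_side (ev T b c) q.
rewrite (ev_at_k _ q) 1?sdC // in h1; rewrite (ev_at_k _ q n2) in h2.
rewrite /newm [ev T d a]evC [ev T c a]evC [ev T c b]evC.
rewrite (qform_self _ aL) in h1; rewrite (qform_self _ aL) in h2.
rewrite (qform_anti (ev T a c) (ev T a b) aL) in t1.
rewrite (qform_anti (ev T a d) (ev T a c) aL) in t2.
rewrite (qform_anti (ev T a d) (ev T b c) aL) (qform_anti (ev T c d) (ev T b c) aL) in h2.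
rewrite (qform_anti (ev T a d) (ev T b c) aL) (qform_anti (ev T a d) (ev T a c) aL).
rewrite (qform_anti (ev T b c) (ev T a c) aL) in t1 *.
clear - t1 t2 m1 m2 m3 m4 h1 h2; lia.
Qed.

Definition setm b d (v : int) x y := if (x == b) && (y == d) then v
  else if (x == d) && (y == b) then - v else m x y.

Lemma setm_other b d v x y : sd x y != sd b d -> setm b d v x y = m x y.
Proof.
move=> ne; rewrite /setm; case: ifP => [/andP[/eqP e1 /eqP e2]|_].
  by rewrite e1 e2 eqxx in ne.
by case: ifP => [/andP[/eqP e1 /eqP e2]|_] //; rewrite e1 e2 sdC eqxx in ne.
Qed.

Lemma setm_diag b d v : setm b d v b d = v.
Proof. by rewrite /setm !eqxx. Qed.

Lemma setm_anti b d v x y : b != d -> setm b d v y x = - setm b d v x y.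
Proof.
move=> bd; rewrite /setm [(y == b) && _]andbC [(y == d) && _]andbC (z_anti hz x y).
have : ~~ (((x == b) && (y == d)) && ((x == d) && (y == b))).
  by apply/negP => /andP[/andP[/eqP -> _] /andP[/eqP e _]]; rewrite e eqxx in bd.
by case: ((x == b) && (y == d)); case: ((x == d) && (y == b)); rewrite ?opprK.
Qed.

Lemma trirel_new a b c d v : quad T k a b c d -> v = newm a b c d ->
  trirel T' (sL S') (setm b d v) a b d.
Proof.
move=> q ev_; have aL := g_anti gS; have pca : present T c a by rewrite presentC (qac q).
have [[n1 n2 n3 n4] [m1 m2 m3 m4]] := cyc4_sd (qcyc q).
have t1 := z_tri hz (qab q) (qbc q) pca; have t2 := z_tri hz (qac q) (qcd q) (qda q).
rewrite /trirel [ev T c a]evC in t1; rewrite /trirel [ev T d a]evC in t2.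
have a1 := z_anti hz a b; have a2 := z_anti hz a c; have a3 := z_anti hz a d; have a4 := z_anti hz b c.
have h1 := compat_side (ev T a d) q; have h2 := compat_side (ev T a b) q.
rewrite (ev_at_k _ q) 1?sdC // in h1; rewrite (ev_at_k _ q n1) in h2.
rewrite (qform_self _ aL) in h1; rewrite (qform_self _ aL) in h2.
rewrite /trirel setm_diag !setm_other // ev_ !(mutL tU _ gS).
rewrite (ev_flip tau hT q n1 m1) (ev_flip tau hT q n4 m4) (@ev_arc _ tau T' k b d (flip_tri k hT) (flip_k hT q)).
have [pE mE] := pm_vecE htau hT hB q.
have -> : emap S k (unitv (lshift n k) + bot b d) = ev T a b + ev T c d - ev T a c.
  rewrite emapD emap_k emap_id ?botl // mE.
  by apply: row_ext => i; rewrite !(entryD, entryN); ring.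
rewrite !emap_id ?(ev_at_k _ q) // !qformD.
rewrite [ev T d a]evC /newm.
have g1 := qform_anti (ev T a b) (ev T a c) aL; have g2 := qform_anti (ev T a b) (ev T a d) aL.
have g3 := qform_anti (ev T a b) (ev T b c) aL; have g4 := qform_anti (ev T a b) (ev T c d) aL.
have g5 := qform_anti (ev T a c) (ev T a d) aL; have g6 := qform_anti (ev T a c) (ev T b c) aL.
have g7 := qform_anti (ev T a c) (ev T c d) aL; have g8 := qform_anti (ev T a d) (ev T b c) aL.
have g9 := qform_anti (ev T a d) (ev T c d) aL; have g10 := qform_self (ev T a b) aL.
clear - t1 t2 a1 a2 a3 a4 h1 h2 g1 g2 g3 g4 g5 g6 g7 g8 g9 g10; lia.
Qed.

Lemma trirel_eq L m1 m2 x y w : m1 x y = m2 x y -> m1 y w = m2 y w -> m1 w x = m2 w x ->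
  trirel T' L m1 x y w -> trirel T' L m2 x y w.
Proof. by rewrite /trirel => -> -> ->. Qed.

Lemma zinv_step a b c d : quad T k a b c d -> zinv T' S' (setm b d (newm a b c d)).
Proof.
move=> q; set v := newm a b c d; set m' := setm b d v.
have [[n1 n2 n3 n4] [m1 m2 m3 m4]] := cyc4_sd (qcyc q).
have := implyP (cyc4_neq _ _ _ _) (qcyc q); rewrite !(inj_eq val_inj) => /and5P[ab ac ad bc /andP[bd cd]].
have q' := quad_rot2 q; have aL' : anti (sL S') by apply: mut_anti.
have am' x y : m' y x = - m' x y by apply: setm_anti.
have old x y : present T' x y -> sd x y != sd b d -> present T x y && (sd x y != sd a c).
  exact: (present_back hT q).
have zm x y : present T' x y -> z x y = mono t S' (y < x)%N (m' x y) (ev T' x y).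
  move=> pxy; have [e|ne] := eqVneq (sd x y) (sd b d).
    case: (sd_inj e) => -[-> ->]; first by rewrite (z_new q) /m' setm_diag.
    have := z_new q'; rewrite (newm_rot2 q) => ->.
    by rewrite am' /m' setm_diag.
  have /andP[p0 nac] := old _ _ pxy ne.
  rewrite (z_mono hz p0) /m' setm_other // (ev_flip tau hT q nac ne) /mono.
  by rewrite (sfr_mut_neq tU gS) // (ev_at_k _ q nac).
have pu x y : present T' x y -> z x y \is a GRing.unit.
  by move=> /zm ->; apply: monoU => //; apply: good_mutate.
have pt x y : present T' x y -> sd x y != sd b d -> Ptol z x y.
  by move=> pxy ne; have /andP[p0 _] := old _ _ pxy ne; apply: (z_ptol hz).
have pf := present_flip hT q.
have [pab pbc pcd pda] : [/\ present T' a b, present T' b c, present T' c d & present T' d a].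
  by rewrite /T' !pf (qab q) (qbc q) (qcd q) (qda q) n1 n2 n3 n4.
have pbd : present T' b d by rewrite /T' pf eqxx orbT.
(* The side [ab] survives the flip, and [Ptol_third] carries its Ptolemy relation over to [bd]. *)
have Pbd : Ptol z b d.
  apply: (@Ptol_third _ _ z b d a); try (apply: pu; rewrite // presentC //).
    by apply: pt; rewrite 1?presentC // sdC.
  exact: (z_diag hz).
split=> //.
- exact: (z_diag hz).
- move=> x y pxy; have [e|ne] := eqVneq (sd x y) (sd b d); last exact: pt.
  by case: (sd_inj e) => -[-> ->] //; apply: Ptol_sym.
have tabd : trirel T' (sL S') m' a b d by apply: trirel_new q _.
have tcdb : trirel T' (sL S') m' c d b.
  apply: (@trirel_eq _ (setm d b (- v))); last by apply: trirel_new q' _; rewrite (newm_rot2 q).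
  - by rewrite /m' !setm_other // [sd d b]sdC.
  - by rewrite setm_diag am' /m' setm_diag.
  - by rewrite /m' !setm_other // [sd d b]sdC.
have third x : x != b -> x != d -> present T' b x -> present T' d x -> x = a \/ x = c.
  exact: (flip_third hT q).
have key x y w : sd x y = sd b d -> present T' x y -> present T' y w -> present T' w x ->
    trirel T' (sL S') m' x y w.
  move=> e pxy pyw pwx.
  have [wx wy] : w != x /\ w != y.
    by rewrite (present_neq (flip_tri k hT) pwx) eq_sym (present_neq (flip_tri k hT) pyw).
  have pxw : present T' x w by rewrite presentC.
  case: (sd_inj e) => -[ex ey]; subst x y.
    case: (third w wx wy pxw pyw) => ->; first by apply: trirel_rot; exact: tabd.
    by apply: trirel_swap => //; apply: trirel_rot; apply: tcdb.
  case: (third w wy wx pyw pxw) => ->; last by apply: trirel_rot; exact: tcdb.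
  by apply: trirel_swap => //; apply: trirel_rot; apply: tabd.
move=> x y w pxy pyw pwx.
have [e1|ne1] := eqVneq (sd x y) (sd b d); first exact: key.
have [e2|ne2] := eqVneq (sd y w) (sd b d); first by do 2 apply: trirel_rot; apply: key.
have [e3|ne3] := eqVneq (sd w x) (sd b d); first by apply: trirel_rot; apply: key.
have /andP[p1 k1] := old _ _ pxy ne1; have /andP[p2 k2] := old _ _ pyw ne2.
have /andP[p3 k3] := old _ _ pwx ne3.
have := z_tri hz p1 p2 p3; rewrite /trirel !(mutL tU _ gS) /m' !setm_other //.
rewrite (ev_flip tau hT q k1 ne1) (ev_flip tau hT q k2 ne2) (ev_flip tau hT q k3 ne3).
by rewrite !emap_id // ?(ev_at_k _ q k1) ?(ev_at_k _ q k2) ?(ev_at_k _ q k3).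
Qed.

End Step.
End Family.

(** * Existence of lambda lengths by developing the polygon *)

Section Points.
Variable D : unitRingType.
(** In place of the determinant of two plane vectors, which is lacking over a noncommutative ring, a
    point carries a left vector and a right covector, and [pairing] evaluates one on the other. *)
Definition pt := ((D * D) * (D * D))%type.
Definition pairing (p q : pt) : D := p.1.1 * q.2.1 + p.1.2 * q.2.2.

Definition lcomb (al be : D) (p q : D * D) : D * D := (al * p.1 + be * q.1, al * p.2 + be * q.2).
Definition rcomb (al be : D) (p q : D * D) : D * D := (p.1 * al + q.1 * be, p.2 * al + q.2 * be).

Lemma pairing_lcomb al be (p q : pt) w r : pairing (lcomb al be p.1 q.1, w) r =
  al * pairing p r + be * pairing q r.
Proof. by rewrite /pairing /= !mulrDl !mulrDr !mulrA addrACA. Qed.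

Lemma pairing_rcomb al be (p q : pt) l r : pairing r (l, rcomb al be p.2 q.2) =
  pairing r p * al + pairing r q * be.
Proof. by rewrite /pairing /= !mulrDl !mulrDr !mulrA addrACA. Qed.

End Points.

Section Existence.
Variable n : nat.
Local Notation V := 'I_n.+3.
Variable tau : 'I_n -> pairV n.
Implicit Types (x y w a b c d : V).
Variables (D : unitRingType) (t : D).
Hypothesis tU : t \is a GRing.unit.
Variables (T : 'I_n -> pairV n) (S : qseed n D).
Hypothesis hT : triangulation T.
Hypothesis gS : good t S.
Local Notation ev := (ev tau T).
Local Notation L := (sL S).
Local Notation mono := (mono t S).

Definition area x y w := qform L (ev x y) (ev y w)
    + qform L (ev y w) (ev w x) + qform L (ev w x) (ev x y).

Record edge_ok (p q : pt D) (x y : V) (m : int) : Prop := EdgeOk {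
  eo_fw : pairing p q = mono false m (ev x y);
  eo_bw : pairing q p = mono true (- m) (ev x y);
  eo_pt : Ptol (@pairing D) p q }.

Record develops a b (P : V -> pt D) (m : V -> V -> int) : Prop := Develops {
  dv_diag : forall x, (a <= x <= b)%N -> pairing (P x) (P x) = 0;
  dv_edge : forall x y, (a <= x)%N -> (x < y)%N -> (y <= b)%N -> present T x y ->
    edge_ok (P x) (P y) x y (m x y);
  dv_tri : forall x y w, (a <= x)%N -> (x < y)%N -> (y < w)%N -> (w <= b)%N ->
    present T x y -> present T y w -> present T x w -> m x y + m y w - m x w = area x y w }.

Lemma mono_opp (m : int) u : mono true m u + mono false m u = 0.
Proof. by rewrite /mono expr1 expr0 mulN1r mul1r addNr. Qed.

(** Prescribing the pairings with [pa] and [pb] determines the new point. Its pairing with itself is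
    a sum of two monomials of opposite signs, and the condition on [area] makes their exponents
    equal. *)
Lemma new_point pa pb a b c (m mac mcb : int) :
  edge_ok pa pb a b m -> pairing pa pa = 0 -> pairing pb pb = 0 ->
  mac + mcb - m = area a c b ->
  exists pc, [/\ pairing pc pc = 0, edge_ok pa pc a c mac & edge_ok pc pb c b mcb].
Proof.
move=> [fw bw P] ha hb hm; have aL := g_anti gS.
pose zac := mono false mac (ev a c); pose zca := mono true (- mac) (ev a c).
pose zcb := mono false mcb (ev c b); pose zbc := mono true (- mcb) (ev c b).
pose zab := mono false m (ev a b); pose zba := mono true (- m) (ev a b).
have [uac uca ucb ubc] : [/\ zac \is a GRing.unit, zca \is a GRing.unit, zcb \is a GRing.unit & zbc \is a GRing.unit].
  by split; apply: monoU.
have uab : zab \is a GRing.unit by apply: monoU.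
have uba : zba \is a GRing.unit by apply: monoU.
(* As [pa] and [pb] pair to 0 with themselves, each coefficient is the prescribed value divided by a
   pairing of [pa] with [pb]. *)
pose pc : pt D := (lcomb (zca * zba^-1) (zcb * zab^-1) pb.1 pa.1,
                   rcomb (zba^-1 * zbc) (zab^-1 * zac) pa.2 pb.2).
have eac : pairing pa pc = zac by rewrite pairing_rcomb ha fw mul0r add0r mulVKr.
have ebc : pairing pb pc = zbc by rewrite pairing_rcomb hb bw mul0r addr0 mulVKr.
have eca : pairing pc pa = zca by rewrite pairing_lcomb ha bw mulr0 addr0 mulrVK.
have ecb : pairing pc pb = zcb by rewrite pairing_lcomb hb fw mulr0 add0r mulrVK.
have ecc : pairing pc pc = 0.
  rewrite pairing_lcomb eac ebc /zca /zba /zbc /zcb /zab /zac !(mono3 tU gS) /=.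
  set E1 := (X in mono true X); set E2 := (X in mono false X).
  have -> : E1 = E2.
    have g1 := qform_anti (ev a b) (ev a c) aL; have g2 := qform_anti (ev a b) (ev c b) aL.
    have g3 := qform_anti (ev a c) (ev c b) aL.
    move: hm; rewrite /area [ev b a]evC /E1 /E2; clear - g1 g2 g3; lia.
  rewrite (_ : ev c b - ev a b + ev a c = ev a c - ev a b + ev c b) ?mono_opp //.
  by apply: row_ext => i; rewrite !(entryD, entryN); ring.
exists pc; split=> //; split=> //.
  by apply: (Ptol_third P) => //; rewrite ?eac ?eca ?bw ?fw.
by apply/Ptol_sym/(Ptol_third (Ptol_sym P)); rewrite ?ebc ?ecb ?bw ?fw.
Qed.

(** The number [k] only bounds the recursion. The third vertex [c] on [ab] cuts the polygon into one
    on [ac] and one on [cb]; these develop independently, because by [interval_split] only [ab]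
    passes over [c]. *)
Lemma develop k a b pa pb m0 : (b - a <= k)%N -> (a < b)%N -> present T a b ->
  edge_ok pa pb a b m0 -> pairing pa pa = 0 -> pairing pb pb = 0 ->
  exists P m, [/\ develops a b P m, P a = pa, P b = pb & m a b = m0].
Proof.
elim: k a b pa pb m0 => [|k IH] a b pa pb m0 hk ab pab eo ha hb; first by lia.
have [h|h] := leqP b a.+1.
  have ne : (b == a) = false by rewrite -(inj_eq val_inj) /=; lia.
  exists (fun x => if x == a then pa else pb), (fun _ _ => m0).
  split; rewrite ?eqxx ?ne //; split.
  - by move=> x hx; case: eqP.
  - move=> x y h1 h2 h3 _; have -> : x = a by apply: val_inj => /=; lia.
    have -> : y = b by apply: val_inj => /=; lia.
    by rewrite eqxx ne.
  - by move=> x y w *; lia.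
have [|c [abc pac pcb]] := third_vertex hT pab.
  have lt : (a.+1 < n.+3)%N by have := ltn_ord b; lia.
  by exists (Ordinal lt); rewrite /cyc3 /=; lia.
have [ac cb] : (a < c)%N /\ (c < b)%N by move: abc; rewrite /cyc3; lia.
(* The exponent of [ac] is free and taken to be 0; the triangle relation then dictates that of
   [cb]. *)
have hm : 0 + (area a c b + m0) - m0 = area a c b by ring.
have [pc [hc eac ecb]] := new_point eo ha hb hm.
have [|P1 [m1 [d1 P1a P1c m1e]]] := IH a c pa pc 0 _ ac pac eac ha hc; first by lia.
have [|P2 [m2 [d2 P2c P2b m2e]]] := IH c b pc pb _ _ cb pcb ecb hc hb; first by lia.
pose P x := if (x <= c)%N then P1 x else P2 x.
have P_le x : (x <= c)%N -> P x = P1 x by rewrite /P => ->.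
have P_ge x : (c <= x)%N -> P x = P2 x.
  rewrite /P leq_eqVlt => /orP[/eqP/val_inj <-|]; first by rewrite leqnn P1c P2c.
  by rewrite ltnNge => /negbTE ->.
pose m x y := if (y <= c)%N then m1 x y else if (c <= x)%N then m2 x y else m0.
have m_le x y : (y <= c)%N -> m x y = m1 x y by rewrite /m => ->.
have m_ge x y : (x < y)%N -> (c <= x)%N -> m x y = m2 x y.
  by rewrite /m => h1 h2; rewrite h2 leqNgt (leq_ltn_trans h2 h1).
have across x y : (a <= x)%N -> (y <= b)%N -> (x < c < y)%N -> present T x y -> x = a /\ y = b.
  move=> h1 h2 /andP[h3 h4] pxy; have := implyP (interval_split a b c x y).
  rewrite ac cb -!leqNgt h1 h2 h3 h4 !(present_nc hT) // => /(_ isT) /andP[/eqP e1 /eqP e2].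
  by split; apply: val_inj.
have mab : m a b = m0 by rewrite /m leqNgt cb /= leqNgt ac.
exists P, m; split; [|by rewrite P_le ?(ltnW ac)|by rewrite P_ge ?(ltnW cb)|exact: mab]; split.
- move=> x /andP[h1 h2]; have [xc|cx] := leqP x c.
    by rewrite P_le //; apply: (dv_diag d1); rewrite h1.
  by rewrite P_ge ?(ltnW cx) //; apply: (dv_diag d2); rewrite h2 ltnW.
- move=> x y h1 h2 h3 pxy; have [yc|cy] := leqP y c.
    by rewrite !P_le ?m_le //; [apply: (dv_edge d1) | move: h2 yc; clear; lia].
  have [cx|xc] := leqP c x; first by rewrite !P_ge ?m_ge //; [apply: (dv_edge d2) | move: h2 cx; clear; lia].
  have [| -> ->] := across x y h1 h3 _ pxy; first by rewrite xc.
  by rewrite P_le ?(P_ge b) ?mab ?P1a ?P2b //; lia.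
- move=> x y w h1 h2 h3 h4 pxy pyw pxw; have [wc|cw] := leqP w c.
    by rewrite !m_le //; [apply: (dv_tri d1) | move: h3 wc; clear; lia].
  have [cx|xc] := leqP c x; first by rewrite !m_ge //; try (move: h2 h3 cx; clear; lia); apply: (dv_tri d2).
  have [| ex ew] := across x w h1 h4 _ pxw; first by rewrite xc.
  have yc : y = c.
    have [yc|cy|/val_inj //] := ltngtP y c.
      by have [||e _] := across y w _ h4 _ pyw; [move: h1 h2; clear; lia|move: yc cw; clear; lia|move: h2; rewrite ex e ltnn].
    by have [||_ e] := across x y h1 _ _ pxy; [move: h3 h4; clear; lia|move: xc cy; clear; lia|move: h3; rewrite ew e ltnn].
  rewrite yc ex ew mab (m_le a c) // (m_ge c b) // m1e m2e; ring.
Qed.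

Lemma zinv_exists : exists (z : V -> V -> D) (m : V -> V -> int), zinv tau t z T S m.
Proof.
(* The segment between the last vertex and the vertex 0 is on the boundary, with all other vertices
   between its ends. *)
pose a : V := ord0; pose b : V := ord_max.
have pab : present T a b by rewrite /present bsegE /= !eqxx !orbT.
pose zab := mono false 0 (ev a b); pose zba := mono true (- 0) (ev a b).
have uab : zab \is a GRing.unit by apply: monoU.
have uba : zba \is a GRing.unit by apply: monoU.
pose pa : pt D := ((0, zab), (1, 0)); pose pb : pt D := ((zba, 0), (0, 1)).
have eab : pairing pa pb = zab by rewrite /pairing /= mul0r mulr1 add0r.
have eba : pairing pb pa = zba by rewrite /pairing /= mul0r mulr1 addr0.
have eo : edge_ok pa pb a b 0.
  split=> // p q; rewrite eab eba /pairing /= !(mulr1, mulr0, mul0r, addr0, add0r).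
  by rewrite -[X in _ = X + _]mulrA -[X in _ = _ + X]mulrA !mulKr.
have [||||P [m [dv _ _ _]]] := @develop n.+3 a b pa pb 0 _ _ pab eo.
- by rewrite /= leq_subLR; lia.
- by [].
- by rewrite /pairing /= !(mulr0, mul0r) addr0.
- by rewrite /pairing /= !(mulr0, mul0r) addr0.
have ax x : (a <= x)%N by [].
have xb x : (x <= b)%N by rewrite -ltnS ltn_ord.
pose M x y := if (x < y)%N then m x y else if (y < x)%N then - m y x else 0.
have Manti x y : M y x = - M x y by rewrite /M; case: ltngtP => _; rewrite ?opprK ?oppr0.
have Mlt x y : (x < y)%N -> M x y = m x y by rewrite /M => ->.
exists (fun x y => pairing (P x) (P y)), M; split=> //.
- by move=> x; apply: (dv_diag dv); rewrite ax xb.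
- move=> x y pxy i j; have := present_neq hT pxy; rewrite -(inj_eq val_inj) /=.
  rewrite neq_ltn => /orP[xy|yx]; first by apply: (eo_pt (dv_edge dv _ xy _ pxy)).
  by apply: (Ptol_sym (eo_pt (dv_edge dv _ yx _ _))); rewrite // presentC.
- move=> x y pxy; have := present_neq hT pxy; rewrite -(inj_eq val_inj) /= neq_ltn => /orP[xy|yx].
    by rewrite (eo_fw (dv_edge dv _ xy _ pxy)) // Mlt // [(y < x)%N]ltnNge (ltnW xy).
  by rewrite (eo_bw (dv_edge dv _ yx _ _)) 1?presentC // yx evC Manti Mlt // presentC.
have aL := g_anti gS.
have sorted x y w : (x < y)%N -> (y < w)%N -> present T x y -> present T y w -> present T w x ->
    trirel tau T L M x y w.
  move=> xy yw p1 p2; rewrite presentC => p3.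
  have := dv_tri dv (ax x) xy yw (xb w) p1 p2 p3; rewrite /trirel /area (Manti x w) !Mlt //.
  exact: ltn_trans yw.
move=> x y w p1 p2 p3.
have [p1' p2' p3'] : [/\ present T y x, present T w y & present T x w].
  by rewrite presentC p1 presentC p2 presentC p3.
have := present_neq hT p1; have := present_neq hT p2; have := present_neq hT p3.
rewrite -!(inj_eq val_inj) /= !neq_ltn.
case/orP=> h3; case/orP=> h2; case/orP=> h1; try by move: h1 h2 h3; clear; lia.
- exact: (trirel_rot (trirel_rot (sorted y w x h2 h3 p2 p3 p1))).
- exact: (trirel_rot (sorted w x y h3 h1 p3 p1 p2)).
- exact: (trirel_swap aL Manti (trirel_rot (sorted w y x h2 h1 p2' p1' p3'))).
- exact: (sorted x y w h1 h2 p1 p2 p3).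
- exact: (trirel_swap aL Manti (sorted y x w h1 h3 p1' p3' p2')).
- exact: (trirel_swap aL Manti (trirel_rot (trirel_rot (sorted x w y h3 h2 p3' p2' p1')))).
Qed.

End Existence.

(** * Seeds over the based quantum torus *)

Section Torus.
Variables (n : nat) (tau : 'I_n -> pairV n).
Hypothesis htau : triangulation tau.
Variables (D : unitRingType) (t : D) (Mq : 'rV[int]_(n + n) -> D).
Hypothesis hD : forall x : D, x != 0 -> x \is a GRing.unit.
Hypothesis hM0 : Mq 0 = 1.
Hypothesis hMmul : forall a b, Mq a * Mq b = t ^ (qform (Lprin tau) a b) * Mq (a + b).
Hypothesis htc : forall a, t * Mq a = Mq a * t.
Hypothesis hfree : forall (s : seq (int * 'rV[int]_(n + n)))
                  (c : int * 'rV[int]_(n + n) -> int),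
      uniq s -> \sum_(p <- s) (c p)%:~R * (t ^ p.1 * Mq p.2) = 0 ->
      forall p, p \in s -> c p = 0.

Lemma t_unit : t \is a GRing.unit.
Proof.
apply: hD; apply/eqP => t0.
have := @hfree [:: (1, 0)] (fun _ => 1) isT; rewrite big_seq1 /= t0 expr1z mul0r mulr0.
by move/(_ erefl (1, 0)); rewrite inE eqxx => /(_ isT).
Qed.

Lemma t_root m : t ^ m = 1 -> m = 0.
Proof.
move=> tm; apply/eqP/negPn/negP => m0.
pose c (p : int * 'rV[int]_(n + n)) : int := if p.1 == 0 then 1 else -1.
have u : uniq [:: (0 : int, 0 : 'rV[int]_(n + n)); (m, 0)].
  by rewrite /= inE xpair_eqE eqxx !andbT eq_sym.
have := hfree (c := c) u.
rewrite !big_cons big_nil /c /= (negbTE m0) ?eqxx expr0z tm addr0 mulrN1z mulN1r !mul1r subrr.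
by move/(_ erefl (0, 0)); rewrite inE eqxx => /(_ isT).
Qed.

Lemma Btilde_anti r s : Btilde tau r s = - Btilde tau s r.
Proof.
rewrite !mxE -!sumrN; do 3 (apply: eq_bigr => ? _; rewrite -?sumrN).
by case: ifP; rewrite ?oppr0 // /bDelta => _; ring.
Qed.

Lemma Lprin_anti : anti (Lprin tau).
Proof.
move=> i j; rewrite -[i]splitK -[j]splitK /Lprin.
case: (split i) => i' /=; case: (split j) => j' /=.
- by rewrite !block_mxEul !mxE oppr0.
- by rewrite block_mxEur block_mxEdl !mxE eq_sym.
- by rewrite block_mxEur block_mxEdl !mxE opprK eq_sym.
rewrite !block_mxEdr [(- Btilde tau) i' _]mxE [(- Btilde tau) j' _]mxE opprK.
by rewrite Btilde_anti opprK.
Qed.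

Let S0 := init_seed tau Mq.

Lemma S0_X i : sX S0 i = Mq (unitv i).
Proof.
rewrite /S0 /init_seed /=; congr Mq; apply: row_ext => j; rewrite unitvE mxE /ind.
by case: eqP.
Qed.

Lemma S0_compat k v : qform (sL S0) (bcol S0 k) v = v ord0 (lshift n k).
Proof.
have e : bcol S0 k *m Lprin tau = unitv (lshift n k).
  have -> : bcol S0 k = row_mx (\row_i Btilde tau i k) (delta_mx ord0 k).
    apply: row_eq2 => i; rewrite mxE /= /Bprin ?row_mxEl ?row_mxEr ?col_mxEu ?col_mxEd.
      by rewrite mxE.
    by rewrite !mxE eqxx.
  rewrite /Lprin mul_row_block mulmx0 add0r mulmx1; apply: row_eq2 => i.
    by rewrite row_mxEl unitvE !mxE eqxx eq_lshift.
  rewrite row_mxEr unitvE eq_rlshift mulmxN mulmx1 mulmxN -rowE.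
  by rewrite entryD !entryN ![_ ord0 i]mxE (Btilde_anti i k) opprK subrr.
rewrite /qform e mxE (bigD1 (lshift n k)) //= unitvE eqxx mul1r mxE big1 ?addr0 //.
by move=> j /negbTE jk; rewrite unitvE jk mul0r.
Qed.

Lemma MqU a : Mq a \is a GRing.unit.
Proof.
apply/unitrP; exists (Mq (- a)); rewrite !hMmul subrr addNr hM0 qformNr qformNl.
by rewrite (qform_self a Lprin_anti) oppr0 expr0z mulr1.
Qed.

Lemma good0 : good t S0.
Proof.
split.
- exact: Lprin_anti.
- exact: S0_compat.
- by move=> i; rewrite S0_X MqU.
- by move=> i; rewrite S0_X /GRing.comm htc.
- move=> i j; rewrite !S0_X /qc !hMmul mulrA -tzD ?t_unit // addrC; congr (t ^ _ * _).
  by rewrite !qform_unit (Lprin_anti j i) mulr2n addrK.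
Qed.

(** Both sides multiply with the same twist and agree on the unit vectors, which generate the
    lattice. *)
Lemma sfr0E u : sfr t S0 u = Mq u.
Proof.
pose A u := sfr t S0 u = Mq u.
have AD v w : A v -> A w -> A (v + w).
  rewrite /A => hv hw; apply: (mulrI (tzU t_unit (qform (Lprin tau) v w))).
  by rewrite -hMmul -hv -hw (sfr_mul t_unit good0).
have AN v : A v -> A (- v).
  rewrite /A => hv; apply: (mulrI (MqU v)); rewrite -{1}hv -(sfrN t_unit good0) hv.
  rewrite divrr ?MqU // hMmul subrr hM0 qformNr (qform_self v Lprin_anti).
  by rewrite oppr0 expr0z mulr1.
have A0 : A 0 by rewrite /A hM0 sfr0.
have An v (m : nat) : A v -> A (v *+ m).
  by move=> hv; elim: m => [|m IH]; rewrite ?mulr0n // mulrS; apply: AD.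
have Az v (m : int) : A v -> A (v *~ m).
  by move=> hv; case: m => m; [apply: An | rewrite NegzE mulrNz; apply: AN; apply: An].
rewrite -/(A u) (row_sum_delta u); elim/big_ind: _ => // i _.
by rewrite -[u ord0 i]intz scaler_int; apply: Az; rewrite /A sfr_unitv S0_X.
Qed.

Lemma seeds_rcons s k : seeds t tau Mq (rcons s k) = mutate t (seeds t tau Mq s) k.
Proof. by rewrite /seeds -cats1 foldl_cat. Qed.

Lemma seed_good s : good t (seeds t tau Mq s).
Proof.
elim/last_ind: s => [|s k IH]; first exact: good0.
by rewrite seeds_rcons; apply: good_mutate => //; [exact: t_unit | exact: t_root].
Qed.

Lemma seed_Binv s : Binv tau (flips tau s) (seeds t tau Mq s).
Proof.
elim/last_ind: s => [|s k IH]; first exact: Binv_init.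
rewrite seeds_rcons flips_rcons; apply: Binv_step => //.
- exact: t_unit.
- exact: flips_tri.
- exact: seed_good.
Qed.

Lemma seed_zinv : exists z, forall s, exists m, zinv tau t z (flips tau s) (seeds t tau Mq s) m.
Proof.
have [z [m0 zm]] := zinv_exists tau t_unit htau good0; exists z => s.
elim/last_ind: s => [|s k [m IH]]; first by exists m0.
have hT := flips_tri s htau; have [a [b [c [d q]]]] := quad_exists k hT.
rewrite seeds_rcons flips_rcons; eexists.
apply: zinv_step q => //; [exact: t_unit | exact: t_root | exact: seed_good | exact: seed_Binv | exact: IH].
Qed.

Lemma seed_sfr_frozen s (v : 'rV[int]_(n + n)) : (forall i, v ord0 (lshift n i) = 0) ->
  sfr t (seeds t tau Mq s) v = Mq v.
Proof.
move=> hv; elim/last_ind: s => [|s k IH]; first exact: sfr0E.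
by rewrite seeds_rcons (sfr_mut_neq t_unit (seed_good s)).
Qed.

(* [z x y / z y x] determines the exponent of [t] relating [z x y] to the cluster variable,
   and the commutation with the coefficients then determines the cluster variable itself. *)
Theorem cluster_variable_of_arc s1 s2 k1 k2 : flips tau s1 k1 = flips tau s2 k2 ->
  sX (seeds t tau Mq s1) (lshift n k1) = sX (seeds t tau Mq s2) (lshift n k2).
Proof.
have [z hz] := seed_zinv; have tU := t_unit.
set S1 := seeds t tau Mq s1; set S2 := seeds t tau Mq s2.
have [m1 z1] := hz s1; have [m2 z2] := hz s2; rewrite -/S1 -/S2 in z1 z2.
have T1 := flips_tri s1 htau; have T2 := flips_tri s2 htau.
have g1 : good t S1 := seed_good s1; have g2 : good t S2 := seed_good s2.
set x := (flips tau s1 k1).1; set y := (flips tau s1 k1).2.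
have e1 : flips tau s1 k1 = sd x y by apply: tri_sd.
move=> e; have e2 : flips tau s2 k2 = sd x y by rewrite -e.
have xy : (x < y)%N by have := tri_arc T1 k1; case/andP.
have yx : (y < x)%N = false by apply/negbTE; rewrite -leqNgt ltnW.
set bt := bot tau x y.
pose F1 := sfr t S1 (unitv (lshift n k1) + bt); pose F2 := sfr t S2 (unitv (lshift n k2) + bt).
have p1 := present_T e1; have p2 := present_T e2.
have p1' : present (flips tau s1) y x by rewrite presentC.
have p2' : present (flips tau s2) y x by rewrite presentC.
have F12 (u1 u2 : int) b : mono t S1 b u1 (unitv (lshift n k1) + bt) =
    mono t S2 b u2 (unitv (lshift n k2) + bt) -> F1 = t ^ (u2 - u1) * F2.
  rewrite /mono => /mulrI h; have {}h := h (unitrX _ (unitrN1 _)).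
  by apply: (mulrI (tzU tU u1)); rewrite h [RHS]mulrA -tzD // [u1 + _]addrC subrK.
have ev1 := ev_arc tau T1 e1; have ev2 := ev_arc tau T2 e2.
have := z_mono z1 p1; rewrite (z_mono z2 p2) ev1 ev2 => /esym /F12 h1.
have := z_mono z1 p1'; rewrite (z_mono z2 p2') ![ev _ _ y x]evC ev1 ev2 => /esym /F12.
rewrite (z_anti z1 x y) (z_anti z2 x y) h1 => h2.
have F2U : F2 \is a GRing.unit by apply: sfrU.
have m12 : m1 x y = m2 x y.
  have := mulIr F2U h2 => h3.
  have : t ^ ((m2 x y - m1 x y) - (- m2 x y - - m1 x y)) = 1.
    by rewrite tzD // h3 -tzD // subrr expr0z.
  by move/t_root; clear; lia.
rewrite m12 subrr expr0z mul1r in h1.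
pose X1 := sX S1 (lshift n k1); pose X2 := sX S2 (lshift n k2).
pose q1 := qform (sL S1) (unitv (lshift n k1)) bt.
pose q2 := qform (sL S2) (unitv (lshift n k2)) bt.
have Y1 : sfr t S1 bt = Mq bt by apply: seed_sfr_frozen => i; rewrite botl.
have Y2 : sfr t S2 bt = Mq bt by apply: seed_sfr_frozen => i; rewrite botl.
have c1 : X1 * Mq bt = t ^ q1 * F1 by rewrite -Y1 /X1 -(sfr_unitv t) (sfr_mul tU g1).
have c2 : X2 * Mq bt = t ^ q2 * F2 by rewrite -Y2 /X2 -(sfr_unitv t) (sfr_mul tU g2).
have d1 : Mq bt * X1 = t ^ (- q1) * F1.
  rewrite -Y1 /X1 -(sfr_unitv t) (sfr_mul tU g1) addrC; congr (t ^ _ * _).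
  exact: qform_anti (g_anti g1).
have d2 : Mq bt * X2 = t ^ (- q2) * F2.
  rewrite -Y2 /X2 -(sfr_unitv t) (sfr_mul tU g2) addrC; congr (t ^ _ * _).
  exact: qform_anti (g_anti g2).
have YU := MqU bt; have tB : GRing.comm t (Mq bt) by apply: htc.
have X12 : X1 = t ^ (q1 - q2) * X2.
  by apply: (mulIr YU); rewrite c1 h1 -[RHS]mulrA c2 [RHS]mulrA -tzD // subrK.
have : t ^ (- q1 - - q2) = t ^ (q1 - q2).
  have X2U : X2 \is a GRing.unit by apply: (g_unit g2).
  apply: (mulIr X2U); apply: (mulrI YU).
  by rewrite -X12 d1 h1 [LHS]mulrA -(commtz _ tB) -[LHS]mulrA d2 [LHS]mulrA -tzD // subrK.
move=> h3; have : t ^ ((q1 - q2) - (- q1 - - q2)) = 1.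
  by rewrite tzD // -h3 -tzD // subrr expr0z.
move/t_root => q12; rewrite -/X1 -/X2 X12; have -> : q1 - q2 = 0 by clear - q12; lia.
by rewrite expr0z mul1r.
Qed.

End Torus.

(** * The expansion along a fan *)

Lemma sum_count (I : eqType) (R : zmodType) (s l : seq I) (F : I -> R) :
  uniq s -> {subset l <= s} -> \sum_(x <- l) F x = \sum_(x <- s) F x *+ count_mem x l.
Proof.
move=> us; elim: l => [|y l IH] sub.
  by rewrite big_nil big1 // => x _; rewrite mulr0n.
rewrite big_cons IH; last by move=> x xl; apply: sub; rewrite inE xl orbT.
rewrite [RHS](eq_bigr (fun x => F x *+ (y == x) + F x *+ count_mem x l)); last first.
  by move=> x _; rewrite /= mulrnDr.
rewrite big_split /=; congr (_ + _).
rewrite (bigD1_seq y) //=; last by apply: sub; rewrite inE eqxx.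
by rewrite eqxx mulr1n big1 ?addr0 // => x /negbTE xy; rewrite eq_sym xy.
Qed.

Section Fan.
Variables (n : nat) (tau : 'I_n -> pairV n).
Local Notation V := 'I_n.+3.
Hypothesis htau : triangulation tau.
Variables (D : unitRingType) (t : D) (Mq : 'rV[int]_(n + n) -> D).
Hypothesis hD : forall x : D, x != 0 -> x \is a GRing.unit.
Hypothesis hM0 : Mq 0 = 1.
Hypothesis hMmul : forall a b, Mq a * Mq b = t ^ (qform (Lprin tau) a b) * Mq (a + b).
Hypothesis htc : forall a, t * Mq a = Mq a * t.
Hypothesis hfree : forall (s : seq (int * 'rV[int]_(n + n)))
                  (c : int * 'rV[int]_(n + n) -> int),
      uniq s -> \sum_(p <- s) (c p)%:~R * (t ^ p.1 * Mq p.2) = 0 ->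
      forall p, p \in s -> c p = 0.

Local Notation vec := 'rV[int]_(n + n).
Local Notation ev := (ev tau).
Local Notation bot := (bot tau).
Local Notation Lam := (Lprin tau).

Let tU := t_unit hD hfree.
Let tR := t_root hfree.
Let sG s := seed_good hD hM0 hMmul htc hfree s.
Let sB s : Binv tau (flips tau s) (seeds t tau Mq s).
Proof. exact: seed_Binv. Qed.

(** Repetitions in [vs] are allowed, hence the multiplicities. If [f v] and [g v] differ, the pair
    of [f v] and [v + u] occurs on the left only, because [v + u] determines [v]; its coefficient
    would be positive. *)
Lemma same_exponents (vs : seq vec) (u : vec) (f g : vec -> int) :
  \sum_(v <- vs) t ^ (f v) * Mq (v + u) = \sum_(v <- vs) t ^ (g v) * Mq (v + u) ->
  forall v, v \in vs -> f v = g v.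
Proof.
move=> e v vvs; apply/eqP/negPn/negP => fg.
pose lf := [seq (f v, v + u) | v <- vs]; pose lg := [seq (g v, v + u) | v <- vs].
pose s := undup (lf ++ lg).
pose c p : int := (count_mem p lf)%:Z - (count_mem p lg)%:Z.
have us : uniq s by apply: undup_uniq.
pose F (p : int * vec) := t ^ p.1 * Mq p.2.
have sumc : \sum_(p <- s) (c p)%:~R * F p = 0.
  transitivity (\sum_(p <- s) (F p *+ count_mem p lf - F p *+ count_mem p lg)).
    by apply: eq_bigr => p _; rewrite /c rmorphB /= !mulrBl -!pmulrn !mulr_natl.
  rewrite sumrB -!sum_count //; last first.
  - by move=> p pl; rewrite mem_undup mem_cat pl.
  - by move=> p pl; rewrite mem_undup mem_cat pl orbT.
  by rewrite !big_map /F /= e subrr.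
have vs_in : (f v, v + u) \in s by rewrite mem_undup mem_cat map_f.
have := hfree us sumc vs_in; rewrite /c.
have -> : count_mem (f v, v + u) lg = 0%N.
  apply/count_memPn/negP => /mapP[v' _ [e1 /addIr e2]].
  by rewrite e1 -e2 eqxx in fg.
have : (0 < count_mem (f v, (v + u)%R) lf)%N by rewrite -has_count has_pred1 map_f.
by clear; lia.
Qed.

(* The two orders of multiplication by [u] yield opposite powers of [t], which are
   therefore trivial: this is why all the coefficients of the expansion are 1. *)
Lemma sfr_sum (S : qseed n D) (f u : vec) (vs : seq vec) : good t S ->
  sfr t S f = \sum_(v <- vs) Mq v -> sfr t S u = Mq u ->
  sfr t S (f + u) = \sum_(v <- vs) Mq (v + u).
Proof.
move=> gS hf hu; set l := qform (sL S) f u.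
have e1 : sfr t S (f + u) = \sum_(v <- vs) t ^ (qform Lam v u - l) * Mq (v + u).
  apply: (mulrI (tzU tU l)); rewrite /l -(sfr_mul tU gS) hf hu mulr_suml mulr_sumr.
  by apply: eq_bigr => v _; rewrite hMmul [RHS]mulrA -tzD // -/l [l + _]addrC subrK.
have e2 : sfr t S (f + u) = \sum_(v <- vs) t ^ (l - qform Lam v u) * Mq (v + u).
  have lE : - l = qform (sL S) u f by rewrite (qform_anti u f (g_anti gS)).
  apply: (mulrI (tzU tU (- l))); rewrite {1}lE [f + u]addrC -(sfr_mul tU gS) hf hu.
  rewrite !mulr_sumr; apply: eq_bigr => v _.
  rewrite hMmul [RHS]mulrA -tzD // (qform_anti u v (Lprin_anti tau)) [u + v]addrC.
  by congr (t ^ _ * _); rewrite addrA addNr add0r.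
rewrite e1; apply: eq_big_seq => v vvs.
have := same_exponents (etrans (esym e1) e2) vvs => h.
have -> : qform Lam v u - l = 0 by move: h; clear; lia.
by rewrite expr0z mul1r.
Qed.

Variables (a : V) (is_ : seq 'I_n) (p q w : nat -> V).
Local Notation K := (size is_).
Hypothesis A1 : forall j i0, (j < K)%N -> tau (nth i0 is_ j) = sd (p j) (q j).
Hypothesis A2 : forall j, (j < K)%N -> present tau (p j) (w j) /\ present tau (w j) (q j).
Hypothesis A3 : forall j, (j < K)%N -> cyc4 a (p j) (w j) (q j).
Hypothesis A4 : present tau a (p 0%N) /\ present tau (q 0%N) a.
Hypothesis A5 : forall j, (j.+1 < K)%N ->
  p j.+1 = w j /\ q j.+1 = q j \/ p j.+1 = p j /\ q j.+1 = w j.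

Definition shift (u : vec) (l : seq vec) := [seq v + u | v <- l].

(** The exchange relation in the quadrilateral with vertices [a], [p j], [w j], [q j]: the lambda
    length of [a, w j] is [(a p)(w q) / (p q)] plus [(a q)(p w) / (p q)]. *)
Definition fanW j (PQ : seq vec * seq vec) :=
  shift (ev tau (w j) (q j) - ev tau (p j) (q j)) PQ.1 ++
  shift (ev tau (p j) (w j) - ev tau (p j) (q j)) PQ.2.

(* The exponents of the lambda lengths of [a, p j] and of [a, q j]. *)
Fixpoint fanPQ j : seq vec * seq vec :=
  if j is j'.+1 then
    let W := fanW j' (fanPQ j') in
    if p j == w j' then (W, (fanPQ j').2) else ((fanPQ j').1, W)
  else ([:: ev tau a (p 0%N)], [:: ev tau a (q 0%N)]).

(** By [fi_frozen], monomials in the coefficients and the arcs still in their initial position are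
    the same in the current frame and the initial one; this allows the exchange relations to be
    expanded in [Mq]. *)
Record fan_inv j (T : 'I_n -> pairV n) (S : qseed n D) : Prop := FanInv {
  fi_arcs : forall i, T i = tau i \/ exists x, T i = sd a x;
  fi_rest : forall i, i \notin take j is_ -> T i = tau i;
  fi_frozen : forall v : vec, (forall i, v ord0 (lshift n i) != 0 -> T i = tau i) ->
    sfr t S v = Mq v;
  fi_p : present T a (p j) /\ sfr t S (ev T a (p j)) = \sum_(v <- (fanPQ j).1) Mq v;
  fi_q : present T a (q j) /\ sfr t S (ev T a (q j)) = \sum_(v <- (fanPQ j).2) Mq v }.

Section Step.
Variables (j : nat) (i0 : 'I_n) (T : 'I_n -> pairV n) (S : qseed n D).
Hypothesis jK : (j < K)%N.
Let k := nth i0 is_ j.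
Hypothesis uis : uniq is_.
Hypothesis hT : triangulation T.
Hypothesis gS : good t S.
Hypothesis hB : Binv tau T S.
Hypothesis hI : fan_inv j T S.

Lemma fan_Tk : T k = sd (p j) (q j).
Proof.
rewrite -(A1 i0 jK); apply: (fi_rest hI).
have := uis; rewrite -{1}(cat_take_drop j is_) (drop_nth i0 jK) cat_uniq /= negb_or.
by case/and3P=> _ /andP[].
Qed.

(** Every arc of [T] belongs to [tau] or ends at [a], and those ending at [a] do not cross
    [p j, q j], which is still in [T]. *)
Lemma fan_present x y : present tau x y ->
  (forall z, ~~ xing a z (p j) (q j) -> ~~ xing x y a z) -> present T x y.
Proof.
move=> pxy h; apply: (present_max hT); first exact: (present_neq htau pxy).
move=> i u v e; case: (fi_arcs hI i) => [ei|[z ez]].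
  by apply: (present_nc htau pxy); apply: (present_T (i := i)); rewrite -ei.
have uz := esym e; rewrite ez in uz.
have h1 : ~~ xing x y a z.
  by apply: h; apply: (present_nc hT (present_T ez) (present_T fan_Tk)).
by case: (sd_inj uz) => -[-> ->] //; rewrite /xing orbC.
Qed.

Lemma fan_quad : quad T k (p j) (w j) (q j) a.
Proof.
have cy := A3 jK; have [h1 h2] := A2 jK.
have ins z : ~~ xing a z (p j) (q j) -> ~~ xing (p j) (w j) a z && ~~ xing (w j) (q j) a z.
  by move=> hz; apply: (implyP (cyc_inside _ _ _ _ _)); rewrite cy.
apply/and5P; split.
- by rewrite -cyc4_rot.
- by rewrite fan_Tk.
- by apply: fan_present => // z /ins /andP[].
- by apply: fan_present => // z /ins /andP[].
by rewrite presentC (fi_q hI).1 (fi_p hI).1.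
Qed.

Lemma fan_ev x y : present tau x y -> present T x y -> x != a -> y != a ->
  ev T x y = ev tau x y /\ forall i, ev T x y ord0 (lshift n i) != 0 -> T i = tau i.
Proof.
move=> pxy Pxy xa ya.
have key i : T i = sd x y -> tau i = sd x y.
  case: (fi_arcs hI i) => [-> //|[z ->]] /esym/sd_inj[] [e1 e2]; by rewrite ?e1 ?e2 eqxx in xa ya.
have key2 i : tau i = sd x y -> T i = sd x y.
  move=> ei; case/orP: Pxy => [/existsP[i' /eqP ei']|bs].
    by have /(tri_inj htau) -> : tau i = tau i' by rewrite ei (key _ ei').
  by have := tri_arc htau i; rewrite ei is_arc_sd bs andbF.
split; last first.
  by move=> i; rewrite evl; case: (T i =P sd x y) => // e _; rewrite e (key _ e).
apply: row_eq2 => i; rewrite ?evl ?evr //; congr ind.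
by apply/eqP/eqP => [/key|/key2].
Qed.

Lemma fan_step_w :
  sfr t (mutate t S k) (ev (flip T k) a (w j)) = \sum_(v <- fanW j (fanPQ j)) Mq v.
Proof.
have q0 := fan_quad; have cy := A3 jK; have [h1 h2] := A2 jK.
have := implyP (cyc4_neq _ _ _ _) cy; rewrite !(inj_eq val_inj) => /and5P[ap aw aq pw /andP[pq wq]].
have [pa wa qa] : [/\ p j != a, w j != a & q j != a] by rewrite eq_sym ap eq_sym aw eq_sym aq.
rewrite [ev _ a _]evC (sfr_new htau hD tU tR hT gS hB q0).
have [e1 s1] := fan_ev h1 (qab q0) pa wa.
have [e2 s2] := fan_ev h2 (qbc q0) wa qa.
have [e3 s3] := fan_ev (present_T (A1 i0 jK)) (qac q0) pa qa.
have fz (u v : vec) : (forall i, u ord0 (lshift n i) != 0 -> T i = tau i) ->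
    (forall i, v ord0 (lshift n i) != 0 -> T i = tau i) -> sfr t S (u - v) = Mq (u - v).
  move=> hu hv; apply: (fi_frozen hI) => i; rewrite entryD entryN => h.
  have [hu0|hu0] := eqVneq (u ord0 (lshift n i)) 0; last exact: hu.
  by apply: hv; apply: contraNneq h => ->; rewrite hu0 oppr0.
rewrite ![ev T _ _ - _ + _]addrC [ev T (p j) a]evC [ev T (q j) a]evC.
rewrite (sfr_sum gS (fi_p hI).2 (fz _ _ s2 s3)) (sfr_sum gS (fi_q hI).2 (fz _ _ s1 s3)).
by rewrite e1 e2 e3 big_cat !big_map.
Qed.

Lemma fan_flip_inv : (j.+1 < K)%N -> fan_inv j.+1 (flip T k) (mutate t S k).
Proof.
move=> jK1; have q0 := fan_quad; have cy := A3 jK.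
have := implyP (cyc4_neq _ _ _ _) cy; rewrite !(inj_eq val_inj) => /and5P[ap aw aq pw /andP[pq wq]].
have Tk' := flip_k hT q0.
have old x : present T a x -> x != w j ->
    present (flip T k) a x /\ sfr t (mutate t S k) (ev (flip T k) a x) = sfr t S (ev T a x).
  move=> pax xw.
  have n1 : sd a x != sd (p j) (q j).
    by apply/eqP => /sd_inj[] [e1 _]; rewrite e1 eqxx in ap aq.
  have n2 : sd a x != sd (w j) a.
    by apply/eqP => /sd_inj[] [e1 e2]; [rewrite e1 eqxx in aw | rewrite e2 eqxx in xw].
  rewrite (present_flip hT q0) pax n1; split=> //.
  by rewrite (ev_flip tau hT q0 n1 n2) (sfr_mut_neq tU gS) // (ev_at_k _ q0 n1).
have pw' : present (flip T k) a (w j) by rewrite presentC; apply: present_T Tk'.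
split.
- move=> i; have [->|ik] := eqVneq i k; first by right; exists (w j); rewrite Tk' sdC.
  by rewrite (flip_neq hT q0 ik); apply: (fi_arcs hI).
- move=> i; rewrite (take_nth i0) // mem_rcons inE negb_or => /andP[ik itk].
  by rewrite (flip_neq hT q0 ik); apply: (fi_rest hI).
- move=> v hv.
  have vk : v ord0 (lshift n k) = 0.
    apply/eqP/negPn/negP => /hv; rewrite Tk' (A1 i0 jK) => /sd_inj[] [e1 e2].
      by rewrite e2 eqxx in aq.
    by rewrite e2 eqxx in ap.
  rewrite (sfr_mut_neq tU gS vk); apply: (fi_frozen hI) => i hi.
  by rewrite -(hv i hi) (flip_neq hT q0) //; apply: contraNneq hi => ->; rewrite vk.
- rewrite /=; case: (A5 jK1) => -[-> _]; rewrite ?eqxx ?(negbTE pw) /=.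
    by split; rewrite ?fan_step_w.
  by have [-> ->] := old _ (fi_p hI).1 pw; split=> //; apply: (fi_p hI).2.
rewrite /=; case: (A5 jK1) => -[-> ->]; rewrite ?eqxx ?(negbTE pw) /=.
  by have [|-> ->] := old _ (fi_q hI).1; rewrite 1?eq_sym //; split=> //; apply: (fi_q hI).2.
by split; rewrite ?fan_step_w.
Qed.

End Step.

Lemma fan_inv0 : fan_inv 0 tau (init_seed tau Mq).
Proof.
have E u := sfr0E hD hM0 hMmul htc hfree u.
split; [by left | by [] | by move=> v _; apply: E | |].
  by rewrite /= big_seq1 E; split=> //; apply: A4.1.
by rewrite /= big_seq1 E presentC; split=> //; apply: A4.2.
Qed.

Hypothesis uis : uniq is_.

Lemma fan_seed j : (j < K)%N -> fan_inv j (flips tau (take j is_)) (seeds t tau Mq (take j is_)).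
Proof.
elim: j => [|j IH] jK; first by rewrite take0; apply: fan_inv0.
have i0 : 'I_n by case: (is_) jK => [//|i _ _].
rewrite (take_nth i0) ?(ltnW jK) // flips_rcons seeds_rcons.
apply: fan_flip_inv => //; first [exact: flips_tri | exact: sG | exact: sB | apply: IH; exact: ltnW | exact: ltnW].
Qed.

(** The lambda length of the last arc is its cluster variable with the coefficients [bot a w_],
    which are removed by [sfr_sum]. *)
Lemma fan_last i0 (k := last i0 is_) (w_ := w K.-1) : (0 < K)%N ->
  flips tau is_ k = sd a w_ /\
  sX (seeds t tau Mq is_) (lshift n k) =
  \sum_(v <- fanW K.-1 (fanPQ K.-1)) Mq (v - bot a w_).
Proof.
move=> K0; have jK : (K.-1 < K)%N by rewrite ltn_predL.
have hI := fan_seed jK; set s := take K.-1 is_ in hI.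
have ek : k = nth i0 is_ K.-1 by rewrite /k -nth_last.
have es : is_ = rcons s k.
  by rewrite ek /s -take_nth // prednK // take_size.
have T1 := flips_tri s htau; have T2 := flips_tri is_ htau.
have q0 := fan_quad i0 jK uis T1 hI; rewrite -ek in q0.
have Tk : flips tau is_ k = sd a w_.
  by rewrite es flips_rcons (flip_k T1 q0) sdC.
split=> //; have W := fan_step_w i0 jK uis T1 (sG s) (@sB s) hI.
rewrite -ek -flips_rcons -seeds_rcons -es -/w_ (ev_arc tau T2 Tk) in W.
have fz : sfr t (seeds t tau Mq is_) (- bot a w_) = Mq (- bot a w_).
  apply: (seed_sfr_frozen hD hM0 hMmul htc hfree) => i.
  by rewrite entryN botl oppr0.
by have := sfr_sum (sG is_) W fz; rewrite addrK sfr_unitv.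
Qed.

End Fan.

(** * The expansion over perfect matchings *)

Section Tiles.
Variables (n : nat) (tau : 'I_n -> pairV n).
Hypothesis htau : triangulation tau.
Variable gamma : pairV n.
Hypothesis hg : is_arc gamma.
Hypothesis hgT : ~~ in_T tau gamma.
Variable i0 : 'I_n.
Local Notation a := gamma.1.
Local Notation b := gamma.2.
Local Notation cs := (cs tau gamma).
Local Notation K := (nk tau gamma).
Local Notation ix j := (nth i0 cs j).
Local Notation vec := 'rV[int]_(n + n).

Definition pp j := ip tau gamma (ix j).
Definition qq j := iq tau gamma (ix j).
Local Notation w := (wT tau gamma).
Local Notation u := (uT tau gamma).
Local Notation dN := (dirN tau gamma).
(** Consecutive crossed arcs share their outer end when this holds and their inner end otherwise. *)
Definition shq j := qq j.+1 == qq j.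

Lemma arcAtE j : (j < K)%N -> arcAt tau gamma j = sd (pp j) (qq j).
Proof. by move=> jK; rewrite /arcAt (nth_map i0) // (cs_arc htau hg hgT i0 jK). Qed.

Lemma next_tile j : (j < K)%N ->
  [/\ cyc3 (pp j) (w j) (qq j), present tau (pp j) (w j), present tau (w j) (qq j) &
   (j.+1 < K)%N -> pp j.+1 = w j /\ qq j.+1 = qq j \/ pp j.+1 = pp j /\ qq j.+1 = w j].
Proof.
move=> jK; have [r [cy p1 p2 nx]] := next_triangle htau hg hgT i0 jK.
rewrite -/(pp j) -/(qq j) -/(pp j.+1) -/(qq j.+1) in cy p1 p2 nx.
suff -> : w j = r.
  split=> // jK1; case: nx => [[e _]|[_ h _]] //.
  by move: jK1; rewrite e prednK ?ltnn // (cs_nonempty htau hg hgT).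
rewrite /wT; case: nx => [[-> ->]|[jK1 h rb]]; first by rewrite eqxx.
have -> : (j == K.-1) = false by apply/eqP => e; move: jK1; rewrite e prednK ?ltnn // (cs_nonempty htau hg hgT).
have rp : r != pp j by rewrite eq_sym; apply: (present_neq htau p1).
have rq : r != qq j by apply: (present_neq htau p2).
rewrite !arcAtE //; case: h => -[-> ->]; first by apply: oth_shared.
by rewrite [sd (pp j) r]sdC [sd (pp j) _]sdC; apply: oth_shared.
Qed.

Lemma tile_cyc j : (j < K)%N -> cyc4 a (pp j) (w j) (qq j).
Proof.
move=> jK; have [cy _ _ _] := next_tile jK.
have := implyP (thru_cyc a b (pp j) (qq j) (w j)).
by rewrite (cs_thru htau hg hgT i0 jK) cy => /(_ isT) /andP[].
Qed.

Lemma tile_neq j : (j < K)%N -> [/\ pp j != w j, w j != qq j & pp j != qq j].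
Proof.
move=> jK; have := implyP (cyc4_neq _ _ _ _) (tile_cyc jK); rewrite !(inj_eq val_inj).
by case/and5P=> _ _ _ pw /andP[pq wq].
Qed.

Lemma step_cases j : (j.+1 < K)%N ->
  [/\ shq j, pp j.+1 = w j, qq j.+1 = qq j & u j.+1 = pp j] \/
  [/\ ~~ shq j, pp j.+1 = pp j, qq j.+1 = w j & u j.+1 = qq j].
Proof.
move=> jK1; have jK := ltnW jK1; have [_ _ _ /(_ jK1) h] := next_tile jK.
have [pw wq pq] := tile_neq jK; rewrite /shq /uT !arcAtE //=.
case: h => -[-> ->]; [left | right].
  by rewrite eqxx; split=> //; rewrite oth_shared // eq_sym.
rewrite wq; split=> //; rewrite [sd (pp j) (qq j)]sdC [sd (pp j) (w j)]sdC.
by rewrite oth_shared // eq_sym.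
Qed.

Lemma tile_ucyc j : (j < K)%N -> cyc4 (u j) (pp j) (w j) (qq j).
Proof.
case: j => [|j] jK; first by rewrite /uT; apply: tile_cyc.
have cy := tile_cyc (ltnW jK); have cy' := tile_cyc jK.
have /andP[h1 h2] := implyP (cyc4_next a (pp j) (w j) (qq j) (w j.+1)) cy.
by case: (step_cases jK) => -[_ ep eq eu]; move: cy'; rewrite eu ep eq => cy';
  [apply: (implyP h1) | apply: (implyP h2)].
Qed.

Lemma ends_tile j : (j < K)%N -> pf tau gamma j = pp j /\ po tau gamma j = qq j.
Proof.
move=> jK; have := implyP (cyc4_ccw _ _ _ _) (tile_ucyc jK) => /andP[h1 /negbTE h2].
have E1 : ccw3 (u j) (pp j) (w j) by [].
have E2 : ccw3 (u j) (qq j) (w j) = false by [].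
by rewrite /pf /po (arcAtE jK) /sd; case: (ltnP (pp j) (qq j)) => _ /=; rewrite ?E1 ?E2.
Qed.

(** The tiles alternate in orientation, so the corner at which the shared end appears depends on the
    parity; in [closedI_ok] it cancels against the parity in [xbit]. *)
Lemma dirN_tile j : (j.+1 < K)%N -> dN j = if shq j then odd j else ~~ odd j.
Proof.
move=> jK1; have jK := ltnW jK1; have [e1 e2] := ends_tile jK.
have [pw wq pq] := tile_neq jK.
have -> : dN j = (u j.+1 == nwT tau gamma j) by [].
rewrite /nwT e1 e2; case: (step_cases jK1) => -[h _ _ ->]; rewrite ?h ?(negbTE h).
  by case: (odd j) => /=; rewrite ?eqxx // (negbTE pq).
by case: (odd j) => /=; rewrite ?eqxx // eq_sym (negbTE pq).
Qed.

Definition sds j s := sd (side_ends tau gamma j s).1 (side_ends tau gamma j s).2.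

Lemma sdsE j : (j < K)%N ->
  if odd j then [/\ sds j 0 = sd (u j) (qq j), sds j 1 = sd (w j) (qq j),
      sds j 2 = sd (pp j) (w j) & sds j 3 = sd (u j) (pp j)]
   else [/\ sds j 0 = sd (u j) (pp j), sds j 1 = sd (pp j) (w j),
      sds j 2 = sd (w j) (qq j) & sds j 3 = sd (u j) (qq j)].
Proof.
move=> jK; have [e1 e2] := ends_tile jK; rewrite /sds /side_ends /seT /nwT e1 e2; case: (odd j) => /=.
  by split; rewrite // sdC.
by split; rewrite // sdC.
Qed.

Lemma sds_glueE j : (j.+1 < K)%N -> ~~ dN j -> sds j 1 = sds j.+1 3.
Proof.
move=> jK1; rewrite dirN_tile //; have := sdsE jK1; have := sdsE (ltnW jK1).
case: (step_cases jK1) => -[h ep eq eu]; rewrite ?h ?(negbTE h) eu ep eq /=.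
  by case: (odd j) => //= -[_ -> _ _] [_ _ _ ->].
by case: (odd j) => //= -[_ -> _ _] [_ _ _ ->]; rewrite sdC.
Qed.

Lemma sds_glueN j : (j.+1 < K)%N -> dN j -> sds j 2 = sds j.+1 0.
Proof.
move=> jK1; rewrite dirN_tile //; have := sdsE jK1; have := sdsE (ltnW jK1).
case: (step_cases jK1) => -[h ep eq eu]; rewrite ?h ?(negbTE h) eu ep eq /=.
  by case: (odd j) => //= -[_ _ -> _] [-> _ _ _].
by case: (odd j) => //= -[_ _ -> _] [-> _ _ _]; rewrite sdC.
Qed.

Definition top x y : vec := row_mx (\row_i ind (tau i == sd x y)) 0.

Lemma topl x y i : top x y ord0 (lshift n i) = ind (tau i == sd x y).
Proof. by rewrite row_mxEl mxE. Qed.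
Lemma topr x y i : top x y ord0 (rshift n i) = 0.
Proof. by rewrite row_mxEr mxE. Qed.

(* For a perfect matching, the edge glued to the tile [j.-1] is counted once too often among
   the sides of the tiles [j.-1] and [j], whatever the twisting of these tiles. *)
Definition tilev j (t : bool) : vec :=
  (if t then top (u j) (pp j) + top (w j) (qq j) else top (pp j) (w j) + top (u j) (qq j))
  - top (pp j) (qq j)
  - (if (0 < j)%N then if shq j.-1 then top (u j) (pp j) else top (u j) (qq j) else 0)
  + (if t then unitv (rshift n (ix j)) else 0).

Lemma labelE j s i : (label tau gamma j s == Some i) = (tau i == sds j s).
Proof.
rewrite /label; case: pickP => [k /eqP e|/(_ i)]; last by rewrite -/(sds j s) => ->.
by rewrite -/(sds j s) in e; rewrite -e (inj_eq (tri_inj htau)) eq_sym.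
Qed.

Lemma nu_tiles I : closedI tau gamma I -> nu (hP tau gamma I) = \sum_(j < K) tilev j (I j).
Proof.
move=> cl; have K0 := cs_nonempty htau hg hgT.
apply: row_eq2 => i; rewrite summxE /nu ?row_mxEl ?row_mxEr mxE.
  pose lb j s : int := ind (tau i == sds j s).
  rewrite (card_edges (hP tau gamma I) (fun j s => label tau gamma j s == Some i)).
  have -> : (\sum_(j < K) \sum_(s < 4) (emem (hP tau gamma I) j s && (label tau gamma j s == Some i)))%N%:Z
     = \sum_(j < K) \sum_(s < 4) (emem (hP tau gamma I) j s)%:Z * lb j s.
    rewrite (big_morph Posz PoszD (erefl _)); apply: eq_bigr => j _.
    rewrite (big_morph Posz PoszD (erefl _)); apply: eq_bigr => s _.
    by rewrite labelE /lb /ind; case: (emem _ _ _); case: (_ == _).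
  have -> : (count_mem i cs)%:Z = \sum_(j < K) ind (tau i == sd (pp j) (qq j)).
    rewrite -sum1_count big_mkcond (big_nth i0) big_mkord (big_morph Posz PoszD (erefl _)).
    apply: eq_bigr => j _; rewrite -(cs_arc htau hg hgT i0 (ltn_ord j)) (inj_eq (tri_inj htau)) eq_sym /=.
    by rewrite /ind; case: eqP.
  rewrite (label_sum cl); first last.
  - by move=> j jK d; rewrite /lb (sds_glueN jK d).
  - by move=> j jK d; rewrite /lb (sds_glueE jK d).
  rewrite -sumrB; apply: eq_bigr => j _; have jK := ltn_ord j.
  rewrite /tilev !(entryD, entryN) topl /lb.
  have -> : (if I j then unitv (rshift n (ix j)) else 0) ord0 (lshift n i) = 0.
    by case: (I j); rewrite ?unitvE ?eq_lrshift // mxE.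
  have -> : (if (0 < j)%N then if shq j.-1 then top (u j) (pp j) else top (u j) (qq j) else 0)
      ord0 (lshift n i) =
    (if (0 < j)%N then if dN j.-1 then ind (tau i == sds j 0) else ind (tau i == sds j 3) else 0).
    case: (nat_of_ord j) jK => [|m] mK /=; first by rewrite mxE.
    have := sdsE mK; rewrite dirN_tile //=.
    by case: (shq m); case: (odd m) => /= -[e0 _ _ e3]; rewrite ?e0 ?e3 topl.
  have -> : (if I j then top (u j) (pp j) + top (w j) (qq j) else top (pp j) (w j) + top (u j) (qq j))
      ord0 (lshift n i) = (if xbit I j then ind (tau i == sds j 0) + ind (tau i == sds j 2)
      else ind (tau i == sds j 1) + ind (tau i == sds j 3)).
    have := sdsE jK; rewrite /xbit; case: (I j); case: (odd j) => /= -[e0 e1 e2 e3];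
      by rewrite ?e0 ?e1 ?e2 ?e3 entryD !topl // addrC.
  by rewrite addr0; ring.
have -> : #|[set j : 'I_K | twisted (hP tau gamma I) j && (nth None (map Some cs) j == Some i)]|
    = (\sum_(j < K) (I j && (ix j == i)))%N.
  rewrite -sum1dep_card big_mkcond /=; apply: eq_bigr => j _.
  by rewrite (twisted_hP K0 j cl) (nth_map i0) //=; case: (_ && _).
rewrite (big_morph Posz PoszD (erefl _)); apply: eq_bigr => j _.
rewrite /tilev !(entryD, entryN) topr.
have -> : (if I j then top (u j) (pp j) + top (w j) (qq j) else top (pp j) (w j) + top (u j) (qq j))
    ord0 (rshift n i) = 0.
  by case: (I j); rewrite entryD !topr addr0.
have -> : (if (0 < j)%N then if shq j.-1 then top (u j) (pp j) else top (u j) (qq j) else 0)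
      ord0 (rshift n i) = 0.
  by case: ifP => _; [case: ifP => _; rewrite topr | rewrite mxE].
rewrite !oppr0 !add0r; case: (I j); last by rewrite mxE.
by rewrite unitvE eq_rshift eq_sym; case: eqP.
Qed.

End Tiles.

Lemma mem_map_rcons (T : eqType) (s : seq (seq T)) l (b c : T) :
  (rcons l b \in [seq rcons l' c | l' <- s]) = (b == c) && (l \in s).
Proof.
apply/mapP/andP => [[l' ls /rcons_inj[-> ->]]|[/eqP-> ls]]; first by rewrite eqxx.
by exists l.
Qed.

(** * Order ideals of a fence and the fan recursion *)

Section Snake.
Variables (n : nat) (tau : 'I_n -> pairV n).
Hypothesis htau : triangulation tau.
Variable gamma : pairV n.
Hypothesis hg : is_arc gamma.
Hypothesis hgT : ~~ in_T tau gamma.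
Variable i0 : 'I_n.
Local Notation a := gamma.1.
Local Notation cs := (cs tau gamma).
Local Notation K := (nk tau gamma).
Local Notation ix j := (nth i0 cs j).
Local Notation vec := 'rV[int]_(n + n).
Local Notation pp := (pp tau gamma i0).
Local Notation qq := (qq tau gamma i0).
Local Notation w := (wT tau gamma).
Local Notation u := (uT tau gamma).
Local Notation shq := (shq tau gamma i0).
Local Notation tilev := (tilev tau gamma i0).
Local Notation ev := (ev tau tau).
Local Notation bot := (bot tau).
Local Notation fI := (fI tau).
Local Notation fanPQ := (fanPQ tau a pp qq w).
Local Notation fanW := (fanW tau pp qq w).

Lemma tile_quad j : (j < K)%N -> quad tau (ix j) (pp j) (w j) (qq j) (u j).
Proof.
move=> jK; have [_ h1 h2 _] := next_tile htau hg hgT i0 jK.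
rewrite /quad h1 h2 (cs_arc htau hg hgT i0 jK) eqxx -cyc4_rot (tile_ucyc htau hg hgT i0 jK) /=.
case: j jK {h1 h2} => [|j] jK.
  by rewrite /uT /=; have [h1 h2] := first_triangle htau hg hgT i0; apply/andP.
have [_ h1 h2 _] := next_tile htau hg hgT i0 (ltnW jK).
have h3 : present tau (pp j) (qq j) := present_T (cs_arc htau hg hgT i0 (ltnW jK)).
case: (step_cases htau hg hgT i0 jK) => -[_ -> -> ->]; first by rewrite h1 presentC h3.
by rewrite h2 presentC h3.
Qed.

Definition delta j i : int := ind (i == ix j).

Lemma fI_quad i j : (j < K)%N ->
  fI i (w j) (qq j) + fI i (u j) (pp j) = fI i (pp j) (w j) + fI i (qq j) (u j) + delta j i.
Proof.
move=> jK; have q := tile_quad jK; rewrite /delta /ind; case: eqP => [->|/eqP ne].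
  exact: (fI_self htau (qcyc q) (qk q)).
by rewrite addr0; exact: (fI_other htau q ne).
Qed.

Lemma fI_far i j : (j < K)%N ->
  fI i a (qq j) + fI i (pp j) (w j) = fI i (pp j) (qq j) + fI i a (w j).
Proof.
move=> jK; have q := tile_quad jK.
have := implyP (both_far a (pp j) (w j) (qq j) (tau i).1 (tau i).2).
rewrite (tile_cyc htau hg hgT i0 jK) (present_nc htau) ?(qac q) ?(present_T (tri_sd htau i)) //.
have -> : ((tau i).1 < (tau i).2)%N by case/andP: (tri_arc htau i).
by move=> /(_ isT) /eqP; rewrite /fI; clear; lia.
Qed.

Lemma fI_fan i j : (j < K)%N -> (0 < j)%N ==> shq j.-1 ->
  fI i a (pp j) + fI i (w j) (qq j) = fI i (pp j) (qq j) + fI i a (w j) + delta j i.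
Proof.
move=> jK; have q := tile_quad jK; have := fI_far i jK; have := fI_quad i jK.
case: j jK q => [|j] jK q; first by rewrite /uT /= ![fI i _ a]fIC; lia.
move=> _ _ /= sq.
have cy := tile_cyc htau hg hgT i0 jK.
have ti := present_T (tri_sd htau i).
have cu : cyc4 a (u j.+1) (pp j.+1) (qq j.+1).
  case: (step_cases htau hg hgT i0 jK) => -[h]; last by rewrite sq in h.
  by move=> -> -> ->; apply: (tile_cyc htau hg hgT i0 (ltnW jK)).
rewrite /delta /ind; case: eqP => [->|/eqP ne].
  have := implyP (both_same a (pp j.+1) (w j.+1) (qq j.+1)) cy => /=.
  have -> : minn (pp j.+1) (qq j.+1) = (tau (ix j.+1)).1 by rewrite (qk q) /sd /minn; case: ifP.
  have -> : maxn (pp j.+1) (qq j.+1) = (tau (ix j.+1)).2 by rewrite (qk q) /sd /maxn; case: ifP.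
  by move/eqP; rewrite /fI; clear; lia.
have := implyP (both_fan a (pp j.+1) (w j.+1) (qq j.+1) (u j.+1) (tau i).1 (tau i).2).
have uq : present tau (u j.+1) (qq j.+1) by rewrite presentC (qcd q).
rewrite cy cu !(present_nc htau) ?(qac q) ?(qab q) ?(qbc q) //.
have -> : ((tau i).1 < (tau i).2)%N by case/andP: (tri_arc htau i).
have ne' : tau i != sd (pp j.+1) (qq j.+1) by rewrite -(qk q); apply: contraNneq ne => /(tri_inj htau)->.
have -> : ~~ (((tau i).1 == pp j.+1 :> nat) && ((tau i).2 == qq j.+1 :> nat)).
  by apply: contra ne' => /andP[/eqP/val_inj <- /eqP/val_inj <-]; rewrite -(tri_sd htau).
have -> : ~~ (((tau i).1 == qq j.+1 :> nat) && ((tau i).2 == pp j.+1 :> nat)).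
  by apply: contra ne' => /andP[/eqP/val_inj <- /eqP/val_inj <-]; rewrite sdC -(tri_sd htau).
by move=> /(_ isT) /eqP; rewrite /fI; clear; lia.
Qed.

Lemma tilevl j t i : tilev j t ord0 (lshift n i) =
  (if t then ind (tau i == sd (u j) (pp j)) + ind (tau i == sd (w j) (qq j))
   else ind (tau i == sd (pp j) (w j)) + ind (tau i == sd (u j) (qq j)))
  - ind (tau i == sd (pp j) (qq j))
  - (if (0 < j)%N then if shq j.-1 then ind (tau i == sd (u j) (pp j))
     else ind (tau i == sd (u j) (qq j)) else 0).
Proof.
rewrite /tilev !(entryD, entryN) topl.
by case: t; case: j => [|j] /=; try (case: (shq j)); rewrite ?unitvE ?eq_lrshift !entryD !topl ?mxE ?addr0.
Qed.

Lemma tilevr j t i : tilev j t ord0 (rshift n i) = if t then delta j i else 0.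
Proof.
rewrite /tilev !(entryD, entryN) topr.
have -> : (if t then unitv (rshift n (ix j)) else 0) ord0 (rshift n i) = if t then delta j i else 0.
  by case: t; rewrite ?unitvE ?eq_rshift /delta /ind ?mxE //; case: eqP.
by case: t; case: j => [|j] /=; try (case: (shq j)); rewrite !entryD !topr ?mxE ?oppr0 ?addr0 ?add0r.
Qed.

(** What turns an exponent for [a, pp j] into a term of the cluster variable of [a, w j]: the factor
    of the exchange relation, with the coefficients of [a, w j] removed. [fromQ] does the same from
    [a, qq j]. *)
Definition fromP j := ev (w j) (qq j) - ev (pp j) (qq j) - bot a (w j).
Definition fromQ j := ev (pp j) (w j) - ev (pp j) (qq j) - bot a (w j).

Lemma tile0 : tilev 0 true = ev a (pp 0) + fromP 0 /\ tilev 0 false = ev a (qq 0) + fromQ 0.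
Proof.
have K0 := cs_nonempty htau hg hgT.
by split; apply: row_eq2 => i; rewrite ?tilevl ?tilevr !(entryD, entryN) ?evl ?evr ?botl ?botr /=;
  have := fI_far i K0; have := fI_fan i K0 isT; rewrite /uT /=; clear; lia.
Qed.

(** The end that moves to [w j] inherits all the terms of the preceding stage, whose coefficients
    [bot a (w j)] have to be restored; the end that stays keeps its own terms. *)
Lemma tileS j : (j.+1 < K)%N ->
  if shq j then tilev j.+1 true - bot a (w j) = fromP j.+1 /\ fromQ j + tilev j.+1 false = fromQ j.+1
  else tilev j.+1 false - bot a (w j) = fromQ j.+1 /\ fromP j + tilev j.+1 true = fromP j.+1.
Proof.
move=> jK; have f1 i := fI_far i jK; have f2 i := fI_fan i jK; have f3 i := fI_quad i jK.
move: (tilev _) (@tilevl j.+1) (@tilevr j.+1) => X Xl Xr.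
rewrite /fromP /fromQ; case: (step_cases htau hg hgT i0 jK) => -[h ep eq eu].
  have {}f2 i := f2 i h; rewrite h.
  split; apply: row_eq2 => i; move: (f1 i) (f2 i) (f3 i); clear f1 f2 f3.
    by rewrite !(entryD, entryN) Xl evl evl !botl /= h; clear; lia.
    by rewrite !(entryD, entryN) Xr !evr !botr /= ep eq eu; clear; lia.
    by rewrite !(entryD, entryN) Xl !evl !botl /= h ep eq eu; clear; lia.
  by rewrite !(entryD, entryN) Xr !evr !botr /= ep eq eu ![fI i (qq j) _]fIC; clear; lia.
rewrite (negbTE h).
split; apply: row_eq2 => i; move: (f1 i) (f3 i); clear f1 f2 f3.
  by rewrite !(entryD, entryN) Xl evl evl !botl /= (negbTE h); clear; lia.
  by rewrite !(entryD, entryN) Xr !evr !botr /= ep eq eu; clear; lia.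
  by rewrite !(entryD, entryN) Xl !evl !botl /= (negbTE h) ep eq eu ![sd _ (qq j)]sdC; clear; lia.
by rewrite !(entryD, entryN) Xr !evr !botr /= ep eq eu ![fI i _ (qq j)]fIC; clear; lia.
Qed.

(** A covering relation of the fence, directed by the shared end. *)
Definition ok j b0 b1 := if shq j then b0 ==> b1 else b1 ==> b0.

Lemma closedI_ok I : closedI tau gamma I <-> forall j, (j.+1 < K)%N -> ok j (I j) (I j.+1).
Proof.
split=> h j jK; have := h j jK; rewrite /ok (dirN_tile htau hg hgT i0 jK) /xbit /=;
by case: (shq j); case: (odd j); case: (I j); case: (I j.+1).
Qed.

(* The sets of twisted tiles of the matchings of the first [j.+1] tiles. *)
Fixpoint ideals j : seq (seq bool) :=
  if j is j'.+1 then
    [seq rcons l true | l <- ideals j' & ok j' (last false l) true] ++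
    [seq rcons l false | l <- ideals j' & ok j' (last false l) false]
  else [:: [:: true]; [:: false]].

Lemma size_ideals j l : l \in ideals j -> size l = j.+1.
Proof.
elim: j l => [|j IH] l; first by rewrite !inE => /orP[]/eqP->.
by rewrite mem_cat => /orP[]/mapP[l']; rewrite mem_filter => /andP[_ /IH e] ->; rewrite size_rcons e.
Qed.

Lemma mem_ideals j l : (l \in ideals j) =
  (size l == j.+1) && all (fun i => ok i (nth false l i) (nth false l i.+1)) (iota 0 j).
Proof.
elim: j l => [|j IH] l; first by case: l => [|[] [|? ?]].
case/lastP: l => [|l c].
  by apply/negbTE/negP => /size_ideals.
rewrite [ideals _]/= mem_cat !mem_map_rcons !mem_filter IH size_rcons eqSS.
case: (size l =P j.+1) => [sl|_]; last by rewrite /= !andbF.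
rewrite -[in RHS]addn1 iotaD all_cat /= add0n andbT !nth_rcons sl ltnSn ltnn eqxx.
rewrite -[j in nth false l j]/(j.+1.-1) -sl nth_last.
have -> : all (fun i => ok i (nth false (rcons l c) i) (nth false (rcons l c) i.+1)) (iota 0 j) =
  all (fun i => ok i (nth false l i) (nth false l i.+1)) (iota 0 j).
  apply: eq_in_all => i; rewrite mem_iota /= add0n => ij.
  by rewrite !nth_rcons sl !ltnS ij (ltnW ij).
by case: c; rewrite /= ?orbF ?andbF ?orFb andbC.
Qed.

Lemma ideals_uniq j : uniq (ideals j).
Proof.
elim: j => [//|j IH] /=; rewrite cat_uniq !map_inj_uniq ?filter_uniq //; try exact: rcons_injl.
rewrite andbT /=; apply/hasPn => l /mapP[l' _ ->].
by rewrite /= mem_map_rcons.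
Qed.

Definition expo (l : seq bool) : vec := \sum_(i < size l) tilev i (nth false l i).

Lemma expo_rcons l c : expo (rcons l c) = expo l + tilev (size l) c.
Proof.
rewrite /expo size_rcons big_ord_recr /= nth_rcons ltnn eqxx; congr (_ + _).
by apply: eq_bigr => i _; rewrite nth_rcons ltn_ord.
Qed.

Lemma expo_ideal j l c : l \in ideals j -> expo (rcons l c) = expo l + tilev j.+1 c.
Proof. by move=> /size_ideals e; rewrite expo_rcons e. Qed.

Section Sum.
Variable A : zmodType.
Implicit Type G : vec -> A.

Lemma big_fanW j G : \sum_(v <- fanW j (fanPQ j)) G (v - bot a (w j)) =
  \sum_(v <- (fanPQ j).1) G (v + fromP j) + \sum_(v <- (fanPQ j).2) G (v + fromQ j).
Proof.
rewrite /fanW big_cat /shift !big_map.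
by congr (_ + _); apply: eq_bigr => v _; rewrite -addrA.
Qed.

Lemma fan_ideals j G : (j < K)%N ->
  \sum_(l <- ideals j | last false l) G (expo l) = \sum_(v <- (fanPQ j).1) G (v + fromP j) /\
  \sum_(l <- ideals j | ~~ last false l) G (expo l) = \sum_(v <- (fanPQ j).2) G (v + fromQ j).
Proof.
elim: j G => [|j IH] G jK.
  have [e1 e2] := tile0.
  rewrite /= !big_cons !big_nil /= !addr0 /expo !big_ord_recl !big_ord0 /= !addr0.
  by rewrite -e1 -e2.
have jK' := ltnW jK.
have step c : \sum_(l <- ideals j.+1 | last false l == c) G (expo l) =
    \sum_(l <- ideals j | ok j (last false l) c) G (expo l + tilev j.+1 c).
  rewrite [ideals _]/= big_cat !big_map /= !big_filter_cond /=.
  have E d : \sum_(l <- ideals j | ok j (last false l) d && (last false (rcons l d) == c)) G (expo (rcons l d))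
     = if d == c then \sum_(l <- ideals j | ok j (last false l) d) G (expo l + tilev j.+1 d) else 0.
    case: (d =P c) => [<-|/eqP/negbTE dc]; last first.
      by rewrite big_pred0 // => l; rewrite last_rcons dc andbF.
    rewrite (eq_bigl (fun l => ok j (last false l) d)); last by move=> l; rewrite last_rcons eqxx andbT.
    rewrite big_seq_cond [RHS]big_seq_cond; apply: eq_bigr => l /andP[hl _].
    by rewrite (expo_ideal _ hl).
  by rewrite !E; case: (c); rewrite /= ?addr0 ?add0r.
have total (H : vec -> A) : \sum_(l <- ideals j) H (expo l) = \sum_(v <- fanW j (fanPQ j)) H (v - bot a (w j)).
  have [e1 e2] := IH H jK'.
  by rewrite big_fanW -e1 -e2 [LHS](bigID (fun l => last false l)).
have lastT l : last false l = (last false l == true) by case: (last _ _).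
have lastF l : ~~ last false l = (last false l == false) by case: (last _ _).
rewrite (eq_bigl _ _ lastT) (eq_bigl _ _ lastF) !step.
have [pw wq pq] := tile_neq htau hg hgT i0 jK'.
have e := tileS jK; move: e; rewrite [fanPQ j.+1]/=.
(* With a shared outer end, a twisted tile [j.+1] puts no condition on the tile [j], and an
   untwisted one forces it to be untwisted; with a shared inner end the roles are exchanged. *)
case: (step_cases htau hg hgT i0 jK) => -[h ep eq eu]; rewrite ?h ?(negbTE h) ep ?eqxx ?(negbTE pw) /= => -[e1 e2].
  split.
    rewrite (eq_bigl xpredT); last by move=> l; rewrite /ok h implybT.
    rewrite (total (fun v => G (v + _))); apply: eq_bigr => v _.
    by rewrite -addrA [- _ + _]addrC e1.
  rewrite (eq_bigl (fun l => ~~ last false l)); last by move=> l; rewrite /ok h implybF.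
  rewrite (IH (fun v => G (v + _)) jK').2; apply: eq_bigr => v _.
  by rewrite -addrA e2.
split; last first.
  rewrite (eq_bigl xpredT); last by move=> l; rewrite /ok (negbTE h).
  rewrite (total (fun v => G (v + _))); apply: eq_bigr => v _.
  by rewrite -addrA [- _ + _]addrC e1.
rewrite (eq_bigl (fun l => last false l)); last by move=> l; rewrite /ok (negbTE h).
rewrite (IH (fun v => G (v + _)) jK').1; apply: eq_bigr => v _.
by rewrite -addrA e2.
Qed.

End Sum.

(** Reading off the twists identifies perfect matchings with ideals, and [nu] is additive over the
    tiles, so [fan_ideals] applies once the ideals are split by their last bit. *)
Lemma snake_sum_fan (D : unitRingType) (Mq : vec -> D) :
  snake_sum tau gamma Mq = \sum_(v <- fanW K.-1 (fanPQ K.-1)) Mq (v - bot a (w K.-1)).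
Proof.
have K0 := cs_nonempty htau hg hgT; have eK := prednK K0.
have jK : (K.-1 < K)%N by rewrite eK.
pose h l := hP tau gamma (nth false l).
have cl l : l \in ideals K.-1 -> closedI tau gamma (nth false l).
  rewrite mem_ideals => /andP[_ /allP hl]; apply/closedI_ok => j jK1.
  by apply: hl; rewrite mem_iota /= add0n; move: jK1 eK; clear; lia.
have uh : uniq [seq h l | l <- ideals K.-1].
  rewrite map_inj_in_uniq ?ideals_uniq // => l l' /size_ideals sl /size_ideals sl' e.
  apply: (@eq_from_nth _ false) => [|j]; rewrite sl // eK => hj.
  by rewrite -(bitsP_hP (tau := tau) (gamma := gamma) (nth false l) hj) -/(h l) e bitsP_hP.
transitivity (\sum_(P <- [seq h l | l <- ideals K.-1]) Mq (nu P)).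
  rewrite big_uniq //; apply: eq_bigl => P; apply/idP/mapP => [/(perfect_hP K0)[c e]|[l /cl c ->]].
    pose l := mkseq (bitsP P) K; exists l.
      rewrite mem_ideals size_mkseq eK eqxx; apply/allP => i; rewrite mem_iota /= add0n => iK.
      have iK1 : (i.+1 < K)%N by move: iK eK; clear; lia.
      by rewrite !nth_mkseq ?(ltnW iK1) //; apply: (proj1 (closedI_ok _) c).
    by rewrite {1}e; apply: eq_hP => i iK; rewrite nth_mkseq.
  exact: hP_perfect.
rewrite big_map; have [e1 e2] := fan_ideals Mq jK.
transitivity (\sum_(l <- ideals K.-1) Mq (expo l)); last first.
  by rewrite big_fanW -e1 -e2 [LHS](bigID (fun l => last false l)).
apply: eq_big_seq => l hl; rewrite /h (nu_tiles htau hg hgT i0 (cl l hl)) /expo.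
by rewrite (size_ideals hl) eK.
Qed.

End Snake.

Theorem mainTheorem2
  (n : nat) (hn : (0 < n)%N)
  (tau : 'I_n -> pairV n)
  (hT : triangulation tau)
  (hA : quiver_typeA (Btilde tau))
  (* ambient division ring D (e.g. the skew field of fractions of the
     quantum torus) *)
  (D : unitRingType)
  (hD : forall x : D, x != 0 -> x \is a GRing.unit)
  (* t = q^{1/2} and the based quantum torus M[a], a in Z^{2n}, inside D *)
  (t : D) (Mq : 'rV[int]_(n + n) -> D)
  (hM0 : Mq 0 = 1)
  (hMmul : forall a b : 'rV[int]_(n + n),
      Mq a * Mq b = t ^ (qform (Lprin tau) a b) * Mq (a + b))
  (htc : forall a : 'rV[int]_(n + n), t * Mq a = Mq a * t)
  (hfree : forall (s : seq (int * 'rV[int]_(n + n)))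
                  (c : int * 'rV[int]_(n + n) -> int),
      uniq s -> \sum_(p <- s) (c p)%:~R * (t ^ p.1 * Mq p.2) = 0 ->
      forall p, p \in s -> c p = 0)
  (* an arc gamma not in T, reached as the k-th arc after the flips s *)
  (gamma : pairV n) (hg : is_arc gamma) (hgT : ~~ in_T tau gamma)
  (s : seq 'I_n) (k : 'I_n) (hk : flips tau s k = gamma) :
  sX (seeds t tau Mq s) (lshift n k) = snake_sum tau gamma Mq.
Proof.
have K0 := cs_nonempty hT hg hgT.
have A1 j i0 : (j < size (cs tau gamma))%N ->
    tau (nth i0 (cs tau gamma) j) = sd (pp tau gamma k j) (qq tau gamma k j).
  by move=> jK; rewrite (set_nth_default k) // (cs_arc hT hg hgT k jK).
have A2 j : (j < size (cs tau gamma))%N -> present tau (pp tau gamma k j) (wT tau gamma j) /\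
    present tau (wT tau gamma j) (qq tau gamma k j).
  by case/(next_tile hT hg hgT k).
have A5 j (jK : (j.+1 < size (cs tau gamma))%N) := let: And4 _ _ _ h := next_tile hT hg hgT k (ltnW jK) in h jK.
have [e1 e2] := fan_last hT hD hM0 hMmul htc hfree A1 A2 (@tile_cyc _ _ hT _ hg hgT k)
  (first_triangle hT hg hgT k) A5 (cs_uniq tau gamma) k K0.
rewrite (snake_sum_fan hT hg hgT k) -[RHS]e2.
(* Flipping the crossed arcs in order also ends at [gamma], so the variable reached through [s] is
   the one expanded along the fan. *)
apply: (cluster_variable_of_arc hT hD hM0 hMmul htc hfree).
by rewrite hk e1 /wT eqxx; apply: sd_surj.
Qed.
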